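(* For all $l\in\mathbb Z_{\ge0}\cup\{\infty\}$ and $(a_1,a_2,a_3,a_4)\in[0,\infty]^4$ with $l\le a_1\le a_2\le a_3\le a_4$, the set $\mathscr D(l,a_1,a_2,a_3,a_4)$ is path-connected, infinite-dimensional, and dense in $\mathscr M$.
   Context: $\mathscr M$ is the set of all isometry classes of non-empty compact metric spaces, equipped with the Gromov–Hausdorff distance $\mathcal{GH}$ (the infimum of the Hausdorff distances between $i(X)$ and $j(Y)$ over all isometric embeddings $i:X\to Z$, $j:Y\to Z$ into a common metric space $Z$). Subsets of $\mathscr M$ carry the topology induced by $\mathcal{GH}$. A topological space is infinite-dimensional if its topological (covering) dimension is infinite. $\mathscr D(l,a_1,a_2,a_3,a_4)\subset\mathscr M$ is the set of all compact metric spaces $(X,d)$ with $\dim_TX=l$, $\dim_H(X,d)=a_1$, $\dim_P(X,d)=a_2$, $\overline{\dim}_B(X,d)=a_3$, $\dim_A(X,d)=a_4$, where the dimensions are as follows. $\dim_T X$ is the topological (covering) dimension of $X$. $B(x,r)$ denotes the closed ball with center $x$ and radius $r$, and subsets carry the restricted metric. Hausdorff dimension: for $s\in[0,\infty)$ and $\delta>0$ let $\mathcal H^s_\delta(A)=\inf\{\sum_{i\ge1}\mathrm{diam}(A_i)^s : A\subset\bigcup_{i\ge 1}A_i,\ \mathrm{diam}(A_i)<\delta\}$ and $\mathcal H^s(A)=\sup_{\delta>0}\mathcal H^s_\delta(A)$; then $\dim_H(X,d)=\inf\{s\in[0,\infty):\mathcal H^s(X)=0\}$ (with $\inf\emptyset=\infty$).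 Packing dimension (radius-type): for $A\subset X$, $s\in[0,\infty)$ and $\delta>0$, let $\widetilde{\mathcal P}^s_\delta(A)$ be the supremum of $\sum_i r_i^s$ over all finite or countable sequences $\{r_i\}$ in $(0,\delta)$ for which there are points $x_i\in A$ such that the closed balls $B(x_i,r_i)$ are pairwise disjoint. Put $\widetilde{\mathcal P}^s_0(A)=\inf_{\delta>0}\widetilde{\mathcal P}^s_\delta(A)$ and $\mathcal P^s(A)=\inf\{\sum_{i\ge1}\widetilde{\mathcal P}^s_0(S_i): A\subset\bigcup_{i\ge1}S_i\}$; then $\dim_P(X,d)=\inf\{s\in[0,\infty):\mathcal P^s(X)=0\}$ (with $\inf\emptyset=\infty$). Upper box dimension: $N_d(X,r)$ is the least cardinality of a subset $A\subset X$ with $X=\bigcup_{a\in A}B(a,r)$, and $\overline{\dim}_B(X,d)=\limsup_{r\to0}\frac{\log N_d(X,r)}{-\log r}$. Assouad dimension: $\dim_A(X,d)$ is the infimum of all $\lambda\in(0,\infty)$ for which there is $C\in(0,\infty)$ such that $N_d(B(x,R),r)\le C(R/r)^\lambda$ for all $x\in X$ and all $R>r>0$; it is $\infty$ if no such $\lambda$ exists. *)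

(* Defs.v *)
From HB Require Import structures.
From mathcomp Require Import all_boot all_order all_algebra generic_quotient.
From mathcomp Require Import all_classical all_reals all_analysis.

Set Implicit Arguments.
Unset Strict Implicit.
Unset Printing Implicit Defensive.

Import Order.TTheory GRing.Theory Num.Theory.
Import numFieldTopology.Exports numFieldNormedType.Exports.

Local Open Scope classical_set_scope.
Local Open Scope ring_scope.
Local Open Scope quotient_scope.

Section Topology.
Variables (R : realType) (T : topologicalType).

Definition open_cover (U : set (set T)) : Prop :=
  U `<=` open /\ \bigcup_(A in U) A = setT.

Definition refines (V U : set (set T)) : Prop :=
  forall B, V B -> exists2 A, U A & B `<=` A.

(* Any [m.+1] distinct members have empty intersection, that is, every point
   lies in at most [m] members. *)
Definition multiplicity_le (m : nat) (V : set (set T)) : Prop :=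
  forall F : 'I_m.+1 -> set T, injective F -> (forall i, V (F i)) ->
    \bigcap_i F i = set0.

(* "dim_T T <= m - 1"; the shift makes m = 0 say that T is empty. *)
Definition covering_dim_lt (m : nat) : Prop :=
  forall U, finite_set U -> open_cover U ->
    exists V, [/\ finite_set V, open_cover V, refines V U & multiplicity_le m V].

Definition dim_T : \bar R :=
  ereal_inf [set (m%:R - 1)%:E | m in covering_dim_lt].

Definition infinite_dimensional : Prop := dim_T = +oo%E.

Definition path_connected (A : set T) : Prop :=
  forall x y, A x -> A y ->
    exists g : R -> T, [/\ {within `[0, 1], continuous g},
      g 0 = x, g 1 = y & g @` `[0, 1] `<=` A].

End Topology.
Arguments dim_T R T : clear implicits.
Arguments infinite_dimensional R T : clear implicits.
Arguments path_connected R {T} A.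

Section MetricDimensions.
Variables (R : realType) (X : metricType R).
Implicit Types (A S : set X) (x : X).

(* The library's [closed_ball] is the closure of the open ball, which may be
   strictly smaller. *)
Definition cball x (r : R) : set X := [set y | mdist x y <= r].

(* 0 is adjoined so that the empty set has diameter 0. *)
Definition diam A : \bar R :=
  ereal_sup (0%E |` [set (mdist p.1 p.2)%:E | p in A `*` A]).

(* diam(A)^s with the conventions diam(set0)^s = 0 and 0^0 = 1, so that s = 0
   gives the counting measure. *)
Definition diam_pow (s : R) A : \bar R :=
  if A == set0 then 0%E else (diam A `^ s)%E.

Definition hausdorff_pre (s delta : R) A : \bar R :=
  ereal_inf [set (\sum_(i <oo) diam_pow s (S i))%E
    | S in [set S : nat -> set X |
        A `<=` \bigcup_i S i /\ forall i, (diam (S i) < delta%:E)%E]].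

Definition hausdorff_meas (s : R) A : \bar R :=
  ereal_sup [set hausdorff_pre s delta A | delta in [set delta | 0 < delta]].

Definition dim_H : \bar R :=
  ereal_inf [set s%:E | s in [set s : R | 0 <= s /\ hausdorff_meas s setT = 0%E]].

(* Finite or countable sequences are families indexed by an arbitrary subset
   [I] of nat; the balls are balls of the ambient space X. *)
Definition packing_pre (s delta : R) A : \bar R :=
  ereal_sup [set z | exists (I : set nat) (r : nat -> R) (c : nat -> X),
    [/\ forall i, I i -> 0 < r i < delta,
        forall i, I i -> A (c i),
        trivIset I (fun i => cball (c i) (r i))
      & z = \esum_(i in I) (r i `^ s)%:E]].

Definition packing_pre0 (s : R) A : \bar R :=
  ereal_inf [set packing_pre s delta A | delta in [set delta | 0 < delta]].

Definition packing_meas (s : R) A : \bar R :=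
  ereal_inf [set (\sum_(i <oo) packing_pre0 s (S i))%E
    | S in [set S : nat -> set X | A `<=` \bigcup_i S i]].

Definition dim_P : \bar R :=
  ereal_inf [set s%:E | s in [set s : R | 0 <= s /\ packing_meas s setT = 0%E]].

(* N(S, r) for S with the restricted metric: the centres must lie in S. The
   value is +oo if no finite set of centres suffices. *)
Definition covering_number S (r : R) : \bar R :=
  ereal_inf [set n%:R%:E | n in [set n : nat | exists A : set X,
    [/\ A `<=` S, (A #= `I_n)%card & S `<=` \bigcup_(a in A) cball a r]]].

Definition upper_dim_B : \bar R :=
  limf_esup (fun r : R => lne (covering_number setT r) * ((- ln r)^-1)%:E)%E
    (0 : R)^'+.

Definition dim_A : \bar R :=
  ereal_inf [set lam%:E | lam in [set lam : R | 0 < lam /\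
    exists2 C : R, 0 < C &
      forall (x : X) (rho r : R), 0 < r -> r < rho ->
        (covering_number (cball x rho) r <= (C * (rho / r) `^ lam)%:E)%E]].

End MetricDimensions.

Definition isometric_embedding (R : realType) (X Y : metricType R)
    (f : X -> Y) : Prop :=
  forall x y, mdist (f x) (f y) = mdist x y.

Definition isometric (R : realType) (X Y : metricType R) : Prop :=
  exists2 f : X -> Y, bijective f & isometric_embedding f.

Definition hausdorff_dist (R : realType) (Z : metricType R) (A B : set Z) :
    \bar R :=
  maxe (ereal_sup [set ereal_inf [set (mdist a b)%:E | b in B] | a in A])
       (ereal_sup [set ereal_inf [set (mdist a b)%:E | a in A] | b in B]).

Definition gh_dist (R : realType) (X Y : metricType R) : \bar R :=
  ereal_inf [set h | exists (Z : metricType R) (i : X -> Z) (j : Y -> Z),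
    [/\ isometric_embedding i, isometric_embedding j
      & h = hausdorff_dist (range i) (range j)]].

(* The carrier and the metric structure are separate fields, instead of one
   field of type [metricType R], so that the carrier lives in its own universe,
   below that of [Metric.type]: the isometry classes then form a type small
   enough to be a [topologicalType]. Every compact metric space has at most the
   cardinality of the continuum, so no isometry class is lost. *)
Record compactMetric (R : realType) := CompactMetric {
  cm_carrier :> Type;
  cm_class : Metric R cm_carrier;
  cm_nonempty : [set: cm_carrier] !=set0;
  cm_compact : compact [set: Metric.Pack cm_class] }.

HB.instance Definition _ (R : realType) (X : compactMetric R) :
  Metric R (cm_carrier X) := cm_class X.

HB.instance Definition _ (R : realType) := gen_eqMixin (compactMetric R).
HB.instance Definition _ (R : realType) := gen_choiceMixin (compactMetric R).

Section IsometryClasses.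
Variable R : realType.

Definition isometricb : rel (compactMetric R) :=
  fun X Y => `[< isometric X Y >].

Lemma isometricb_refl : reflexive isometricb.
Proof. by move=> X; apply/asboolP; exists id => //; exists id. Qed.

Lemma isometricb_sym : symmetric isometricb.
Proof.
move=> X Y; apply/asboolP/asboolP => -[f [g fK gK] fi];
  (exists g; first by exists f) => x y; by rewrite -fi !gK.
Qed.

Lemma isometricb_trans : transitive isometricb.
Proof.
move=> Y X Z /asboolP[f fb fi] /asboolP[g gb gi]; apply/asboolP.
exists (g \o f); first exact: bij_comp.
by move=> x y; rewrite /= gi fi.
Qed.

Canonical isometry_rel :=
  EquivRel isometricb isometricb_refl isometricb_sym isometricb_trans.

Definition GH_space : Type := {eq_quot isometry_rel}.

HB.instance Definition _ := Quotient.copy GH_space {eq_quot isometry_rel}.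
HB.instance Definition _ := Choice.copy GH_space {eq_quot isometry_rel}.

Definition isometry_class (X : compactMetric R) : GH_space := \pi_GH_space X.

Definition GH (x y : GH_space) : \bar R := gh_dist (repr x) (repr y).

Definition GH_open (U : set GH_space) : Prop :=
  forall x, U x -> exists2 e : R, 0 < e & [set y | (GH x y < e%:E)%E] `<=` U.

Lemma GH_openT : GH_open setT.
Proof. by move=> x _; exists 1. Qed.

Lemma GH_openI : setI_closed GH_open.
Proof.
move=> U V oU oV x [/oU[e e0 eU] /oV[d d0 dV]].
exists (Num.min e d); first by rewrite lt_min e0.
move=> y /= xy; split.
- by apply: eU; apply: lt_le_trans xy _; rewrite lee_fin ge_min lexx.
- by apply: dV; apply: lt_le_trans xy _; rewrite lee_fin ge_min lexx orbT.
Qed.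

Lemma GH_open_bigU (I : Type) (f : I -> set GH_space) :
  (forall i, GH_open (f i)) -> GH_open (\bigcup_i f i).
Proof.
move=> fo x [i _ /fo[e e0 ef]]; exists e => // y xy.
by exists i => //; exact: ef.
Qed.

HB.instance Definition _ :=
  isOpenTopological.Build GH_space GH_openT GH_openI GH_open_bigU.

Definition D_set (l a1 a2 a3 a4 : \bar R) : set GH_space :=
  [set isometry_class X | X in [set X : compactMetric R |
    [/\ dim_T R X = l, dim_H X = a1, dim_P X = a2, upper_dim_B X = a3
      & dim_A X = a4]]].

End IsometryClasses.

(* Main.v *)
(* All five dimensions of a wedge of two rescaled spaces are the maxima of those
   of the pieces. Hence a rescaled wedge joins any two members of the set by a
   path inside it; wedging a finite net of an arbitrary compact space with a
   tiny member gives density; and wedging finite spaces parametrized by the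
   n-cube with a tiny member embeds the n-cube in a way that numbers of
   separated points can detect, so that the covering dimension is at least n by
   Lebesgue's covering theorem. A member of the set is the wedge of a cube of
   dimension l and of four Boolean sequence spaces with weighted sup distances:
   in the i-th one, the i-th of the Hausdorff, packing, box and Assouad
   dimensions has the prescribed value, the earlier ones vanish, and the later
   ones are not larger than that value. *)

(* All metric dimensions are read off separated lists, which are monotone under inclusion, unlike
   covers whose centres must lie in the covered set. Each dimension has a growth predicate ([hpow],
   [ppow], [bpow], [apow]) that follows from dimension < s and implies dimension <= s, so dimensions
   are compared at real exponents slightly too large. The two parts of a wedge stay at a positive
   distance, hence are clopen, which makes the covering dimension of a wedge elementary. The
   covering theorem is stated for a map from the cube into a space with two families of open sets,
   so that it bounds the dimension of the target directly. In the Boolean spaces everything compares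
   k ln 2 with the rate L k, where expR (- L k) is the k-th weight: one good scale decides the
   Hausdorff dimension, the worst scales the box dimension and the worst blocks [i, k) the Assouad
   dimension. Raising the rate at chosen places lowers some of these and keeps others. Packing and
   box dimension cannot be told apart in this way in a full sequence space, so the box piece is made
   countable instead. *)
Require Import Defs.
From HB Require Import structures.
From mathcomp Require Import all_boot all_fingroup all_order all_algebra.
From mathcomp Require Import generic_quotient.
From mathcomp Require Import all_classical all_reals all_analysis.
From mathcomp Require Import zify lra.

Set Implicit Arguments.
Unset Strict Implicit.
Unset Printing Implicit Defensive.

Import Order.TTheory GRing.Theory Num.Theory.
Import numFieldTopology.Exports numFieldNormedType.Exports.

Local Open Scope classical_set_scope.
Local Open Scope ring_scope.

(* Compact spaces are built from distances on small carriers: the carrier of a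
   [metricType] lives in too large a universe for [compactMetric]. *)
Record dspace (R : realType) := DSpace {
  dcar : Type;
  ddist : dcar -> dcar -> R;
  ddistxx : forall x, ddist x x = 0;
  ddist_eq0 : forall x y, ddist x y = 0 -> x = y;
  ddist_sym : forall x y, ddist x y = ddist y x;
  ddist_tri : forall y x z, ddist x z <= ddist x y + ddist y z }.
Arguments ddist {R} d _ _.

Definition dtype (R : realType) (M : dspace R) := dcar M.

HB.instance Definition _ (R : realType) (M : dspace R) :=
  gen_eqMixin (dtype M).
HB.instance Definition _ (R : realType) (M : dspace R) :=
  gen_choiceMixin (dtype M).
HB.instance Definition _ (R : realType) (M : dspace R) :=
  isMetric.Build R (dtype M) (@ddistxx R M) (@ddist_eq0 R M) (@ddist_sym R M)
    (@ddist_tri R M).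

Section GHspace.
Variable R : realType.

Lemma mdist_ddist (M : dspace R) (x y : dtype M) : mdist x y = ddist M x y.
Proof. by []. Qed.

Definition cspace (M : dspace R) (ne : [set: dtype M] !=set0)
    (co : compact [set: dtype M]) : compactMetric R :=
  @CompactMetric R (dtype M) (Metric.class (dtype M)) ne co.

End GHspace.

(** * Kuhn's cubical Sperner lemma *)

Section Kuhn.

(* A facet of a simplex is a door when it carries all labels below [d]; a
   rainbow simplex has one door, any other simplex has zero or two. *)
Lemma doors_parity (d : nat) (L : 'I_d.+1 -> nat) :
  (forall k, L k <= d)%N ->
  \big[addb/false]_(j < d.+1)
     [forall c : 'I_d, exists k : 'I_d.+1, (k != j) && (L k == c)] =
  [forall c : 'I_d.+1, exists k : 'I_d.+1, L k == c].
Proof.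
move=> Ld.
pose door (j : 'I_d.+1) :=
  [forall c : 'I_d, exists k : 'I_d.+1, (k != j) && (L k == c)].
(* Choosing a vertex for each of the d labels injects the labels into the d vertices other than [j],
   so it exhausts them and the labels on a door are distinct. *)
have doorL j : door j -> forall k1 k2, k1 != j -> k2 != j -> L k1 = L k2 ->
    k1 = k2.
  move=> /forallP dj.
  pose f (c : 'I_d) : 'I_d.+1 := xchoose (existsP (dj c)).
  have fP c : f c != j /\ L (f c) = c.
    by have /andP[? /eqP] := xchooseP (existsP (dj c)).
  have finj : injective f.
    by move=> a b ab; apply: val_inj; rewrite /= -(fP a).2 -(fP b).2 ab.
  have imf : [set f c | c in [set: 'I_d]]%SET = [set~ j]%SET.
    apply/eqP; rewrite eqEcard; apply/andP; split.
      by apply/fintype.subsetP => k /imsetP[c _ ->]; rewrite !inE (fP c).1.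
    by rewrite (card_imset _ finj) cardsC1 card_ord cardsT card_ord.
  move=> k1 k2 k1j k2j.
  have : k1 \in [set~ j]%SET by rewrite !inE.
  have : k2 \in [set~ j]%SET by rewrite !inE.
  rewrite -imf => /imsetP[c2 _ ->] /imsetP[c1 _ ->].
  by rewrite (fP c1).2 (fP c2).2 => cc; congr f; exact: val_inj.
have doorN j k : door j -> k != j -> (L k < d)%N.
  move=> dj kj; rewrite ltn_neqAle Ld andbT; apply/negP => /eqP Lk.
  pose f (c : 'I_d) : 'I_d.+1 := xchoose (existsP (forallP dj c)).
  have fP c : f c != j /\ L (f c) = c.
    by have /andP[? /eqP] := xchooseP (existsP (forallP dj c)).
  have finj : injective f.
    by move=> a b ab; apply: val_inj; rewrite /= -(fP a).2 -(fP b).2 ab.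
  have : (#|[set f c | c in [set: 'I_d]]%SET| < d)%N.
    have sub : ([set f c | c in [set: 'I_d]] \subset ~: [set j; k])%SET.
      apply/fintype.subsetP => x /imsetP[c _ ->]; rewrite !inE negb_or (fP c).1 /=.
      apply/eqP => fk; have := (fP c).2; rewrite fk Lk => dc.
      by have := ltn_ord c; rewrite -dc ltnn.
    have := subset_leq_card sub; have := cardsC [set j; k]%SET.
    rewrite cards2 card_ord eq_sym kj /=; lia.
  by rewrite (card_imset _ finj) cardsT card_ord ltnn.
have [R|NR] := boolP [forall c : 'I_d.+1, exists k : 'I_d.+1, L k == c].
  pose f (c : 'I_d.+1) : 'I_d.+1 := xchoose (existsP (forallP R c)).
  have fP c : L (f c) = c by have /eqP := xchooseP (existsP (forallP R c)).
  have finj : injective f.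
    by move=> a b ab; apply: val_inj; rewrite /= -(fP a) -(fP b) ab.
  have fsurj k : exists c, k = f c.
      have [g fK gK] := injF_bij finj.
    by exists (g k); rewrite gK.
  rewrite (bigD1 (f ord_max)) //= big1 ?addbF.
    apply/forallP => c; apply/existsP.
    exists (f (widen_ord (leqnSn d) c)); rewrite fP eqxx andbT.
    apply/eqP => /finj /(congr1 val) /= cd; by have := ltn_ord c; rewrite cd ltnn.
  move=> j jm; apply/negP => /doorN - /(_ (f ord_max)).
  by rewrite fP /= ltnn eq_sym; move/(_ jm).
have [[j0 dj0]|nd] := pselect (exists j, door j); last first.
  by rewrite big1 // => j _; apply/negP => dj; apply: nd; exists j.
have Lj0 : (L j0 < d)%N.
  rewrite ltn_neqAle Ld andbT; apply/negP => /eqP Lj0d.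
  case/negP: NR; apply/forallP => c; apply/existsP.
  have [cd|dc] := ltnP c d.
    have /existsP[k /andP[_ /eqP kc]] := forallP dj0 (Ordinal cd).
    by exists k; rewrite kc.
  exists j0; rewrite Lj0d; apply/eqP; have := ltn_ord c; lia.
(* [k0] is the other vertex with the label of [j0]. Exchanging the two gives the second door; the
   facet of a third door would contain both, against [doorL]. *)
have /existsP[k0 /andP[k0j0 /eqP /= k0c]] := forallP dj0 (Ordinal Lj0).
have dk0 : door k0.
  apply/forallP => c; apply/existsP.
  have /existsP[k /andP[kj kc]] := forallP dj0 c.
  have [kk|kk] := eqVneq k k0; last by exists k; rewrite kk.
  by exists j0; rewrite eq_sym k0j0 -k0c -kk.
rewrite (bigD1 j0) //= (bigD1 k0) //= big1 => [|j /andP[jj0 jk0]].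
  by rewrite -/(door _) -/(door _) dj0 dk0.
apply/negP => dj.
by have := doorL _ dj _ _ _ _ k0c; rewrite ![_ == j]eq_sym => /(_ jk0 jj0) kk;
   rewrite kk eqxx in k0j0.
Qed.

Variables (n N : nat) (phi : ('I_n -> nat) -> nat).
Hypothesis N0 : (0 < N)%N.
Hypothesis phi_le : forall x, (phi x <= n)%N.
Hypothesis phi0 : forall x i, x i = 0%N -> (phi x <= i)%N.
Hypothesis phiN : forall x i, x i = N -> phi x != i.

Implicit Types (v : {ffun 'I_n -> 'I_N.+1}) (s : 'S_n).

(* Kuhn's triangulation of the grid: the simplex (v, s) starts at v and steps in
   the directions s 0, s 1, ... in turn; those with [ksimp d v s] triangulate
   the face where the coordinates from [d] on vanish. *)
Definition kvert v s (k : nat) : 'I_n -> nat :=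
  fun i => (v i + (s^-1%g i < k))%N.

Definition ksimp d v s : bool :=
  [forall i : 'I_n, if (i < d)%N then (v i < N)%N else v i == ord0]
  && [forall i : 'I_n, (d <= i)%N ==> (s i == i)].

Definition kdoor d v s (j : nat) : bool :=
  [forall c : 'I_d, exists k : 'I_d.+1,
     ((k : nat) != j) && (phi (kvert v s k) == c)].

Definition krainbow d v s : bool :=
  [forall c : 'I_d.+1, exists k : 'I_d.+1, phi (kvert v s k) == c].

(** Multiplication by a transposition exchanges even and odd permutations, so the terms cancel in
    pairs modulo 2. *)
Lemma sum_tperm (a b : 'I_n) (P : pred 'S_n) (g : 'S_n -> bool) : a != b ->
  (forall s, P (tperm a b * s)%g = P s) ->
  (forall s, P s -> g (tperm a b * s)%g = g s) ->
  \big[addb/false]_(s | P s) g s = false.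
Proof.
move=> ab Pt gt; rewrite (bigID (fun s => odd_perm s)) /=.
rewrite (reindex_inj (mulgI (tperm a b))) /=.
rewrite [X in X (+) _](_ : _ = \big[addb/false]_(s | P s && ~~ odd_perm s) g s).
  by rewrite addbb.
apply: eq_big => [s|s]; first by rewrite Pt odd_permM odd_tperm ab.
by rewrite Pt => /andP[Ps _]; exact: gt.
Qed.

Lemma ksimp_s d v s (i : 'I_n) : ksimp d v s -> (d <= i)%N -> s i = i.
Proof. by move=> /andP[_ /forallP/(_ i)/implyP/[apply]/eqP]. Qed.

Lemma ksimp_sV d v s (i : 'I_n) : ksimp d v s -> (d <= i)%N -> s^-1%g i = i.
Proof. by move=> ks di; rewrite -{1}(ksimp_s ks di) permK. Qed.

Lemma ksimp_lt d v s (i : 'I_n) : ksimp d v s -> (s i < d)%N = (i < d)%N.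
Proof.
move=> ks; have [di|di] := leqP d i.
  by rewrite (ksimp_s ks di) ltnNge di.
rewrite ltnNge; apply/negP => dsi.
by have /perm_inj si := ksimp_s ks dsi; rewrite si leqNgt di in dsi.
Qed.

(** Exchanging the steps just before and just after vertex [j] moves only that vertex, so the
    opposite facet is shared by two simplices with the same start. *)
Lemma kdoor_middle d v (j : nat) : (d <= n)%N -> (0 < j < d)%N ->
  \big[addb/false]_(s | ksimp d v s) kdoor d v s j = false.
Proof.
move=> dn /andP[j0 jd].
have j1n : (j.-1 < n)%N by lia.
have jn : (j < n)%N by lia.
apply: (@sum_tperm (Ordinal j1n) (Ordinal jn)).
- by apply/eqP => /(congr1 val) /=; lia.
- move=> s; rewrite /ksimp; congr andb; apply: eq_forallb => i.
  have [di|//] := boolP (d <= i)%N; rewrite /= permM tpermD //;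
    by apply/eqP => /(congr1 val) /=; lia.
move=> s _; apply: eq_forallb => c; apply: eq_existsb => k.
have [//|kj] := eqVneq (k : nat) j; rewrite /=; congr (phi _ == _).
apply/funext => i; rewrite /kvert invMg tpermV permM; congr (_ + nat_of_bool _)%N.
case: tpermP => [->|->|//] /=; lia.
Qed.

Section kuhn_step.
Variables (d : nat) (dn : (d < n)%N).

Let e : 'I_n := Ordinal dn.
Let z : 'I_n := Ordinal (leq_ltn_trans (leq0n d) dn).

(** The cycle 0 -> 1 -> ... -> d -> 0, larger indices being fixed. [krot * s] takes the directions
    of [s] from the second one on, and [s z] after them as step d. *)
Definition krot_fun (p : 'I_n) : 'I_n :=
  if (p < d)%N then insubd z p.+1 else if p == e then z else p.

Lemma krot_fun_lt (p : 'I_n) : (p < d)%N -> val (krot_fun p) = p.+1.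
Proof. by move=> pd; rewrite /krot_fun pd val_insubd (leq_ltn_trans pd). Qed.

Lemma krot_fun_e : krot_fun e = z.
Proof. by rewrite /krot_fun /= ltnn eqxx. Qed.

Lemma krot_fun_gt (p : 'I_n) : (d < p)%N -> krot_fun p = p.
Proof.
move=> dp; rewrite /krot_fun ltnNge ltnW //=; case: eqP => // pe.
by rewrite pe /= ltnn in dp.
Qed.

Lemma krot_inj : injective krot_fun.
Proof.
have cs (p : 'I_n) : (p < d)%N \/ p = e \/ (d < p)%N.
  have [|dp|pd] := ltngtP p d; [by left|by right; right|right; left].
  exact: val_inj.
move=> p q.
have [pd|[->|pd]] := cs p; have [qd|[->|qd]] := cs q;
  rewrite ?krot_fun_e ?(krot_fun_gt pd) ?(krot_fun_gt qd) //.
- move=> /(congr1 val); rewrite !krot_fun_lt // => -[]; exact: val_inj.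
- by move=> /(congr1 val); rewrite krot_fun_lt.
- move=> /(congr1 val); rewrite krot_fun_lt //=; lia.
- by move=> /(congr1 val); rewrite krot_fun_lt.
- by move=> qz; rewrite -qz in qd.
- move=> /(congr1 val); rewrite krot_fun_lt //=; lia.
- by move=> pz; rewrite pz in pd.
Qed.

Definition krot : 'S_n := perm krot_inj.

Lemma krotV_z : krot^-1%g z = e.
Proof. by apply: (@perm_inj _ krot); rewrite permKV permE krot_fun_e. Qed.

Lemma krotV_le (q : 'I_n) : (0 < q <= d)%N -> (krot^-1%g q : nat) = q.-1.
Proof.
move=> /andP[q0 qd].
have q1 : (q.-1 < n)%N by exact: leq_ltn_trans (leq_pred _) (ltn_ord _).
suff -> : krot^-1%g q = Ordinal q1 by [].
apply: (@perm_inj _ krot); rewrite permKV permE; apply: val_inj.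
by rewrite krot_fun_lt /=; lia.
Qed.

Lemma krotV_gt (q : 'I_n) : (d < q)%N -> krot^-1%g q = q.
Proof.
by move=> dq; apply: (@perm_inj _ krot); rewrite permKV permE krot_fun_gt.
Qed.

Definition kadd v (i : 'I_n) : {ffun 'I_n -> 'I_N.+1} :=
  [ffun j => if j == i then inord (v j).+1 else v j].
Definition ksub v (i : 'I_n) : {ffun 'I_n -> 'I_N.+1} :=
  [ffun j => if j == i then inord (v j).-1 else v j].

(* The images of the simplices under removal of the first vertex: facets
   with missing direction [s e]. *)
Definition kfacet v s : bool :=
  [forall i : 'I_n, if (i <= d)%N then if i == s e then (0 < v i)%N
     else (v i < N)%N else v i == ord0]
  && [forall i : 'I_n, (d < i)%N ==> (s i == i)].

(** Without its first vertex the walk starts at [kadd v (s z)]. The direction [s z] is not taken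
    again among the first d steps, whence the bound on [k]. *)
Lemma kvert_rot v s k : ksimp d.+1 v s -> (k <= d)%N ->
  kvert (kadd v (s z)) (krot * s)%g k = kvert v s k.+1.
Proof.
move=> ks kd; apply/funext => i; rewrite /kvert invMg permM ffunE.
have [iz|iz] := eqVneq i (s z).
  rewrite iz permK krotV_z /= [(d < k)%N]ltnNge kd addn0 addn1 inordK //.
  have /andP[/forallP/(_ (s z)) + _] := ks.
  by rewrite (ksimp_lt _ ks) /= -ltnS.
congr (_ + nat_of_bool _)%N.
have q0 : (0 < s^-1%g i)%N.
  rewrite lt0n; apply/eqP => q0; move: iz.
  suff <- : s^-1%g i = z by rewrite permKV eqxx.
  exact: val_inj.
have [qd|qd] := leqP (s^-1%g i) d.
  by rewrite krotV_le ?q0 // -[in RHS](prednK q0) ltnS.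
rewrite krotV_gt // ltnNge (leq_trans kd (ltnW qd)) /= ltnS leqNgt.
by rewrite (leq_ltn_trans kd qd).
Qed.

Lemma kdoor0 v s : ksimp d.+1 v s ->
  kdoor d.+1 v s 0 = krainbow d (kadd v (s z)) (krot * s)%g.
Proof.
move=> ks; apply: eq_forallb => c; apply/existsP/existsP => -[k].
  move=> /andP[k0 kc]; have kd : (k.-1 < d.+1)%N by have := ltn_ord k; lia.
  exists (Ordinal kd); rewrite kvert_rot //= prednK //; lia.
move=> kc; exists (lift ord0 k); move: kc; rewrite kvert_rot //.
by rewrite -ltnS.
Qed.

Lemma kdoor_last v s : kdoor d.+1 v s d.+1 = krainbow d v s.
Proof.
apply: eq_forallb => c; apply/existsP/existsP => -[k].
  move=> /andP[k0 kc]; have kd : (k < d.+1)%N by have := ltn_ord k; lia.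
  by exists (Ordinal kd).
move=> kc; exists (widen_ord (leqnSn _) k); rewrite kc andbT /=.
by have := ltn_ord k; lia.
Qed.

(** [f] sends a simplex to its facet opposite to the first vertex, and [g] puts the vertex back; the
    condition 0 < v i in [kfacet] makes this step back possible. *)
Lemma kfacet_sum :
  \big[addb/false]_(p : {ffun 'I_n -> 'I_N.+1} * 'S_n | ksimp d.+1 p.1 p.2)
     krainbow d (kadd p.1 (p.2 z)) (krot * p.2)%g =
  \big[addb/false]_(p : {ffun 'I_n -> 'I_N.+1} * 'S_n | kfacet p.1 p.2)
     krainbow d p.1 p.2.
Proof.
pose f (p : {ffun 'I_n -> 'I_N.+1} * 'S_n) :=
  (kadd p.1 (p.2 z), (krot * p.2)%g).
pose g (p : {ffun 'I_n -> 'I_N.+1} * 'S_n) :=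
  (ksub p.1 (p.2 e), (krot^-1 * p.2)%g).
have te_le u t : kfacet u t -> (t e <= d)%N.
  move=> /andP[_ /forallP ft]; rewrite leqNgt; apply/negP => dte.
  have /implyP/(_ dte)/eqP/perm_inj te := ft (t e).
  by rewrite te /= ltnn in dte.
rewrite [RHS](reindex_onto f g) /=; last first.
  move=> [u t] /= ut; rewrite /f /g /= mulKVg; congr pair.
  have /andP[/forallP fu _] := ut.
  apply/ffunP => j; rewrite !ffunE permM krotV_z.
  case: eqP => // je; have := fu j; rewrite je eqxx (te_le _ _ ut) => u0.
  have uN := ltn_ord (u (t e)).
  by apply: val_inj; rewrite /= !inordK ?prednK //; lia.
apply: eq_bigl => -[v s]; apply/idP/andP => /= [ks|[]].
  have /andP[/forallP kv /forallP kss] := ks.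
  have szd : (s z < d.+1)%N by rewrite (ksimp_lt _ ks).
  split; last first.
    rewrite /f /g /= mulKg permM permE krot_fun_e; apply/eqP; congr pair.
    apply/ffunP => j; rewrite !ffunE; case: eqP => // ->.
    have := kv (s z); rewrite szd => vN.
    by rewrite [X in inord X.-1]inordK ?ltnS //= inord_val.
  apply/andP; split; apply/forallP => i; rewrite ?permM ?permE ?krot_fun_e /=.
    rewrite ffunE; have := kv i; rewrite ltnS; case: ifP => id1 //.
      by case: (i == s z) => // viN; rewrite inordK.

    by case: (i =P s z) => // iz; rewrite iz -ltnS szd in id1.
  apply/implyP => di; rewrite krot_fun_gt //.
  by have := kss i; rewrite di.
move=> kf _; have := te_le _ _ kf; rewrite /= permM permE krot_fun_e => szd.
have /andP[/forallP fu /forallP fs] := kf.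
apply/andP; split; apply/forallP => i.
  have := fu i; rewrite /= permM permE krot_fun_e ffunE ltnS.
  case: (i =P s z) => [->|_]; last by case: (i <= d)%N.
  rewrite szd => i0; rewrite ltnNge; apply/negP => Nv.
  by move: i0; rewrite /inord /insubd insubF //=; lia.
have := fs i; rewrite /= permM permE; case: ltnP => //= di.
by rewrite krot_fun_gt.
Qed.

(** Rainbow simplices of dimension d + 1 are counted modulo 2 by their doors. A door inside the grid
    belongs to two simplices and cancels. A facet on a wall x_i = N lacks the label i; on a wall x_i
    = 0 all labels are at most i, so a door there has i = d and is a rainbow simplex of the
    d-dimensional face. *)
Lemma kuhn_step :
  \big[addb/false]_(p : {ffun 'I_n -> 'I_N.+1} * 'S_n | ksimp d.+1 p.1 p.2)
     krainbow d.+1 p.1 p.2 =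
  \big[addb/false]_(p : {ffun 'I_n -> 'I_N.+1} * 'S_n | ksimp d p.1 p.2)
     krainbow d p.1 p.2.
Proof.
have le_d v s (k : 'I_d.+2) : ksimp d.+1 v s -> (phi (kvert v s k) <= d.+1)%N.
  move=> ks; have [dn1|dn1] := ltnP d.+1 n; last first.
    exact: leq_trans (phi_le _) _.
  pose i := Ordinal dn1; apply: (phi0 (i := i)); rewrite /kvert.
  have /andP[/forallP/(_ i) + _] := ks.
  rewrite ltnn => /eqP ->; rewrite (ksimp_sV ks) //= add0n; apply/eqP.
  by rewrite eqb0 -leqNgt -ltnS.
under eq_bigr => p ks do
  rewrite /krainbow -(doors_parity (fun k => le_d _ _ k ks)).
rewrite exchange_big big_ord_recl big_ord_recr /=.
rewrite [X in X (+) _](eq_bigr (fun p : {ffun 'I_n -> 'I_N.+1} * 'S_n => krainbow d (kadd p.1 (p.2 z)) (krot * p.2)%g));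
  last first.
  by move=> p ks; rewrite -kdoor0.
rewrite kfacet_sum [X in _ (+) (X (+) _)]big1 => [|i _]; last first.
  rewrite -(pair_big_dep xpredT (ksimp d.+1)
    (fun v s => kdoor d.+1 v s (lift ord0 (widen_ord (leqnSn d) i)))) /=.
  by apply: big1 => v _; apply: kdoor_middle => //=; rewrite /bump leq0n /= add1n ltnS.
rewrite addFb.
rewrite [X in _ (+) X](eq_bigr (fun p => krainbow d p.1 p.2)); last first.
  by move=> p _; rewrite -kdoor_last; apply: eq_forallb => c; apply: eq_existsb.
(* A facet is orthogonal to the direction [p.2 e]. The sum over first facets is split by whether
   that coordinate is below [N], the sum over last facets by whether it is positive. *)
rewrite (bigID (fun p : {ffun 'I_n -> 'I_N.+1} * 'S_n => val (p.1 (p.2 e)) < N)%N) /=.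
rewrite [X in _ (+) X](bigID (fun p : {ffun 'I_n -> 'I_N.+1} * 'S_n => 0 < val (p.1 (p.2 e)))%N) /=.
rewrite [X in (_ (+) X) (+) _]big1 => [|[u t] /= /andP[kf]]; last first.
  rewrite -leqNgt => Nu; apply/negP => /forallP rb.
  have utN : u (t e) = N :> nat by have := ltn_ord (u (t e)); lia.
  have te_d : (t e < d.+1)%N.
    rewrite ltnNge; apply/negP => dte; have /andP[/forallP/(_ (t e)) + _] := kf.
    rewrite leqNgt dte /= => /eqP ue; by move: utN N0; rewrite ue /= => <-.
  have /existsP[k /eqP kc] := rb (Ordinal te_d).
  have := @phiN (kvert u t k) (t e); rewrite kc /= eqxx => H; apply: notF; apply: H.
  by rewrite /kvert permK utN /= ltnNge -ltnS ltn_ord addn0.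
rewrite addbF [X in _ (+) (X (+) _)](eq_bigl
  (fun p : {ffun 'I_n -> 'I_N.+1} * 'S_n => kfacet p.1 p.2 && (val (p.1 (p.2 e)) < N)%N)); last first.
  move=> [u t] /=; rewrite /kfacet /ksimp; apply/idP/idP.
    case/andP => /andP[/forallP ku /forallP kt] u0; have := ku (t e).
    case: ltnP => td1; last by move=> /eqP ut; rewrite ut in u0.
    move=> -> ; rewrite andbT; apply/andP; split; apply/forallP => i.
      have := ku i; rewrite ltnS; case: (i <= d)%N => //.
      by case: eqP => [->|].
    by have := kt i.
  case/andP => /andP[/forallP ku /forallP kt] uN; have := ku (t e).
  rewrite eqxx; case: (leqP (t e) d) => td1.
    move=> ->; rewrite andbT; apply/andP; split; apply/forallP => i.
      by have := ku i; rewrite ltnS; case: (i <= d)%N => //; case: eqP => [->|].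
    by have := kt i.
  have /implyP/(_ td1)/eqP/perm_inj te := kt (t e).
  by rewrite te /= ltnn in td1.
(* The facets strictly inside the grid have cancelled; those with coordinate 0 in the direction
   [t e] remain. Their labels are at most [t e], so the label d forces t e = e. *)
rewrite addbA addbb addFb (bigID (fun p : {ffun 'I_n -> 'I_N.+1} * 'S_n => p.2 e == e)) /=.
rewrite [X in _ (+) X]big1 ?addbF => [|[u t] /= /andP[/andP[ks u0] te]]; last first.
  apply/negP => /forallP/(_ ord_max)/existsP[k /eqP /= kd].
  have te_d : (t e < d)%N.
    have : (t e < d.+1)%N by rewrite (ksimp_lt _ ks).
    rewrite ltnS leq_eqVlt => /orP[/eqP ted|//].
    by case/eqP: te; apply: val_inj.
  have := @phi0 (kvert u t k) (t e); rewrite kd.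
  rewrite /kvert permK /= [(d < k)%N]ltnNge -ltnS ltn_ord addn0.
  by move: u0; rewrite lt0n negbK => /eqP u0 /(_ u0); rewrite leqNgt te_d.
apply: eq_bigl => -[u t] /=; apply/idP/idP.
  case/andP => /andP[/andP[/forallP ku /forallP kt] u0] /eqP te.
  rewrite te lt0n negbK in u0.
  apply/andP; split; apply/forallP => i.
    have := ku i; rewrite ltnS leq_eqVlt; case: eqP => [ie|ie] /=.
      have -> : i = e by apply: val_inj.
      by rewrite /= ltnn => _; apply: u0.
    by [].
  apply/implyP; rewrite leq_eqVlt => /orP[/eqP ie|di]; last first.
    by have := kt i; rewrite di.
  by have -> : i = e by [apply: val_inj]; rewrite te.
case/andP => /forallP ku /forallP kt.
have te : t e = e by apply/eqP; have := kt e; rewrite /= leqnn.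
rewrite te eqxx andbT; have := ku e; rewrite ltnn => ue.
rewrite [X in _ && X](_ : _ = true) ?andbT; last by rewrite (eqP ue).
apply/andP; split; apply/forallP => i.
  by have := ku i; rewrite ltnS; case: (ltngtP i d) => // _ /eqP ->.
by have := kt i; case: ltnP => //= di /implyP; apply; exact: ltnW.
Qed.

End kuhn_step.

(** For d = 0 the only simplex is the origin, whose label is 0. By [kuhn_step] the number of rainbow
    simplices is odd in every dimension up to n. *)
Lemma kuhn : exists v s, (forall i, v i < N)%N /\
  forall c, (c <= n)%N -> exists2 k, (k <= n)%N & phi (kvert v s k) = c.
Proof.
have H d : (d <= n)%N ->
    \big[addb/false]_(p : {ffun 'I_n -> 'I_N.+1} * 'S_n | ksimp d p.1 p.2)
     krainbow d p.1 p.2 = true.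
  elim: d => [_|d IH dn]; last by rewrite kuhn_step // IH // ltnW.
  rewrite (bigD1 ([ffun=> ord0], 1%g)) /=; last first.
    apply/andP; split; apply/forallP => i; first by rewrite ffunE.
    by rewrite perm1 eqxx.
  rewrite big1 => [|[u t] /= /andP[/andP[/forallP ku /forallP kt] /eqP ne]].
    rewrite addbF; apply/forallP => c; apply/existsP; exists ord0.
    have -> : val c = 0%N by case: c => -[].
    rewrite -leqn0; have [n0|n0] := posnP n.
      by apply: leq_trans (phi_le _) _; rewrite n0.
    apply: (phi0 (i := Ordinal n0)).
    by rewrite /kvert ffunE.
  case: ne; congr pair.
    by apply/ffunP => i; rewrite ffunE; apply/eqP; apply: ku.
  by apply/permP => i; rewrite perm1; apply/eqP; have := kt i.
have [[v s] /= /andP[ks rb]] : exists p : {ffun 'I_n -> 'I_N.+1} * 'S_n,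
    ksimp n p.1 p.2 && krainbow n p.1 p.2.
  apply: contrapT => nex; have := H n (leqnn _).
  rewrite big1 // => p ks; apply/negP => rb; apply: nex; exists p.
  by rewrite ks.
exists v, s; split.
  by move=> i; have /andP[/forallP/(_ i) + _] := ks; rewrite ltn_ord.
move=> c cn; have /existsP[k /eqP kc] := forallP rb (Ordinal (cn : (c < n.+1)%N)).
by exists k => //; rewrite -ltnS.
Qed.

End Kuhn.

(** * Lebesgue's covering theorem *)

Section LebesgueCovering.
Variable R : realType.

Lemma nbhs_mdistE (X : metricType R) (x : X) (P : set X) :
  nbhs x P <-> exists2 e : R, 0 < e & forall y, mdist x y < e -> P y.
Proof.
rewrite -(metricType_numDomainType.filter_from_mdist_nbhs x).
by split=> -[e e0 He]; exists e.
Qed.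

Lemma open_mdistE (X : metricType R) (A : set X) :
  open A <-> forall x, A x -> exists2 e : R, 0 < e & forall y, mdist x y < e -> A y.
Proof.
rewrite openE; split=> [oA x /oA/nbhs_mdistE//|oA x /oA /nbhs_mdistE//].
Qed.

Lemma lebesgue_number (X : metricType R) (U : set (set X)) :
  compact [set: X] -> open_cover U ->
  exists2 d : R, 0 < d &
    forall x, exists2 A, U A & forall y, mdist x y < d -> A y.
Proof.
move=> /compact_near_coveringP coX [oU cU].
pose P (d : R) (x : X) := exists2 A, U A & forall y, mdist x y < d -> A y.
have H : \forall d \near (0:R)^'+, [set: X] `<=` P d.
  apply: coX => x _; have [A UA Ax] : (\bigcup_(A in U) A) x by rewrite cU.
  have /open_mdistE/(_ x Ax)[e e0 eA] := oU _ UA.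
  exists ([set x' | mdist x x' < e / 2], [set d | d < e / 2]) => /=.
    split; first by apply/nbhs_mdistE; exists (e / 2) => //; lra.
    by apply: nbhs_right_lt; lra.
  move=> [x' d] /= [xx' de]; exists A => // y x'y; apply: eA.
  by apply: le_lt_trans (metric_triangle _ x' _) _; lra.
near (0:R)^'+ => d; exists d => // x.
have : [set: X] `<=` P d by near: d.
exact.
Unshelve. all: by end_near. Qed.

Lemma covering_dim_lt_le (T : topologicalType) m m' :
  (m <= m')%N -> covering_dim_lt T m -> covering_dim_lt T m'.
Proof.
move=> mm' H U fU cU; have [V [fV cV rV mV]] := H U fU cU.
exists V; split => // F Finj FV.
have mm'1 : (m.+1 <= m'.+1)%N by [].
have := mV (F \o widen_ord mm'1).
rewrite -!subset0 => mF x Fx; apply: (mF _ _ x) => //.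
- by move=> i j /Finj /(congr1 val) /= ij; exact: val_inj.
- by move=> i; exact: FV.
- by move=> i _; exact: Fx.
Qed.

(** A cover whose members have diameter below a Lebesgue number of [U] refines [U]; [x0] selects a
    member of [U] for the empty set. *)
Lemma small_covers_dim (X : metricType R) (x0 : X) m : compact [set: X] ->
  (forall e : R, 0 < e -> exists V, [/\ finite_set V, open_cover V,
     multiplicity_le m V & forall B (x y : X), V B -> B x -> B y -> mdist x y < e]) ->
  covering_dim_lt X m.
Proof.
move=> coX H U fU cU; have [d d0 dU] := lebesgue_number coX cU.
have [V [fV cV mV sV]] := H d d0; exists V; split=> // B VB.
have [[x Bx]|/forallNP nB] := pselect (exists x, B x).
  have [A UA dA] := dU x; exists A => // y By; apply: dA; exact: (sV B).
by have [A UA _] := dU x0; exists A => // y /nB.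
Qed.

Definition ucube n : set ('I_n -> R) := [set x | forall i, 0 <= x i <= 1].

(** No member of a suitably refined cover meets both faces x_i = 0 and x_i = 1. Each member is
    labelled by the first face x_i = 0 that it meets, or by n. Kuhn's lemma on a fine grid then
    gives n + 1 members with distinct labels and a common point. *)
Lemma lebesgue_covering (T : topologicalType) (K : metricType R) (n : nat)
    (c : ('I_n -> R) -> K) (f : K -> T) (A B : 'I_n -> set T) :
  compact [set: K] -> continuous f ->
  (forall x y (e : R), 0 <= e -> (forall i, `|x i - y i| <= e) ->
     mdist (c x) (c y) <= e) ->
  (forall i, open (A i)) -> (forall i, open (B i)) ->
  (forall i, A i `|` B i = setT) ->
  (forall x i, ucube x -> x i = 0 -> ~ B i (f (c x))) ->
  (forall x i, ucube x -> x i = 1 -> ~ A i (f (c x))) ->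
  ~ covering_dim_lt T n.
Proof.
move=> coK cf lip oA oB AB fB fA dimT.
(* Every member of a refinement lies, for each i, inside [A i] or inside [B i], hence misses one of
   the two opposite faces. *)
pose sel (h : {ffun 'I_n -> bool}) : set T :=
  [set x | forall i, if h i then A i x else B i x].
have osel h : open (sel h).
  rewrite openE => x sx; apply: filter_forall => i.
  by have := sx i; case: (h i) => sxi; apply: open_nbhs_nbhs.
have cU : open_cover [set sel h | h in [set: {ffun 'I_n -> bool}]].
  split; first by move=> _ [h _ <-].
  rewrite -subTset => x _; exists (sel [ffun i => `[< A i x >]]).
    by exists [ffun i => `[< A i x >]].
  move=> i; rewrite ffunE; case: asboolP => // nA.
  by have : (A i `|` B i) x by [rewrite AB]; case.
have fU : finite_set [set sel h | h in [set: {ffun 'I_n -> bool}]].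
  exact/finite_image/finite_finset.
have [V [fV [oV cV] rV mV]] := dimT _ fU cU.
have cK : open_cover [set f @^-1` W | W in V].
  split.
    by move=> _ [W VW <-]; apply: open_comp (oV _ VW) => x _; exact: cf.
  rewrite -subTset => x _; have [W VW Wx] : (\bigcup_(W in V) W) (f x).
    by rewrite cV.
  by exists (f @^-1` W) => //; exists W.
have [d d0 dV] := lebesgue_number coK cK.
have {}dV x : exists2 W, V W & forall y, mdist x y < d -> W (f y).
  by have [_ [W VW <-] ?] := dV x; exists W.
pose N := (Num.bound d^-1).+1.
have N0 : 0 < N%:R :> R by rewrite ltr0n.
have Nd : N%:R^-1 < d.
  rewrite -[ltRHS]invrK ltf_pV2 ?posrE ?invr_gt0 //.
  apply: lt_trans (archi_boundP _) _; first by rewrite invr_ge0 ltW.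
  by rewrite ltr_nat.
(* [minn] keeps the point in the cube for every [g], because [kuhn] labels all functions and not
   only those bounded by [N]. *)
pose gr (g : 'I_n -> nat) : 'I_n -> R := fun i => (minn (g i) N)%:R / N%:R.
have gr_cube g : ucube (gr g).
  move=> i; rewrite /gr divr_ge0 //= ler_pdivrMr // mul1r ler_nat.
  exact: geq_minr.
have Wx (g : 'I_n -> nat) : {W | V W & forall y, mdist (c (gr g)) y < d -> W (f y)}.
  by apply: cid2; exact: dV.
pose L g := s2val (Wx g).
have LV g : V (L g) by exact: (s2valP (Wx g)).
have Ld g y : mdist (c (gr g)) y < d -> L g (f y) by exact: (s2valP' (Wx g)).
pose meets (W : set T) (i : 'I_n) := exists x, [/\ ucube x, x i = 0 & W (f (c x))].
pose lab (W : set T) : nat := find (fun i => `[< meets W i >]) (enum 'I_n).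
have lab_le W : (lab W <= n)%N by rewrite -[leqRHS](size_enum_ord n) find_size.
have lab_meets W i : meets W i -> (lab W <= i)%N.
  move=> mWi; rewrite leqNgt; apply/negP => iW.
  have := before_find i iW; rewrite nth_ord_enum.
  by move/asboolP.
have meets_lab W (i : 'I_n) : lab W = i -> meets W i.
  move=> Wi; have hs : has (fun i => `[< meets W i >]) (enum 'I_n).
    by rewrite has_find -/(lab W) Wi size_enum_ord.
  by have := nth_find i hs; rewrite -/(lab W) Wi nth_ord_enum => /asboolP.
have Lg g : L g (f (c (gr g))) by apply: Ld; rewrite mdistxx.
have [||||v [s [vN lbl]]] := @kuhn n N (fun g => lab (L g)).
- by [].
- by move=> g; exact: lab_le.
- move=> g i gi; apply: lab_meets; exists (gr g); split => //.
  by rewrite /gr gi min0n mul0r.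
- move=> g i gi; apply/eqP => /meets_lab[x [cx xi Lx]].
  have [_ [h _ <-] sub] := rV _ (LV g).
  have := sub _ Lx i; have := sub _ (Lg g) i; case: (h i) => [Ai _|_ Bi].
    apply: (fA (gr g) i) => //.
    by rewrite /gr gi minnn divff // gt_eqF.
  exact: (fB x i).
have kx (j : 'I_n.+1) : {k : nat | lab (L (kvert v s k)) = j}.
  by apply: cid; have [k _ kj] := lbl j (leq_ord j); exists k.
pose F (j : 'I_n.+1) : set T := L (kvert v s (sval (kx j))).
have labF j : lab (F j) = j by exact: (svalP (kx j)).
(* All vertices of the rainbow simplex are within 1/N < d of the starting vertex [v], so the members
   chosen at them all contain its image. *)
have : (\bigcap_i F i) (f (c (gr (fun i => v i)))).
  move=> j _; apply: Ld; apply: le_lt_trans Nd.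
  apply: lip; first by rewrite invr_ge0 ltW.
  move=> i; rewrite /gr -mulrBl normrM [`|N%:R^-1|]ger0_norm ?invr_ge0 ?ler0n //.
  rewrite ler_piMl ?invr_ge0 ?ler0n // /kvert.
  have vN' := ltnW (vN i); rewrite !(minn_idPl _) //; last first.
    by apply: leq_trans (vN i); case: (s^-1%g i < _)%N; rewrite ?addn1 ?addn0.
  rewrite natrD addrAC subrr add0r ger0_norm ?ler0n //.
  by case: (_ < _)%N.
rewrite (mV F) // => [i j Fij|i]; last exact: LV.
by apply: val_inj; rewrite /= -(labF i) -(labF j) Fij.
Qed.

End LebesgueCovering.

(** * Dimensions through separated sets *)

Section SeparatedSets.
Variables (R : realType) (X : metricType R).
Implicit Types (A B : set X) (l : seq X).

Definition sepl (r : R) l : bool := pairwise (fun x y => r < mdist x y) l.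

(** Comparison with [covering_number] costs a factor 2 in the radius in one direction only. [K] is
    real so that bounds such as a constant times a power of r can be inserted directly. *)
Definition sepb A (r K : R) : Prop :=
  forall l, (forall x, x \in l -> A x) -> sepl r l -> (size l)%:R <= K.

Lemma sepb_sub A B r K : A `<=` B -> sepb B r K -> sepb A r K.
Proof. by move=> AB H l lA; apply: H => x /lA/AB. Qed.

Lemma sepl_le r r' l : r <= r' -> sepl r' l -> sepl r l.
Proof. by move=> rr'; apply: sub_pairwise => x y; exact: le_lt_trans. Qed.

Lemma sepb_le A r r' K K' : r <= r' -> K <= K' -> sepb A r K -> sepb A r' K'.
Proof.
by move=> rr' KK' H l lA /(sepl_le rr') ls; apply: le_trans KK'; exact: H.
Qed.

Lemma sepl_uniq r l : 0 <= r -> sepl r l -> uniq l.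
Proof.
move=> r0; rewrite uniq_pairwise; apply: sub_pairwise => x y /= rxy.
by rewrite -mdist_gt0; exact: le_lt_trans rxy.
Qed.

(** A separated list of maximal length exists because of the bound [K], and no point can be added to
    it. *)
Lemma sepb_net A r K : sepb A r K -> exists l,
  [/\ (forall x, x \in l -> A x), sepl r l, (size l)%:R <= K &
      forall x, A x -> exists2 a, a \in l & mdist a x <= r].
Proof.
move=> sA; pose P n := `[< exists l, [/\ (forall x, x \in l -> A x),
  sepl r l & size l = n] >].
have P0 : exists n, P n by exists 0%N; apply/asboolP; exists [::].
have K0 : 0 <= K by have := sA [::] (fun x => ltac:(by [])) isT.
have Pb n : P n -> (n <= Num.truncn K)%N.
  by move=> /asboolP[l [lA ls <-]]; rewrite truncn_ge_nat // sA.
case: (ex_maxnP P0 Pb) => _ /asboolP[l [lA ls <-]] lmax.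
exists l; split=> //; first exact: sA.
move=> x Ax; apply: contrapT => nx.
have : P (size (x :: l)).
  apply/asboolP; exists (x :: l); split=> //.
    by move=> y; rewrite inE => /orP[/eqP->|/lA].
  rewrite /sepl /= -/(sepl r l) ls andbT; apply/allP => y yl.
  by rewrite ltNge; apply/negP => xy; apply: nx; exists y; rewrite // metric_sym.
by move=> /lmax /=; rewrite ltnn.
Qed.

Lemma seq_card_eq l : uniq l -> ([set` l] #= `I_(size l))%card.
Proof.
move=> ul; apply/card_set_bijP; exists (index ^~ l); split.
- by move=> x /= xl; rewrite index_mem.
- by move=> x y; rewrite !inE /= => xl yl; exact: index_inj.
- move=> i /= il; case: l ul il => // x0 l ul il.
  by exists (nth x0 (x0 :: l) i); [exact: mem_nth|exact: index_uniq].
Qed.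

Lemma card_eq_seq (n : nat) A : (A #= `I_n)%card ->
  exists2 l, size l = n & forall x, A x <-> x \in l.
Proof.
move=> An; have /finite_seqP[l Al] : finite_set A by apply/finite_setP; exists n.
have lA : A = [set` undup l].
  by rewrite Al; apply/seteqP; split=> x /=; rewrite mem_undup.
exists (undup l); last by move=> x; rewrite lA.
apply/esym/(@card_eq_II n); apply: card_eq_trans (seq_card_eq (undup_uniq l)).
by rewrite -lA card_eq_sym.
Qed.

(** Two points of the list in the ball of one centre would be at distance at most 2 * r, so the list
    has at most as many points as there are centres. *)
Lemma covering_number_sepb A r K : 0 < r ->
  (covering_number A r <= K%:E)%E -> sepb A (2 * r) K.
Proof.
move=> r0 NK l lA ls; rewrite -lee_fin; apply: le_trans NK.
apply/ereal_infP => _ [n [C [CA /card_eq_seq[s <- sC] cov]] <-].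
rewrite lee_fin ler_nat.
have cx (x : X) : exists a, x \in l -> a \in s /\ mdist a x <= r.
  have [xl|] := boolP (x \in l); last by exists x.
  by have [a Ca ax] := cov x (lA x xl); exists a => _; split=> //; apply/sC.
pose f x := sval (cid (cx x)).
have fP x : x \in l -> f x \in s /\ mdist (f x) x <= r := svalP (cid (cx x)).
rewrite -(size_map f); apply: uniq_leq_size; last first.
  by move=> _ /mapP[x xl ->]; exact: (fP x xl).1.
have r20 : 0 <= 2 * r by rewrite mulr_ge0 // ltW.
rewrite map_inj_in_uniq ?(sepl_uniq r20 ls) //.
move=> x y xl yl fxy; apply: contrapT => /eqP xy.
have : 2 * r < mdist x y.
  apply: contrapT => nd.
  have /pairwiseP H := ls.
  have xl' := xl; have yl' := yl; rewrite -!index_mem in xl' yl'.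
  have := H x (index x l) (index y l) xl' yl'.
  have := H x (index y l) (index x l) yl' xl'.
  rewrite !nth_index // => H1 H2.
  have [ij|ji|ij] := ltngtP (index x l) (index y l); first by case: nd; exact: H2.
    by case: nd; rewrite metric_sym; exact: H1.
  by move/eqP: xy; apply; rewrite -(nth_index x xl) ij nth_index.
rewrite ltNge => /negP; apply; apply: le_trans (metric_triangle _ (f x) _) _.
rewrite mulr2n mulrDl mul1r lerD // ?(fP x xl).2 //.
  by rewrite metric_sym (fP x xl).2.
by rewrite fxy (fP y yl).2.
Qed.

Lemma sepb_covering_number A r K : 0 < r ->
  sepb A r K -> (covering_number A r <= K%:E)%E.
Proof.
move=> r0 /sepb_net[l [lA ls lK lnet]]; apply: ge_ereal_inf.
exists (size l)%:R%:E; last by rewrite lee_fin.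
exists (size l) => //; exists [set` l]; split=> //.
by apply: seq_card_eq; apply: sepl_uniq ls; exact: ltW.
Qed.

(* Polynomial growth of order [s] of the separated subsets of [A]; for
   [A = setT] this is the upper box dimension. *)
Definition bpow A (s : R) : Prop := exists C d : R,
  0 < d /\ forall r, 0 < r < d -> sepb A r (C * r `^ (- s)).

Lemma at_right0P (V : set R) :
  (0^'+ V) <-> exists2 d : R, 0 < d & forall r, 0 < r < d -> V r.
Proof.
split=> [/nbhs_ballP[e /= e0 H]|[d d0 H]].
  exists e => // r /andP[r0 re]; apply: H => //=.
  by rewrite /ball /= sub0r normrN gtr0_norm.
near=> r; apply: H; apply/andP; split; near: r.
  exact: nbhs_right_gt.
exact: nbhs_right_lt.
Unshelve. all: by end_near. Qed.

Lemma lt_upper_dim_B s : 0 < s -> (upper_dim_B X < s%:E)%E -> bpow setT s.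
Proof.
move=> s0 /ereal_inf_lt[_ [V /at_right0P[d d0 dV] <-] supV].
have {}supV (r : R) : V r ->
    (lne (covering_number [set: X] r) * ((- ln r)^-1)%:E < s%:E)%E.
  by move=> Vr; apply: le_lt_trans supV; apply: ereal_sup_ubound; exists r.
(* The covering numbers are taken at radius r / 2, since [covering_number_sepb] doubles it; r / 2 <
   1 makes - ln (r / 2) positive. *)
exists (2 `^ s), (2 * Num.min d 1).
split=> [|r /andP[r0 rd]]; first by rewrite mulr_gt0 // lt_min d0 ltr01.
have [h0 hd h1] : [/\ 0 < r / 2, r / 2 < d & r / 2 < 1].
  have : r / 2 < Num.min d 1 by rewrite ltr_pdivrMr // mulrC.
  by rewrite lt_min => /andP[? ?]; split=> //; rewrite divr_gt0.
have -> : 2 `^ s * r `^ (- s) = (r / 2) `^ (- s).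
  rewrite powRM ?invr_ge0 ?(ltW r0) // mulrC; congr (_ * _).
  by rewrite -powR_inv1 // -powRrM mulrNN mul1r.
move: (r / 2) (divfK (lt0r_neq0 (ltr0n R 2 : 0 < 2)) r) h0 hd h1.
move=> {r r0 rd} rho <- h0 hd h1; rewrite mulrC.
apply: covering_number_sepb => //.
have := supV rho (dV _ _); rewrite h0 hd => /(_ isT).
have l0 : 0 < - ln rho by rewrite oppr_gt0 ln_lt0 // h0 h1.
case: (covering_number setT rho) => [t| |] H; last by rewrite leNye.
  rewrite lee_fin; have [t0|t0] := leP t 0; first exact: le_trans (powR_ge0 _ _).
  move: H; rewrite lne_EFin // -EFinM lte_fin ltr_pdivrMr // => H.
  rewrite /powR gt_eqF // -[t]lnK ?posrE // ler_expR.
  by rewrite mulNr -mulrN ltW.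
by move: H; rewrite /= mulyr gtr0_sg ?invr_gt0 // mul1e.
Qed.

Lemma upper_dim_B_le s : bpow setT s -> (upper_dim_B X <= s%:E)%E.
Proof.
move=> [C [d [d0 sB]]]; apply/lee_addgt0Pr => e e0.
pose C' := Num.max C 1; have C'1 : 1 <= C' by rewrite le_max lexx orbT.
have C'0 : 0 < C' by exact: lt_le_trans C'1.
pose L := ln C'; have L0 : 0 <= L by rewrite ln_ge0.
(* Below expR (- (L / e)) the constant [C'] adds at most e to the quotient of logarithms. *)
pose d' := Num.min d (Num.min (1 / 2) (expR (- (L / e)))).
have d'0 : 0 < d' by rewrite !lt_min d0 expR_gt0 divr_gt0.
apply: ge_ereal_inf; exists (ereal_sup
  [set (lne (covering_number [set: X] r) * ((- ln r)^-1)%:E)%E |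
     r in [set r : R | 0 < r < d']]).
  by exists [set r : R | 0 < r < d'] => //; apply/at_right0P; exists d'.
apply/ereal_supP => y [r /= /andP[r0 rd'] <-]; move: rd'.
rewrite !lt_min => /andP[rd /andP[r1 re]].
have l0 : 0 < - ln r by rewrite oppr_gt0 ln_lt0 // r0 (lt_trans r1) //; lra.
have le1 : L <= e * (- ln r).
  rewrite mulrC -ler_pdivrMr // lerNr -[leRHS]expRK; apply: ltW.
  by rewrite ltr_ln ?posrE ?expR_gt0.
have : (covering_number [set: X] r <= (C' * r `^ (- s))%:E)%E.
  apply: sepb_covering_number => //; apply: (sepb_le (lexx r)) (sB _ _) => //.
    by rewrite ler_wpM2r ?powR_ge0 // le_max lexx.
  by rewrite r0 rd.
case: (covering_number [set: X] r) => [t| |] //; last first.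
  by move=> _; rewrite /= mulNyr gtr0_sg ?invr_gt0 // mul1e leNye.
rewrite lee_fin; have [t0|t0] := leP t 0.
  by move=> _; rewrite le0_lneNy ?lee_fin // mulNyr gtr0_sg ?invr_gt0 // mul1e leNye.
move=> tC; rewrite lne_EFin // -EFinM -EFinD lee_fin ler_pdivrMr //.
have : ln t <= ln (C' * r `^ (- s)).
  by rewrite ler_ln ?posrE // mulr_gt0 // powR_gt0.
rewrite lnM ?posrE // ?powR_gt0 // ln_powR -/L; nra.
Qed.

Lemma bpow_le A s s' : s <= s' -> bpow A s -> bpow A s'.
Proof.
move=> ss' [C [d [d0 sA]]]; exists (Num.max C 0), (Num.min d 1).
split=> [|r]; first by rewrite lt_min d0 ltr01.
rewrite lt_min => /andP[r0 /andP[rd r1]].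
apply: (sepb_le (lexx r)) (sA r _); last by rewrite r0 rd.
apply: (@le_trans _ _ (Num.max C 0 * r `^ (- s))).
  by rewrite ler_wpM2r ?powR_ge0 // le_max lexx.
rewrite ler_wpM2l ?le_max ?lexx ?orbT //.
by apply: ger_powR; rewrite ?lerN2 // r0 ltW.
Qed.

Definition apow (s : R) : Prop := exists C : R, forall x rho r,
  0 < r -> r < rho -> sepb (cball x rho) r (C * (rho / r) `^ s).

Lemma lt_dim_A s : (dim_A X < s%:E)%E -> apow s.
Proof.
move=> /ereal_inf_lt[_ [lam [lam0 [C C0 cov]] <-]]; rewrite lte_fin => lams.
exists (C * 2 `^ lam) => x rho r r0 rrho.
have h0 : 0 < r / 2 by rewrite divr_gt0.
have hr : r / 2 < rho by apply: lt_trans rrho; rewrite ltr_pdivrMr //; lra.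
have := covering_number_sepb h0 (cov x rho _ h0 hr).
rewrite mulrC divfK //; apply: sepb_le => //.
have rho0 : 0 < rho by exact: lt_trans rrho.
rewrite invf_div mulrA mulrAC [_ / r * 2]mulrC powRM ?divr_ge0 ?(ltW rho0) ?(ltW r0) //.
rewrite -mulrA ler_wpM2l ?(ltW C0) // ler_wpM2l ?powR_ge0 //.
by apply: ler_powR; [rewrite ler_pdivlMr // mul1r ltW|exact: ltW].
Qed.

Lemma dim_A_le s : 0 < s -> apow s -> (dim_A X <= s%:E)%E.
Proof.
move=> s0 [C sA]; apply: ge_ereal_inf; exists s%:E => //; exists s => //=.
split=> //; exists (Num.max C 1); first by rewrite lt_max ltr01 orbT.
move=> x rho r r0 rrho; apply: sepb_covering_number => //.
apply: (sepb_le (lexx r)) (sA x rho r r0 rrho).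
by rewrite ler_wpM2r ?powR_ge0 // le_max lexx.
Qed.

Lemma apow_bpow s D : (forall x y : X, mdist x y <= D) ->
  apow s -> bpow setT s.
Proof.
move=> bd [C sA]; pose D' := Num.max D 1.
have D'1 : 1 <= D' by rewrite le_max lexx orbT.
have [x0|nX] := pselect (exists x : X, True); last first.
  exists 0, 1; split=> // r _ [|x l] _ _ /=; first by rewrite mul0r.
  by case: nX; exists x.
have {x0}[x0 _] := x0.
exists (C * D' `^ s), 1; split=> // r /andP[r0 r1].
have := sA x0 D' r r0 (lt_le_trans r1 D'1).
rewrite powRM ?invr_ge0 ?(ltW r0) //; last exact: le_trans D'1.
rewrite -powR_inv1 ?(ltW r0) // -powRrM mulN1r mulrA; apply: sepb_sub => y _ /=.
by rewrite /cball /= le_max bd.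
Qed.

Lemma nneseries_ge_term (u : nat -> \bar R) i : (forall i, 0 <= u i)%E ->
  (u i <= \sum_(i <oo) u i)%E.
Proof.
move=> u0; apply: le_trans (@nneseries_lim_ge _ _ xpredT 0 i.+1 _) => //.
by rewrite big_nat_recr //= leeDr // sume_ge0.
Qed.

Lemma nneseries_le_bound (u : nat -> \bar R) K : (forall i, 0 <= u i)%E ->
  (forall n, \sum_(0 <= i < n) u i <= K)%E -> (\sum_(i <oo) u i <= K)%E.
Proof.
move=> u0 uK; apply: lime_le; first exact: is_cvg_nneseries.
by apply: nearW => n.
Qed.

(** Vanishing of the s-dimensional Hausdorff measure. No bound on the diameters is imposed: for s >
    0 a small sum of powers already forces small diameters. *)
Definition hpow (s : R) : Prop := forall e : R, 0 < e ->
  exists S : nat -> set X, setT `<=` \bigcup_i S i /\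
    forall n, (\sum_(0 <= i < n) diam_pow s (S i) <= e%:E)%E.

Lemma diam_ge0 A : (0 <= diam A)%E.
Proof. by apply: ereal_sup_ubound; left. Qed.

Lemma diam_pow_ge0 s A : (0 <= diam_pow s A)%E.
Proof. by rewrite /diam_pow; case: ifP => // _; exact: poweR_ge0. Qed.

Lemma diam_le A (K : R) : 0 <= K ->
  (forall x y, A x -> A y -> mdist x y <= K) -> (diam A <= K%:E)%E.
Proof.
move=> K0 AK; apply/ereal_supP => z [->|[[x y] /= [Ax Ay] <-]].
  by rewrite lee_fin.
by rewrite lee_fin AK.
Qed.

Lemma mdist_le_diam A x y : A x -> A y -> ((mdist x y)%:E <= diam A)%E.
Proof. by move=> Ax Ay; apply: ereal_sup_ubound; right; exists (x, y). Qed.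

Lemma diam_pow_le A s K : 0 < s -> 0 <= K ->
  (forall x y, A x -> A y -> mdist x y <= K) -> (diam_pow s A <= (K `^ s)%:E)%E.
Proof.
move=> s0 K0 AK; rewrite /diam_pow; case: ifP => _; first by rewrite lee_fin powR_ge0.
rewrite -poweR_EFin; apply: gt0_ler_poweR; rewrite ?(ltW s0) ?in_itv /= ?leey ?andbT ?diam_ge0 ?lee_fin //.
exact: diam_le.
Qed.

Lemma lt_dim_H s : 0 < s -> (dim_H X < s%:E)%E -> hpow s.
Proof.
move=> s0 /ereal_inf_lt[_ [s' [s'0 Hs'] <-]]; rewrite lte_fin => s's e e0.
(* Diameters below 1 ensure that the powers do not grow when the exponent rises from s' to s. *)
have : (hausdorff_pre s' 1 [set: X] < e%:E)%E.
  apply: (@le_lt_trans _ _ 0%E); last by rewrite lte_fin.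
  by rewrite -Hs'; apply: ereal_sup_ubound; exists 1; rewrite /= ?ltr01.
move=> /ereal_inf_lt[_ [S [cS dS] <-] Se]; exists S; split=> // n.
apply: le_trans (ltW Se); apply: le_trans (@nneseries_lim_ge _ _ xpredT 0 n _); last first.
  by move=> i _ _; exact: diam_pow_ge0.
apply: lee_sum => i _; rewrite /diam_pow; case: ifP => // _.
have := dS i; have := diam_ge0 (S i); case: (diam (S i)) => [t| |] //.
rewrite lee_fin lte_fin => t0 t1; rewrite !poweR_EFin lee_fin.
move: t0; rewrite le_eqVlt => /orP[/eqP <-|t0].
  by rewrite powR0 ?gt_eqF // powR_ge0.
by apply: ger_powR; rewrite ?t0 ltW.
Qed.

Lemma dim_H_le s : 0 < s -> hpow s -> (dim_H X <= s%:E)%E.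
Proof.
move=> s0 hs; apply: ge_ereal_inf; exists s%:E => //; exists s => //=.
split; first exact: ltW.
apply/eqP; rewrite eq_le; apply/andP; split; last first.
  apply: le_ereal_sup_tmp; exists (hausdorff_pre s 1 [set: X]).
    by exists 1; rewrite /= ?ltr01.
  apply/ereal_infP => _ [S _ <-]; apply: nneseries_ge0 => i _ _.
  exact: diam_pow_ge0.
apply/ereal_supP => _ [d /= d0 <-]; apply/lee_addgt0Pr => e e0; rewrite add0e.
(* A total of at most half of d^s forces every single diameter below d. *)
pose e' := Num.min e ((d `^ s) / 2).
have e'0 : 0 < e' by rewrite lt_min e0 divr_gt0 // powR_gt0.
have [S [cS sS]] := hs e' e'0.
apply: ge_ereal_inf; exists (\sum_(i <oo) diam_pow s (S i))%E.
  exists S => //; split=> // i.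
  have : (diam_pow s (S i) <= e'%:E)%E.
    apply: le_trans (sS i.+1); rewrite big_nat_recr //= leeDr // sume_ge0 // => j _.
    exact: diam_pow_ge0.
  rewrite /diam_pow; case: eqP => [-> _|_].
    by apply: (@le_lt_trans _ _ 0%E); rewrite ?lte_fin //; apply: diam_le.
  have := diam_ge0 (S i); case: (diam (S i)) => [t| |] //.
    rewrite lee_fin poweR_EFin lee_fin lte_fin => t0 te.
    rewrite ltNge; apply/negP => dt.
    have : t `^ s < d `^ s.
      apply: le_lt_trans te _; rewrite gt_min; apply/orP; right.
      by rewrite ltr_pdivrMr // ltr_pMr ?powR_gt0 // ltr1n.
    rewrite ltNge => /negP; apply.
    by apply: ge0_ler_powR; rewrite ?nnegrE // ltW.
  by rewrite poweRyr ?gt_eqF // leye_eq.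
apply: nneseries_le_bound; first by move=> i; exact: diam_pow_ge0.
by move=> n; apply: le_trans (sS n) _; rewrite lee_fin ge_min lexx.
Qed.

Lemma sepb_hpow s : 0 < s ->
  (forall e, 0 < e -> exists r K, [/\ 0 < r, sepb setT r K & K * (2 * r) `^ s <= e]) ->
  hpow s.
Proof.
move=> s0 H e /H[r [K [r0 sB Ke]]]; have [l [_ ls lK lnet]] := sepb_net sB.
(* [ohead (drop i l)] is the i-th point of the net as an option, so no default point of [X] has to
   be supplied. *)
pose S i := if (i < size l)%N then
  [set x | forall a, ohead (drop i l) = Some a -> mdist a x <= r] else set0.
exists S; split.
  move=> x _; have [a al ax] := lnet x I; exists (index a l) => //.
  rewrite /S index_mem al => b; rewrite (drop_nth a) ?index_mem //= nth_index //.
  by move=> -[<-].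
move=> n; apply: (@le_trans _ _ ((size l)%:R * (2 * r) `^ s)%:E).
  apply: (@le_trans _ _ (\sum_(0 <= i < n) (if (i < size l)%N then ((2 * r) `^ s)%:E else 0%E))%E).
    apply: lee_sum => i _; rewrite /S; case: ifPn => il; last first.
      by rewrite /diam_pow eqxx.
    apply: diam_pow_le => //; first by rewrite mulr_ge0 // ltW.
    case: l il {ls lK lnet S} => // a0 l il x y; rewrite (drop_nth a0) //= => Sx Sy.
    apply: le_trans (metric_triangle _ (nth a0 (a0 :: l) i) _) _.
    by rewrite mulr2n mulrDl mul1r lerD // ?Sy // metric_sym Sx.
  rewrite -big_mkcond /= sumEFin lee_fin big_const_seq.
  rewrite iter_addr_0 -[_ *+ count _ _]mulr_natl ler_wpM2r ?powR_ge0 // ler_nat.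
  rewrite -size_filter -[leqRHS](size_iota 0); apply: uniq_leq_size.
    by rewrite filter_uniq // iota_uniq.
  by move=> i; rewrite mem_filter mem_iota /= => /andP[].
by rewrite lee_fin; apply: le_trans Ke; rewrite ler_wpM2r ?powR_ge0.
Qed.

Lemma bpow_hpow s s' : 0 < s' -> s < s' -> bpow setT s -> hpow s'.
Proof.
move=> s'0 ss' [C [d [d0 sB]]]; apply: sepb_hpow => // e e0.
pose C' := Num.max C 1 * 2 `^ s'; have C'0 : 0 < C'.
  by rewrite mulr_gt0 ?powR_gt0 // lt_max ltr01 orbT.
(* The second bound makes the covering sum, at most C' times r to the power s' - s, not exceed e. *)
pose r := Num.min (d / 2) ((e / C') `^ (s' - s)^-1).
have r0 : 0 < r by rewrite lt_min divr_gt0 //= powR_gt0 // divr_gt0.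
have rd : r < d by rewrite gt_min; apply/orP; left; lra.
exists r, (C * r `^ (- s)); split=> //; first by apply: sB; rewrite r0.
apply: (@le_trans _ _ (C' * r `^ (s' - s))).
  rewrite powRM ?(ltW r0) // mulrA [s' - s]addrC powRD; last by rewrite (gt_eqF r0) implybT.
  rewrite [C' * _]mulrA ler_wpM2r ?powR_ge0 // [leRHS]mulrAC ler_wpM2r ?powR_ge0 //.
  by rewrite ler_wpM2r ?powR_ge0 // le_max lexx //.
apply: (@le_trans _ _ (C' * ((e / C') `^ (s' - s)^-1) `^ (s' - s))).
  rewrite ler_wpM2l ?(ltW C'0) //; apply: ge0_ler_powR.
  - by rewrite subr_ge0 ltW.
  - by rewrite nnegrE ltW.
  - by rewrite nnegrE powR_ge0.
  - by rewrite ge_min lexx orbT.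
have ds : s' - s != 0 by rewrite subr_eq0 gt_eqF.
by rewrite -powRrM mulVf // powRr1 ?divr_ge0 ?(ltW e0) ?(ltW C'0) // mulrC divfK // gt_eqF.
Qed.

End SeparatedSets.

Lemma exists_pow_lt (R : realType) (I : eqType) (l : seq I) (r : I -> R) rho :
  0 < rho -> (forall i, i \in l -> 0 < r i) ->
  exists p, forall i, i \in l -> rho / 2 ^+ p < r i.
Proof.
move=> rho0; elim: l => [|i l IH] lr; first by exists 0%N.
have [|p Hp] := IH; first by move=> j jl; apply: lr; rewrite inE jl orbT.
have ri : 0 < r i by apply: lr; rewrite mem_head.
pose q := Num.bound (rho / r i).
have Hq : rho / 2 ^+ q < r i.
  rewrite ltr_pdivrMr ?exprn_gt0 // -ltr_pdivrMl // mulrC.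
  apply: lt_trans (archi_boundP _) _; first by rewrite divr_ge0 // ltW.
  by rewrite -natrX ltr_nat ltn_expl.
have mono m n : (m <= n)%N -> rho / 2 ^+ n <= rho / 2 ^+ m.
  move=> mn; rewrite ler_wpM2l ?(ltW rho0) // lef_pV2 ?posrE ?exprn_gt0 //.
  by rewrite ler_eXn2l // ltr1n.
exists (maxn p q) => j; rewrite inE => /orP[/eqP ->|jl].
  by apply: le_lt_trans Hq; apply: mono; exact: leq_maxr.
by apply: le_lt_trans (Hp j jl); apply: mono; exact: leq_maxl.
Qed.

(** * Packing dimension through box growth of countably many pieces *)

Section Packing.
Variables (R : realType) (X : metricType R).
Implicit Types (A : set X) (l : seq X).

(** The description of the packing dimension as the modified upper box dimension. *)
Definition ppow (s : R) : Prop := exists S : nat -> set X,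
  setT `<=` \bigcup_i S i /\ forall i, bpow (S i) s.

Lemma packing_pre_ge0 (x0 : X) s d A : (0 <= packing_pre s d A)%E.
Proof.
apply: ereal_sup_ubound; exists set0, (fun=> 0), (fun=> x0); split=> //.
by rewrite esum_set0.
Qed.

Lemma packing_pre0_ge0 (x0 : X) s A : (0 <= packing_pre0 s A)%E.
Proof. by apply/ereal_infP => _ [d _ <-]; exact: packing_pre_ge0. Qed.

Lemma packing_meas_ge0 (x0 : X) s A : (0 <= packing_meas s A)%E.
Proof.
apply/ereal_infP => _ [S _ <-]; apply: nneseries_ge0 => i _ _.
exact: packing_pre0_ge0.
Qed.

(** Points more than r apart are centres of disjoint balls of radius r / 2, an admissible packing
    with all radii equal. *)
Lemma packing_sepb (x0 : X) s d A r (K : R) : 0 < r / 2 < d ->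
  (packing_pre s d A <= K%:E)%E -> sepb A r (K * (r / 2) `^ (- s)).
Proof.
move=> /andP[h0 hd] pK l lA ls; rewrite powRN ler_pdivlMr ?powR_gt0 //.
rewrite -lee_fin; apply: le_trans pK; apply: ereal_sup_ubound.
exists `I_(size l), (fun=> r / 2), (nth x0 l); split.
- by move=> i _; rewrite h0 hd.
- by move=> i /= il; apply: lA; exact: mem_nth.
- apply/trivIsetP => i j /= il jl ij; rewrite -subset0 => z [/= iz jz].
  have : mdist (nth x0 l i) (nth x0 l j) <= r.
    apply: le_trans (metric_triangle _ z _) _; rewrite [r in leRHS]splitr.
    by rewrite lerD // metric_sym.
  have /pairwiseP P := ls.
  have [ij'|ji|ij'] := ltngtP i j; last by rewrite ij' eqxx in ij.
    by rewrite leNgt (P x0 i j il jl ij').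
  by rewrite metric_sym leNgt (P x0 j i jl il ji).
- rewrite esum_fset -?fsbig_ord ?sumEFin ?sumr_const ?card_ord ?mulr_natl //.
  by move=> i _; rewrite lee_fin powR_ge0.
Qed.

Lemma lt_dim_P (x0 : X) s : 0 < s -> (dim_P X < s%:E)%E -> ppow s.
Proof.
move=> s0 /ereal_inf_lt[_ [s' [s'0 Hs'] <-]]; rewrite lte_fin => s's.
have : (packing_meas s' [set: X] < 1%:E)%E by rewrite Hs' lte_fin.
move=> /ereal_inf_lt[_ [S cS <-] S1]; exists S; split=> // i.
have : (packing_pre0 s' (S i) < 1%:E)%E.
  apply: le_lt_trans S1; apply: nneseries_ge_term => j.
  exact: packing_pre0_ge0.
move=> /ereal_inf_lt[_ [d /= d0 <-] d1].
apply: (@bpow_le _ _ _ s'); first exact: ltW.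
exists (2 `^ s'), (2 * d); split=> [|r /andP[r0 rd]]; first by rewrite mulr_gt0.
have h : 0 < r / 2 < d by rewrite divr_gt0 //= ltr_pdivrMr // mulrC.
have := packing_sepb x0 h (ltW d1); apply: sepb_le => //.
rewrite mul1r powRM ?invr_ge0 ?(ltW r0) // mulrC ler_wpM2r ?powR_ge0 //.
by rewrite -powR_inv1 // -powRrM mulrNN mul1r.
Qed.

(* Splitting off the balls with radius in ]rho/2, rho] makes the sum of
   the r_i^(s+e) geometric in the scale. *)
Lemma packing_halving (A : set X) (s e C d : R) (I : set nat) (r : nat -> R)
    (c : nat -> X) : 0 < e -> 0 <= s -> 0 <= C ->
  (forall t, 0 < t < d -> sepb A t (C * t `^ (- s))) ->
  (forall i, I i -> A (c i)) -> trivIset I (fun i => cball (c i) (r i)) ->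
  forall (p : nat) (rho : R) (l : seq nat), 0 < rho < d -> uniq l ->
  (forall i, i \in l -> I i /\ rho / 2 ^+ p < r i <= rho) ->
  \sum_(i <- l) r i `^ (s + e) <=
    C * 2 `^ s / (1 - 2 `^ (- e)) * rho `^ e.
Proof.
move=> e0 s0 C0 sA cA tI.
have q1 : 2 `^ (- e) < 1 :> R.
  by rewrite powRN invf_lt1 ?powR_gt0 // -[ltLHS](powRr0 2) /powR gt_eqF // ltr_expR ltr_pM2r ?ln_gt0 // ltr1n.
set K := C * 2 `^ s / (1 - 2 `^ (- e)).
have K0 : 0 <= K by rewrite divr_ge0 ?mulr_ge0 ?powR_ge0 // subr_ge0 ltW.
(* [K] solves the recursion: the layer of radii in ]rho/2, rho] contributes the first term, and the
   induction hypothesis at rho / 2 the second. *)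
have KE : C * 2 `^ s + K * 2 `^ (- e) = K.
  have : K * (1 - 2 `^ (- e)) = C * 2 `^ s by rewrite divfK // subr_eq0 gt_eqF.
  by rewrite mulrBr mulr1 => <-; rewrite subrK.
elim=> [|p IH] rho l /andP[rho0 rhod] ul lr.
  suff -> : l = [::] by rewrite big_nil mulr_ge0 ?powR_ge0.
  case: l ul lr => // i l _ /(_ i (mem_head _ _))[_].
  by rewrite expr0 divr1 => /andP[/lt_le_trans/[apply]]; rewrite ltxx.
have h0 : 0 < rho / 2 by rewrite divr_gt0.
have hd : rho / 2 < d by apply: lt_trans rhod; rewrite ltr_pdivrMr //; lra.
rewrite (bigID (fun i => rho / 2 < r i)) /= -KE mulrDl; apply: lerD; last first.
  rewrite -big_filter.
  have -> : K * 2 `^ (- e) * rho `^ e = K * (rho / 2) `^ e.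
    rewrite powRM ?invr_ge0 ?(ltW rho0) // -mulrA [2 `^ _ * _]mulrC.
    by rewrite -[2^-1]powR_inv1 // -powRrM mulN1r.
  apply: IH; first by rewrite h0 hd.
    exact: filter_uniq.
  move=> i; rewrite mem_filter -leNgt => /andP[ri /lr[Ii /andP[ri' _]]].
  by split=> //; rewrite ri andbT (le_lt_trans _ ri') // exprS invfM mulrA.
rewrite -big_filter.
pose l1 := [seq i <- l | rho / 2 < r i]; rewrite -/l1.
have l1l i : i \in l1 -> i \in l /\ rho / 2 < r i.
  by rewrite mem_filter => /andP[].
(* The balls are disjoint and have radius above rho / 2, so none contains the centre of another and
   the centres are separated at scale rho / 2. *)
have size1 : (size l1)%:R <= C * (rho / 2) `^ (- s).
  rewrite -(size_map c); apply: (sA (rho / 2)).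
  - by rewrite h0 hd.
  - by move=> _ /mapP[i /l1l[/lr[Ii _] _] ->]; exact: cA.
  - rewrite /sepl pairwise_map.
    have : pairwise (fun i j => i != j) l1 by rewrite -uniq_pairwise filter_uniq.
    apply: (@sub_in_pairwise _ (mem l1) _ _ _ l1); last exact: allss.
    move=> i j /l1l[/lr[Ii _] ri] /l1l[/lr[Ij _] rj] ij /=.
    apply: lt_trans ri _; rewrite ltNge; apply/negP => cij.
    have /trivIsetP/(_ i j Ii Ij ij) := tI; rewrite -subset0 => /(_ (c j)); apply.
    split=> //; rewrite /cball /= mdistxx.
    by apply: ltW; apply: lt_trans rj.
apply: (@le_trans _ _ (\sum_(i <- l1) rho `^ (s + e))).
  rewrite !big_seq; apply: ler_sum => i /l1l[/lr[_ /andP[_ ri]] ri'].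
  by apply: ge0_ler_powR; rewrite ?nnegrE ?addr_ge0 ?(ltW e0) ?(ltW rho0) ?(ltW (lt_trans h0 ri')).
rewrite big_const_seq count_predT iter_addr_0 -[_ *+ size _]mulr_natl.
apply: le_trans (ler_wpM2r (powR_ge0 _ _) size1) _.
rewrite powRM ?invr_ge0 ?(ltW rho0) // powRD; last by rewrite (gt_eqF rho0) implybT.
rewrite -[2^-1]powR_inv1 // -powRrM mulrNN mul1r le_eqVlt; apply/orP; left.
have -> : C * (rho `^ (- s) * 2 `^ s) * (rho `^ s * rho `^ e) =
    C * 2 `^ s * rho `^ e * (rho `^ (- s) * rho `^ s) by lra.
by rewrite powRN mulVf ?mulr1 // gt_eqF // powR_gt0.
Qed.

Lemma bpow_packing_pre0 (x0 : X) A s e : 0 < e -> 0 <= s -> bpow A s ->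
  packing_pre0 (s + e) A = 0%E.
Proof.
move=> e0 s0 [C [d [d0 sA]]].
pose C' := Num.max C 0; have C'0 : 0 <= C' by rewrite le_max lexx orbT.
have {}sA t : 0 < t < d -> sepb A t (C' * t `^ (- s)).
  by move=> td; apply: (sepb_le (lexx t)) (sA t td); rewrite ler_wpM2r ?powR_ge0 // le_max lexx.
pose K := Num.max 1 (C' * 2 `^ s / (1 - 2 `^ (- e))).
have K0 : 0 < K by rewrite lt_max ltr01.
apply/eqP; rewrite eq_le packing_pre0_ge0 // andbT.
apply/lee_addgt0Pr => h h0; rewrite add0e.
pose rho := Num.min (d / 2) ((h / K) `^ e^-1).
have rho0 : 0 < rho by rewrite lt_min divr_gt0 //= powR_gt0 // divr_gt0.
have rhod : rho < d by rewrite gt_min; apply/orP; left; rewrite ltr_pdivrMr //; lra.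
apply: ge_ereal_inf; exists (packing_pre (s + e) rho A); first by exists rho.
apply/ereal_supP => _ [J [r [c [Jr Jc Jt ->]]]].
(* An [\esum] is the supremum of its finite partial sums. A finite family has a smallest radius, so
   the halving stops. *)
apply/ereal_supP => _ [F [fF FJ] <-].
rewrite fsbig_finite //= sumEFin lee_fin.
set l := finmap.enum_fset _.
have lF i : i \in l -> F i.
  by move=> il; apply: set_mem; rewrite -(in_fset_set fF); exact: il.
have [p Hp] : exists p, forall i, i \in l -> rho / 2 ^+ p < r i.
  apply: exists_pow_lt => // i /lF/FJ/Jr; by case/andP.
apply: (@le_trans _ _ (K * rho `^ e)).
  apply: le_trans (packing_halving e0 s0 C'0 sA Jc Jt (p := p) (rho := rho) _ _ _) _.
  - by rewrite rho0 rhod.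
  - exact: finmap.fset_uniq.
  - move=> i iF; have Ji := FJ _ (lF _ iF).
    split=> //; rewrite Hp //=; by have /andP[_ /ltW] := Jr i Ji.
  - by rewrite ler_wpM2r ?powR_ge0 // le_max lexx orbT.
apply: (@le_trans _ _ (K * ((h / K) `^ e^-1) `^ e)).
  rewrite ler_wpM2l ?(ltW K0) //; apply: ge0_ler_powR.
  - exact: ltW.
  - by rewrite nnegrE ltW.
  - by rewrite nnegrE powR_ge0.
  - by rewrite ge_min lexx orbT.
by rewrite -powRrM mulVf ?gt_eqF // powRr1 ?divr_ge0 ?(ltW h0) ?(ltW K0) // mulrC divfK // gt_eqF.
Qed.

Lemma dim_P_le (x0 : X) s : 0 <= s -> ppow s -> (dim_P X <= s%:E)%E.
Proof.
move=> s0 [S [cS bS]]; apply/lee_addgt0Pr => e e0; rewrite -EFinD.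
apply: ge_ereal_inf; exists (s + e)%:E => //; exists (s + e) => //=.
split; first by rewrite addr_ge0 // ltW.
apply/eqP; rewrite eq_le packing_meas_ge0 // andbT.
apply: ge_ereal_inf; exists (\sum_(i <oo) packing_pre0 (s + e) (S i))%E.
  by exists S.
by rewrite eseries0 // => i _ _; exact: bpow_packing_pre0.
Qed.

End Packing.

(** * Similarities and unions *)

Section Similarity.
Variable R : realType.

Definition is_sim (X Z : metricType R) (a : R) (f : X -> Z) : Prop :=
  0 < a /\ forall x y, mdist (f x) (f y) = a * mdist x y.

Lemma sim_inj (X Z : metricType R) a (f : X -> Z) : is_sim a f -> injective f.
Proof.
move=> [a0 fa] x y fxy; apply: mdist_positivity; apply/eqP.
have := fa x y; rewrite fxy mdistxx => /esym/eqP.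
by rewrite mulf_eq0 gt_eqF.
Qed.

Lemma bpow_set0 (X : metricType R) (s : R) : bpow (set0 : set X) s.
Proof.
exists 0, 1; split=> // r _ [|x l] lA _ /=; first by rewrite mul0r.
by case: (lA x (mem_head _ _)).
Qed.

Lemma sepb_sim (X Z : metricType R) a (f : X -> Z) (B : set Z) r K :
  is_sim a f -> sepb B r K -> sepb (f @^-1` B) (r / a) K.
Proof.
move=> [a0 fa] sB l lA ls; rewrite -(size_map f); apply: sB.
  by move=> _ /mapP[x xl ->]; exact: lA.
rewrite /sepl pairwise_map; apply: sub_pairwise ls => x y /=.
by rewrite fa ltr_pdivrMr // mulrC.
Qed.

Lemma bpow_sim (X Z : metricType R) a (f : X -> Z) (B : set Z) s :
  is_sim a f -> bpow B s -> bpow (f @^-1` B) s.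
Proof.
move=> fs [C [d [d0 sB]]]; have [a0 _] := fs.
exists (C * a `^ (- s)), (d / a); split=> [|r /andP[r0 rd]].
  by rewrite divr_gt0.
have : sepb B (r * a) (C * (r * a) `^ (- s)).
  by apply: sB; rewrite mulr_gt0 //= -ltr_pdivlMr.
move=> /(sepb_sim fs); rewrite mulfK ?gt_eqF //; apply: sepb_le => //.
by rewrite powRM ?(ltW r0) ?(ltW a0) // [r `^ _ * _]mulrC mulrA.
Qed.

Lemma ppow_sim (X Z : metricType R) a (f : X -> Z) s :
  is_sim a f -> ppow Z s -> ppow X s.
Proof.
move=> fs [S [cS bS]]; exists (fun i => f @^-1` S i); split=> [x _|i].
  by have [i _ Si] := cS (f x) I; exists i.
exact: (bpow_sim fs).
Qed.

Lemma apow_sim (X Z : metricType R) a (f : X -> Z) s :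
  is_sim a f -> apow Z s -> apow X s.
Proof.
move=> fs [C sB]; have [a0 fa] := fs; exists C => x rho r r0 rrho.
have := sB (f x) (rho * a) (r * a); rewrite mulr_gt0 // ltr_pM2r // => /(_ isT rrho).
move=> /(sepb_sim fs); rewrite mulfK ?gt_eqF //.
rewrite -mulf_div divff ?gt_eqF // mulr1; apply: sepb_sub => y.
by rewrite /cball /= fa mulrC ler_pM2r.
Qed.

(** Stated through pairs of points, so that it serves preimages under a similarity of ratio a, with
    c = 1/a, as well as images, with c = a. *)
Lemma diam_pow_scale (X Z : metricType R) (A : set X) (B : set Z) (c s : R) :
  0 < s -> 0 < c ->
  (forall p q, A p -> A q -> exists p' q', [/\ B p', B q' & mdist p q <= c * mdist p' q']) ->
  (diam_pow s A <= (c `^ s)%:E * diam_pow s B)%E.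
Proof.
move=> s0 c0 AB.
have [->|/eqP A0] := eqVneq A set0.
  by rewrite {1}/diam_pow eqxx mule_ge0 ?lee_fin ?powR_ge0 ?diam_pow_ge0.
have [p Ap] : A !=set0 by apply/set0P/eqP.
have B0 : B != set0 by have [p' [_ [Bp' _ _]]] := AB p p Ap Ap; apply/set0P; exists p'.
rewrite [diam_pow s B]/diam_pow (negbTE B0).
have := diam_ge0 B; case dB : (diam B) => [t| |] //; last first.
  by rewrite poweRyr ?gt_eqF // gt0_muley ?leey // lte_fin powR_gt0.
rewrite lee_fin => t0; rewrite poweR_EFin -EFinM -powRM ?(ltW c0) //.
apply: diam_pow_le => //; first by rewrite mulr_ge0 // ltW.
move=> x y Ax Ay; have [p' [q' [Bp Bq pq]]] := AB x y Ax Ay.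
apply: le_trans pq _; rewrite ler_pM2l //.
by rewrite -lee_fin -dB; exact: mdist_le_diam.
Qed.

Lemma hpow_sim (X Z : metricType R) a (f : X -> Z) s : 0 < s ->
  is_sim a f -> hpow Z s -> hpow X s.
Proof.
move=> s0 [a0 fa] hZ e e0.
have c0 : 0 < (a^-1) `^ s by rewrite powR_gt0 // invr_gt0.
have [|S [cS sS]] := hZ (e / (a^-1) `^ s); first by rewrite divr_gt0.
exists (fun i => f @^-1` S i); split=> [x _|n].
  by have [i _ Si] := cS (f x) I; exists i.
apply: (@le_trans _ _ (\sum_(0 <= i < n) ((a^-1) `^ s)%:E * diam_pow s (S i))%E).
  apply: lee_sum => i _; apply: diam_pow_scale => //; first by rewrite invr_gt0.
  move=> x y Sx Sy; exists (f x), (f y); split=> //.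
  by rewrite fa mulKf // gt_eqF.
rewrite -ge0_sume_distrr; last by move=> i _; exact: diam_pow_ge0.
apply: le_trans (lee_wpmul2l _ (sS n)) _; first by rewrite lee_fin ltW.
by rewrite -EFinM lee_fin mulrC divfK // gt_eqF.
Qed.

Definition interleave (T : Type) (u v : nat -> T) (i : nat) : T :=
  if odd i then v i./2 else u i./2.

Lemma interleave_double (T : Type) (u v : nat -> T) i :
  interleave u v i.*2 = u i.
Proof. by rewrite /interleave odd_double doubleK. Qed.

Lemma interleave_doubleS (T : Type) (u v : nat -> T) i :
  interleave u v i.*2.+1 = v i.
Proof. by rewrite /interleave /= odd_double /= uphalf_double. Qed.

Lemma sum_interleave (T : Type) (h : T -> \bar R) (u v : nat -> T) n :
  (forall x, 0 <= h x)%E ->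
  (\sum_(0 <= i < n) h (interleave u v i) <=
   \sum_(0 <= i < n) h (u i) + \sum_(0 <= i < n) h (v i))%E.
Proof.
move=> h0; apply: (@le_trans _ _ (\sum_(0 <= i < n.*2) h (interleave u v i))%E).
  rewrite [leRHS](big_cat_nat (n := n)) //=; last by rewrite -addnn leq_addr.
  by rewrite leeDl // sume_ge0.
elim: n => [|n IH]; first by rewrite !big_nil adde0.
rewrite doubleS !big_nat_recr //= interleave_double interleave_doubleS.
rewrite addeACA -[leLHS]addeA leeD // lee_add2l //.
Qed.

Lemma sim_preim_open (X Z : metricType R) a (f : X -> Z) (A : set Z) :
  is_sim a f -> open A -> open (f @^-1` A).
Proof.
move=> [a0 fa] /open_mdistE oA; apply/open_mdistE => x /oA[e e0 eA].
exists (e / a); first exact: divr_gt0.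
by move=> y xy; apply: eA; rewrite fa mulrC -ltr_pdivlMr.
Qed.

Lemma sim_image_open (X Z : metricType R) a gap (f : X -> Z) (A : set X) :
  is_sim a f -> 0 < gap ->
  (forall x z, mdist (f x) z < gap -> exists x', z = f x') ->
  open A -> open (f @` A).
Proof.
move=> [a0 fa] gap0 fgap /open_mdistE oA; apply/open_mdistE => _ [x /oA[e e0 eA] <-].
exists (Num.min gap (a * e)); first by rewrite lt_min gap0 mulr_gt0.
move=> z; rewrite lt_min => /andP[/fgap[x' ->]]; rewrite fa ltr_pM2l // => xx'.
by exists x' => //; exact: eA.
Qed.

(** The range of [f] is clopen because of [gap]: a cover of [X] is pushed forward and completed by
    the complement of the range, and a refinement is pulled back. *)
Lemma covering_dim_part (X Z : metricType R) a gap (f : X -> Z) (x0 : X) m :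
  is_sim a f -> 0 < gap ->
  (forall x z, mdist (f x) z < gap -> exists x', z = f x') ->
  covering_dim_lt Z m -> covering_dim_lt X m.
Proof.
move=> fs gap0 fgap H U fU [oU cU].
have [||V [fV [oV cV] rV mV]] := H ([set f @` A | A in U] `|` [set ~` range f]).
- by rewrite finite_setU; split; [exact: finite_image|exact: finite_set1].
- split=> [_ [[A /oU oA <-]|->]|].
  + exact: (sim_image_open fs gap0 fgap oA).
  + apply/open_mdistE => z nz; exists gap => // w zw [x _ xw]; apply: nz.
    have [|x' ->] := fgap x z; last by exists x'.
    by rewrite xw metric_sym.
  + rewrite -subTset => z _; have [[x _ <-]|nz] := pselect (range f z).
      have [A UA Ax] : (\bigcup_(A in U) A) x by rewrite cU.
      by exists (f @` A); [left; exists A|exists x].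
    by exists (~` range f) => //; right.
(* Members of [V] in the complement of the range pull back to the empty set, which must still lie in
   some member of [U]. *)
have [A0 UA0 _] : (\bigcup_(A in U) A) x0 by rewrite cU.
exists [set f @^-1` B | B in V]; split.
- exact: finite_image.
- split=> [_ [B /oV oB <-]|]; first exact: (sim_preim_open fs oB).
  rewrite -subTset => x _; have [B VB Bx] : (\bigcup_(B in V) B) (f x) by rewrite cV.
  by exists (f @^-1` B) => //; exists B.
- move=> _ [B VB <-]; have [_ [[A UA <-]|->] BA] := rV _ VB.
    by exists A => // x /BA[y Ay /(sim_inj fs) <-].
  by exists A0 => // x /BA []; exists x.
- move=> F Finj FV; rewrite -subset0 => x Fx.
  have /choice[B HB] : forall i, exists B, V B /\ f @^-1` B = F i.
    by move=> i; have [B VB <-] := FV i; exists B.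
  have := mV B _ (fun i => (HB i).1); rewrite -subset0 => mB; apply: (mB _ (f x)).
    by move=> i j ij; apply: Finj; rewrite -(HB i).2 -(HB j).2 ij.
  by move=> i _; have := Fx i I; rewrite -(HB i).2.
Qed.

Section Union.
Variables (X Y Z : metricType R) (a b gap : R) (f : X -> Z) (g : Y -> Z).
Hypotheses (fs : is_sim a f) (gs : is_sim b g).
Hypothesis fg : forall z, (exists x, z = f x) \/ (exists y, z = g y).
Hypothesis gap0 : 0 < gap.
Hypothesis fgap : forall x y, gap <= mdist (f x) (g y).

Lemma sepb_union B r K1 K2 :
  sepb (f @^-1` B) (r / a) K1 -> sepb (g @^-1` B) (r / b) K2 ->
  sepb B r (K1 + K2).
Proof.
move=> s1 s2 l lB ls; have [a0 fa] := fs; have [b0 gb] := gs.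
have split_l : exists l1 l2, [/\ {subset (map f l1) <= l}, {subset (map g l2) <= l},
    size l = (size l1 + size l2)%N & sepl r (map f l1) /\ sepl r (map g l2)].
  elim: l ls {lB} => [|z l IH]; first by exists [::], [::].
  rewrite /sepl /= => /andP[zl /IH[l1 [l2 [fl1 gl2 sl [s1' s2']]]]].
  have [[x zx]|[y zy]] := fg z.
    exists (x :: l1), l2; split=> /=.
    - by move=> w; rewrite /= !inE -zx => /orP[->//|/fl1 ->]; rewrite orbT.
    - by move=> w /gl2; rewrite inE => ->; rewrite orbT.
    - by rewrite sl addSn.
    - split=> //; rewrite -zx; apply/andP; split=> //.
      by apply/allP => w /fl1; move/allP: zl; apply.
  exists l1, (y :: l2); split=> /=.
  - by move=> w /fl1; rewrite inE => ->; rewrite orbT.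
  - by move=> w; rewrite /= !inE -zy => /orP[->//|/gl2 ->]; rewrite orbT.
  - by rewrite sl addnS.
  - split=> //; rewrite -zy; apply/andP; split=> //.
    by apply/allP => w /gl2; move/allP: zl; apply.
have [l1 [l2 [fl1 gl2 -> [s1' s2']]]] := split_l.
rewrite natrD; apply: lerD.
  apply: s1 => [x xl|]; first by apply: lB; apply: fl1; exact: map_f.
  move: s1'; rewrite /sepl pairwise_map; apply: sub_pairwise => x y /=.
  by rewrite fa ltr_pdivrMr // mulrC.
apply: s2 => [x xl|]; first by apply: lB; apply: gl2; exact: map_f.
move: s2'; rewrite /sepl pairwise_map; apply: sub_pairwise => x y /=.
by rewrite gb ltr_pdivrMr // mulrC.
Qed.

Lemma bpow_union B s : bpow (f @^-1` B) s -> bpow (g @^-1` B) s -> bpow B s.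
Proof.
move=> [C1 [d1 [d10 s1]]] [C2 [d2 [d20 s2]]].
have [a0 _] := fs; have [b0 _] := gs.
exists (C1 * (a^-1) `^ (- s) + C2 * (b^-1) `^ (- s)), (Num.min (d1 * a) (d2 * b)).
split=> [|r]; first by rewrite lt_min !mulr_gt0.
rewrite lt_min => /andP[r0 /andP[ra rb]].
have H1 : sepb (f @^-1` B) (r / a) (C1 * (r / a) `^ (- s)).
  by apply: s1; rewrite divr_gt0 //= ltr_pdivrMr.
have H2 : sepb (g @^-1` B) (r / b) (C2 * (r / b) `^ (- s)).
  by apply: s2; rewrite divr_gt0 //= ltr_pdivrMr.
apply: sepb_le (sepb_union H1 H2) => //.
rewrite !powRM ?invr_ge0 ?(ltW r0) ?(ltW a0) ?(ltW b0) //.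
by rewrite le_eqVlt; apply/orP; left; apply/eqP; lra.
Qed.

Lemma ppow_union s : ppow X s -> ppow Y s -> ppow Z s.
Proof.
move=> [S [cS bS]] [T [cT bT]].
exists (interleave (fun i => f @` S i) (fun i => g @` T i)); split=> [z _|i].
  have [[x ->]|[y ->]] := fg z.
    have [i _ Si] := cS x I; exists i.*2 => //.
    by rewrite interleave_double; exists x.
  have [i _ Si] := cT y I; exists i.*2.+1 => //.
  by rewrite interleave_doubleS; exists y.
have disj x y : f x <> g y.
  by move=> xy; have := fgap x y; rewrite xy mdistxx leNgt gap0.
rewrite /interleave; case: ifP => _; apply: bpow_union.
- rewrite (_ : _ @^-1` _ = set0); first exact: bpow_set0.
  by rewrite -subset0 => x [y _ /esym/disj].
- rewrite (_ : _ @^-1` _ = T i./2) //; apply/seteqP; split=> [y [y' Ty']|y Ty /=].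
    by move/(sim_inj gs) => <-.
  by exists y.
- rewrite (_ : _ @^-1` _ = S i./2) //; apply/seteqP; split=> [y [y' Ty']|y Ty /=].
    by move/(sim_inj fs) => <-.
  by exists y.
- rewrite (_ : _ @^-1` _ = set0); first exact: bpow_set0.
  by rewrite -subset0 => x [y _ /disj].
Qed.

(** The centre [z] may lie outside the range of [h]. The ball is recentred at a point of the list,
    which doubles its radius and costs the factor 2^s. *)
Lemma apow_part (W : metricType R) c (h : W -> Z) (C : R) s z rho r :
  is_sim c h -> 0 <= s -> 0 <= C -> 0 < r -> r < rho ->
  (forall x rho r, 0 < r -> r < rho -> sepb (cball (x : W) rho) r (C * (rho / r) `^ s)) ->
  sepb (h @^-1` cball z rho) (r / c) (C * 2 `^ s * (rho / r) `^ s).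
Proof.
move=> [c0 hc] s0 C0 r0 rrho sA [|x l] lA ls.
  by rewrite /= !mulr_ge0 ?powR_ge0.
have rho0 : 0 < rho by exact: lt_trans rrho.
rewrite -mulrA -powRM ?divr_ge0 ?(ltW rho0) ?(ltW r0) //.
have -> : 2 * (rho / r) = (2 * rho / c) / (r / c).
  by rewrite invf_div [RHS]mulrA divfK ?gt_eqF // mulrA.
apply: (sA x) => //.
- by rewrite divr_gt0.
- by rewrite ltr_pM2r ?invr_gt0 //; lra.
- move=> y yl; rewrite /cball /= ler_pdivlMr // mulrC -hc.
  apply: le_trans (metric_triangle _ z _) _; rewrite mulr2n mulrDl mul1r.
  have := lA x (mem_head _ _); have := lA y yl; rewrite /cball /= => zy zx.
  by rewrite lerD // metric_sym.
Qed.

Lemma apow_union s : 0 <= s -> apow X s -> apow Y s -> apow Z s.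
Proof.
move=> s0 [C1 s1] [C2 s2].
have pos (W : metricType R) C : (forall x rho r, 0 < r -> r < rho ->
     sepb (cball (x : W) rho) r (C * (rho / r) `^ s)) ->
   (forall x rho r, 0 < r -> r < rho ->
     sepb (cball (x : W) rho) r (Num.max C 0 * (rho / r) `^ s)).
  move=> sC x rho r r0 rrho; apply: sepb_le (sC x rho r r0 rrho) => //.
  by rewrite ler_wpM2r ?powR_ge0 // le_max lexx.
exists (Num.max C1 0 * 2 `^ s + Num.max C2 0 * 2 `^ s) => z rho r r0 rrho.
rewrite mulrDl; apply: sepb_union.
  by apply: (apow_part fs) => //; [rewrite le_max lexx orbT|exact: pos].
by apply: (apow_part gs) => //; [rewrite le_max lexx orbT|exact: pos].
Qed.

Lemma hpow_union s : 0 < s -> hpow X s -> hpow Y s -> hpow Z s.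
Proof.
move=> s0 hX hY e e0; have [a0 fa] := fs; have [b0 gb] := gs.
have as0 : 0 < a `^ s by rewrite powR_gt0.
have bs0 : 0 < b `^ s by rewrite powR_gt0.
have [|S [cS sS]] := hX (e / 2 / a `^ s); first by rewrite !divr_gt0.
have [|T [cT sT]] := hY (e / 2 / b `^ s); first by rewrite !divr_gt0.
exists (interleave (fun i => f @` S i) (fun i => g @` T i)); split=> [z _|n].
  have [[x ->]|[y ->]] := fg z.
    have [i _ Si] := cS x I; exists i.*2 => //.
    by rewrite interleave_double; exists x.
  have [i _ Si] := cT y I; exists i.*2.+1 => //.
  by rewrite interleave_doubleS; exists y.
apply: le_trans (sum_interleave _ _ _ _) _; first by move=> A; exact: diam_pow_ge0.
rewrite [e]splitr EFinD; apply: leeD.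
  apply: (@le_trans _ _ (\sum_(0 <= i < n) (a `^ s)%:E * diam_pow s (S i))%E).
    apply: lee_sum => i _; apply: diam_pow_scale => //.
    move=> _ _ [x Sx <-] [y Sy <-]; exists x, y; split=> //.
    by rewrite fa.
  rewrite -ge0_sume_distrr; last by move=> i _; exact: diam_pow_ge0.
  apply: le_trans (lee_wpmul2l _ (sS n)) _; first by rewrite lee_fin ltW.
  by rewrite -EFinM lee_fin mulrC divfK // gt_eqF.
apply: (@le_trans _ _ (\sum_(0 <= i < n) (b `^ s)%:E * diam_pow s (T i))%E).
  apply: lee_sum => i _; apply: diam_pow_scale => //.
  move=> _ _ [x Sx <-] [y Sy <-]; exists x, y; split=> //.
  by rewrite gb.
rewrite -ge0_sume_distrr; last by move=> i _; exact: diam_pow_ge0.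
apply: le_trans (lee_wpmul2l _ (sT n)) _; first by rewrite lee_fin ltW.
by rewrite -EFinM lee_fin mulrC divfK // gt_eqF.
Qed.

(** The two parts are open and disjoint: they are refined separately, and members with a common
    point all come from the same part. *)
Lemma covering_dim_union m :
  covering_dim_lt X m -> covering_dim_lt Y m -> covering_dim_lt Z m.
Proof.
have disj x y : f x <> g y.
  by move=> xy; have := fgap x y; rewrite xy mdistxx leNgt gap0.
have fgap' x z : mdist (f x) z < gap -> exists x', z = f x'.
  have [[x' ->]|[y ->]] := fg z; first by exists x'.
  by rewrite ltNge fgap.
have ggap' y z : mdist (g y) z < gap -> exists y', z = g y'.
  have [[x ->]|[y' ->]] := fg z; last by exists y'.
  by rewrite metric_sym ltNge fgap.
move=> HX HY U fU [oU cU].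
have pre (W : metricType R) c (h : W -> Z) : is_sim c h ->
    finite_set [set h @^-1` A | A in U] /\ open_cover [set h @^-1` A | A in U].
  move=> hs; split; first exact: finite_image.
  split=> [_ [A /oU oA <-]|]; first exact: (sim_preim_open hs oA).
  rewrite -subTset => w _; have [A UA Aw] : (\bigcup_(A in U) A) (h w) by rewrite cU.
  by exists (h @^-1` A) => //; exists A.
have [V1 [fV1 [oV1 cV1] rV1 mV1]] := HX _ (pre _ _ _ fs).1 (pre _ _ _ fs).2.
have [V2 [fV2 [oV2 cV2] rV2 mV2]] := HY _ (pre _ _ _ gs).1 (pre _ _ _ gs).2.
exists ([set f @` B | B in V1] `|` [set g @` B | B in V2]); split.
- by rewrite finite_setU; split; exact: finite_image.
- split=> [_ [[B VB <-]|[B VB <-]]|].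
  + exact: (sim_image_open fs gap0 fgap' (oV1 _ VB)).
  + exact: (sim_image_open gs gap0 ggap' (oV2 _ VB)).
  + rewrite -subTset => z _; have [[x ->]|[y ->]] := fg z.
      have [B VB Bx] : (\bigcup_(A in V1) A) x by rewrite cV1.
      by exists (f @` B); [left; exists B|exists x].
    have [B VB Bx] : (\bigcup_(A in V2) A) y by rewrite cV2.
    by exists (g @` B); [right; exists B|exists y].
- move=> _ [[B VB <-]|[B VB <-]].
    by have [_ [A UA <-] BA] := rV1 _ VB; exists A => // _ [x /BA ? <-].
  by have [_ [A UA <-] BA] := rV2 _ VB; exists A => // _ [x /BA ? <-].
- move=> F Finj FV; rewrite -subset0 => z Fz; have [[x zx]|[y zy]] := fg z.
    have HF i : exists B, V1 B /\ F i = f @` B.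
      have Fi := Fz i I; have [[B VB BF]|[B VB BF]] := FV i; first by exists B.
      by move: Fi; rewrite -BF zx => -[y _ /esym/disj].
    have [B HB] := choice HF.
    have := mV1 B _ (fun i => (HB i).1); rewrite -subset0 => mB; apply: (mB _ x).
      by move=> i j ij; apply: Finj; rewrite (HB i).2 (HB j).2 ij.
    by move=> i _; have := Fz i I; rewrite (HB i).2 zx => -[x' Bx' /(sim_inj fs) <-].
  have HF i : exists B, V2 B /\ F i = g @` B.
    have Fi := Fz i I; have [[B VB BF]|[B VB BF]] := FV i; last by exists B.
    by move: Fi; rewrite -BF zy => -[x _ /disj].
  have [B HB] := choice HF.
  have := mV2 B _ (fun i => (HB i).1); rewrite -subset0 => mB; apply: (mB _ y).
    by move=> i j ij; apply: Finj; rewrite (HB i).2 (HB j).2 ij.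
  by move=> i _; have := Fz i I; rewrite (HB i).2 zy => -[x' Bx' /(sim_inj gs) <-].
Qed.

Lemma covering_dim_unionE m (x0 : X) : covering_dim_lt Z m -> covering_dim_lt X m.
Proof.
apply: (covering_dim_part x0 fs gap0) => x z.
by have [[x' ->]|[y ->]] := fg z; [exists x'|rewrite ltNge fgap].
Qed.

End Union.
Lemma dim_H_ge0 (X : metricType R) : (0 <= dim_H X)%E.
Proof. by apply/ereal_infP => _ [s [s0 _] <-]; rewrite lee_fin. Qed.

Lemma dim_P_ge0 (X : metricType R) : (0 <= dim_P X)%E.
Proof. by apply/ereal_infP => _ [s [s0 _] <-]; rewrite lee_fin. Qed.

Lemma dim_A_ge0 (X : metricType R) : (0 <= dim_A X)%E.
Proof. by apply/ereal_infP => _ [s [s0 _] <-]; rewrite lee_fin ltW. Qed.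

Lemma upper_dim_B_ge0 (X : metricType R) (x0 : X) : (0 <= upper_dim_B X)%E.
Proof.
apply/ereal_infP => _ [V /at_right0P[d d0 dV] <-].
pose r := Num.min (d / 2) (1 / 2).
have r0 : 0 < r by rewrite lt_min !divr_gt0.
have rd : r < d by rewrite gt_min; apply/orP; left; lra.
have r1 : r < 1 by rewrite gt_min; apply/orP; right; lra.
apply: (@le_trans _ _ (lne (covering_number [set: X] r) * ((- ln r)^-1)%:E)%E); last first.
  by apply: ereal_sup_ubound; exists r => //; apply: dV; rewrite r0 rd.
apply: mule_ge0; last by rewrite lee_fin invr_ge0 oppr_ge0 ln_le0 // ltW.
rewrite lne_ge0; apply/ereal_infP => _ [n [A [_ An cA]] <-].
rewrite lee_fin ler1n lt0n; apply/eqP => n0; move: An; rewrite n0 II0 card_eq0 => /eqP A0.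
by have [a] := cA x0 I; rewrite A0.
Qed.

(** Reduces a comparison of dimensions to positive real exponents above [E], where the growth
    predicates apply. *)
Lemma ereal_le_approx (D E : \bar R) : (0 <= E)%E ->
  (forall s : R, 0 < s -> (E < s%:E)%E -> (D <= s%:E)%E) -> (D <= E)%E.
Proof.
move=> E0 H; case: E E0 H => [e| |] E0 H; [|exact: leey|by []].
apply/lee_addgt0Pr => h h0; rewrite -EFinD; apply: H.
  by rewrite -[ltLHS]addr0 ler_ltD.
by rewrite lte_fin ltrDl.
Qed.

Lemma ereal_max_approx (D E F : \bar R) : (0 <= E)%E ->
  (forall s : R, 0 < s -> (E < s%:E)%E -> (F < s%:E)%E -> (D <= s%:E)%E) ->
  (E <= D)%E -> (F <= D)%E -> D = maxe E F.
Proof.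
move=> E0 H ED FD; apply/eqP; rewrite eq_le ge_max ED FD !andbT.
apply: ereal_le_approx; first by rewrite le_max E0.
by move=> s s0; rewrite gt_max => /andP[]; exact: H.
Qed.

(** The candidates in the infimum are integers, so a value below the next integer is witnessed by
    some k <= m. *)
Lemma dim_T_leP (T : topologicalType) (m : nat) :
  (dim_T R T <= (m%:R - 1)%:E)%E <-> covering_dim_lt T m.
Proof.
split=> [H|H]; last by apply: ge_ereal_inf; exists (m%:R - 1)%:E => //; exists m.
have : (dim_T R T < (m.+1%:R - 1)%:E)%E.
  by apply: le_lt_trans H _; rewrite lte_fin ltrD2r ltr_nat.
move=> /ereal_inf_lt[_ [k ck <-]]; rewrite lte_fin ltrD2r ltr_nat ltnS => km.
exact: covering_dim_lt_le ck.
Qed.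

Lemma dim_T_eq (T U : topologicalType) :
  (forall m, covering_dim_lt T m <-> covering_dim_lt U m) ->
  dim_T R T = dim_T R U.
Proof.
move=> TU; congr ereal_inf; apply/seteqP.
by split=> _ [m cm <-]; exists m => //; apply/TU.
Qed.

Section UnionDims.
Variables (X Y Z : metricType R) (a b gap : R) (f : X -> Z) (g : Y -> Z).
Hypotheses (fs : is_sim a f) (gs : is_sim b g).
Hypothesis fg : forall z, (exists x, z = f x) \/ (exists y, z = g y).
Hypothesis gap0 : 0 < gap.
Hypothesis fgap : forall x y, gap <= mdist (f x) (g y).
Variables (x0 : X) (y0 : Y).

Lemma dim_H_union : dim_H Z = maxe (dim_H X) (dim_H Y).
Proof.
have [a0 _] := fs; have [b0 _] := gs.
apply: ereal_max_approx; first exact: dim_H_ge0.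
- move=> s s0 /(lt_dim_H s0) hX /(lt_dim_H s0) hY.
  by apply: dim_H_le => //; apply: (hpow_union fs gs fg).
- apply: ereal_le_approx (dim_H_ge0 _) _ => s s0 /(lt_dim_H s0) hZ.
  by apply: dim_H_le => //; apply: (hpow_sim s0 fs).
- apply: ereal_le_approx (dim_H_ge0 _) _ => s s0 /(lt_dim_H s0) hZ.
  by apply: dim_H_le => //; apply: (hpow_sim s0 gs).
Qed.

Lemma dim_P_union : dim_P Z = maxe (dim_P X) (dim_P Y).
Proof.
apply: ereal_max_approx; first exact: dim_P_ge0.
- move=> s s0 /(lt_dim_P x0 s0) hX /(lt_dim_P y0 s0) hY.
  by apply: (dim_P_le (f x0)); [exact: ltW|apply: (ppow_union fs gs fg gap0 fgap)].
- apply: ereal_le_approx (dim_P_ge0 _) _ => s s0 /(lt_dim_P (f x0) s0) hZ.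
  by apply: (dim_P_le x0); [exact: ltW|apply: (ppow_sim fs)].
- apply: ereal_le_approx (dim_P_ge0 _) _ => s s0 /(lt_dim_P (f x0) s0) hZ.
  by apply: (dim_P_le y0); [exact: ltW|apply: (ppow_sim gs)].
Qed.

Lemma upper_dim_B_union : upper_dim_B Z = maxe (upper_dim_B X) (upper_dim_B Y).
Proof.
have B0 := upper_dim_B_ge0.
apply: ereal_max_approx; first exact: B0.
- move=> s s0 /(lt_upper_dim_B s0) hX /(lt_upper_dim_B s0) hY.
  by apply: upper_dim_B_le; apply: (bpow_union fs gs fg).
- apply: (ereal_le_approx (B0 _ (f x0))) => s s0 /(lt_upper_dim_B s0) hZ.
  by apply: upper_dim_B_le; apply: (bpow_sim fs hZ).
- apply: (ereal_le_approx (B0 _ (f x0))) => s s0 /(lt_upper_dim_B s0) hZ.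
  by apply: upper_dim_B_le; apply: (bpow_sim gs hZ).
Qed.

Lemma dim_A_union : dim_A Z = maxe (dim_A X) (dim_A Y).
Proof.
apply: ereal_max_approx; first exact: dim_A_ge0.
- move=> s s0 /lt_dim_A hX /lt_dim_A hY.
  by apply: dim_A_le => //; apply: (apow_union fs gs fg) => //; exact: ltW.
- apply: ereal_le_approx (dim_A_ge0 _) _ => s s0 /lt_dim_A hZ.
  by apply: dim_A_le => //; apply: (apow_sim fs).
- apply: ereal_le_approx (dim_A_ge0 _) _ => s s0 /lt_dim_A hZ.
  by apply: dim_A_le => //; apply: (apow_sim gs).
Qed.

Lemma dim_T_union : (dim_T R Y <= dim_T R X)%E -> dim_T R Z = dim_T R X.
Proof.
move=> YX; apply: dim_T_eq => m; split.
  exact: (covering_dim_unionE fs fg gap0 fgap x0).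
move=> cX; apply: (covering_dim_union fs gs fg gap0 fgap) => //.
by apply/dim_T_leP; apply: le_trans YX _; apply/dim_T_leP.
Qed.

End UnionDims.

Lemma dim_T_ge (T : topologicalType) (n : nat) :
  ~ covering_dim_lt T n -> (n%:R%:E <= dim_T R T)%E.
Proof.
move=> nc; apply/ereal_infP => _ [m cm <-]; rewrite lee_fin lerBrDr natr1 ler_nat.
by rewrite ltnNge; apply/negP => mn; apply: nc; exact: covering_dim_lt_le cm.
Qed.

End Similarity.

(** * Wedges of compact spaces *)

Section Wedge.
Variable R : realType.

Definition dspace_of (X : compactMetric R) : dspace R :=
  @DSpace R X mdist (@mdistxx R X) (@mdist_positivity R X) (@metric_sym R X)
    (fun y x z => @metric_triangle R X x y z).

(* Makes a scaling factor positive without carrying a proof. *)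
Definition pos (s : R) : R := if 0 < s then s else 1.

Lemma pos_gt0 s : 0 < pos s.
Proof. by rewrite /pos; case: ifP. Qed.

Lemma posE s : 0 < s -> pos s = s.
Proof. by rewrite /pos => ->. Qed.

Section Wedge.
Variables (X Y : dspace R) (x0 : dtype X) (y0 : dtype Y) (s t : R).

Let gap := Num.min (pos s) (pos t).

(** The base points are [gap] apart instead of identified. Both copies are therefore open, and when
    one factor tends to 0 its copy and the gap shrink together. *)
Definition wcross (x : dtype X) (y : dtype Y) : R :=
  pos s * mdist x x0 + gap + pos t * mdist y0 y.

Definition wdist (p q : dtype X + dtype Y) : R :=
  match p, q with
  | inl x, inl x' => pos s * mdist x x'
  | inr y, inr y' => pos t * mdist y y'
  | inl x, inr y => wcross x y
  | inr y, inl x => wcross x y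
  end.

Lemma gap_gt0 : 0 < gap.
Proof. by rewrite lt_min !pos_gt0. Qed.

Lemma wcross_ge x y : gap <= wcross x y.
Proof.
rewrite /wcross addrAC lerDr addr_ge0 // mulr_ge0 ?mdist_ge0 //; exact/ltW/pos_gt0.
Qed.

Lemma wdistxx p : wdist p p = 0.
Proof. by case: p => x /=; rewrite mdistxx mulr0. Qed.

Lemma wdist_eq0 p q : wdist p q = 0 -> p = q.
Proof.
have ne x y : wcross x y <> 0.
  by move=> xy; have := wcross_ge x y; rewrite xy leNgt gap_gt0.
case: p q => [x|y] [x'|y'] /=; try by move/ne.
  by move/eqP; rewrite mulf_eq0 gt_eqF ?pos_gt0 //= => /eqP/mdist_positivity ->.
by move/eqP; rewrite mulf_eq0 gt_eqF ?pos_gt0 //= => /eqP/mdist_positivity ->.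
Qed.

Lemma wdist_sym p q : wdist p q = wdist q p.
Proof. by case: p q => [x|y] [x'|y'] //=; rewrite metric_sym. Qed.

Lemma wdist_tri q p r : wdist p r <= wdist p q + wdist q r.
Proof.
have s0 := pos_gt0 s; have t0 := pos_gt0 t; have g0 := gap_gt0.
have tri (Z : dspace R) (c : R) (x y z : dtype Z) : 0 < c ->
    c * mdist x z <= c * mdist x y + c * mdist y z.
  by move=> c0; rewrite -mulrDr ler_pM2l // metric_triangle.
have nn (Z : dspace R) (c : R) (x y : dtype Z) : 0 < c -> 0 <= c * mdist x y.
  by move=> c0; rewrite mulr_ge0 ?mdist_ge0 // ltW.
case: p q r => [x|y] [x'|y'] [x''|y''] /=; rewrite /wcross.
- exact: tri.
- have := tri X _ x x' x0 s0; lra.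
- have := tri X _ x x0 x'' s0; have := nn Y _ y0 y' t0.
  rewrite (metric_sym x0); lra.
- have := tri Y _ y0 y' y'' t0; lra.
- have := tri X _ x'' x' x0 s0; rewrite (metric_sym x' x''); lra.
- have := tri Y _ y y0 y'' t0; have := nn X _ x' x0 s0.
  rewrite (metric_sym y0 y); lra.
- have := tri Y _ y0 y' y t0; rewrite (metric_sym y' y); lra.
- exact: tri.
Qed.

Definition wedge : dspace R := DSpace wdistxx wdist_eq0 wdist_sym wdist_tri.

End Wedge.

Lemma sim_continuous (X Z : metricType R) a (f : X -> Z) :
  is_sim a f -> continuous f.
Proof. by move=> fs; apply/continuousP => A; exact: (sim_preim_open fs). Qed.

Lemma union_compact (X Y Z : metricType R) a b (f : X -> Z) (g : Y -> Z) :
  is_sim a f -> is_sim b g ->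
  (forall z, (exists x, z = f x) \/ (exists y, z = g y)) ->
  compact [set: X] -> compact [set: Y] -> compact [set: Z].
Proof.
move=> fs gs fg cX cY.
have -> : [set: Z] = f @` setT `|` g @` setT.
  apply/esym; rewrite -subTset => z _; have [[x ->]|[y ->]] := fg z.
    by left; exists x.
  by right; exists y.
by apply: compactU; apply: continuous_compact => //;
   apply: continuous_subspaceT; [exact: sim_continuous fs|exact: sim_continuous gs].
Qed.

Section CompactWedge.
Variables (X Y : compactMetric R) (x0 : X) (y0 : Y) (s t : R).

Definition wedge_of : dspace R :=
  @wedge (dspace_of X) (dspace_of Y) x0 y0 s t.

Definition wl (x : X) : dtype wedge_of := inl x.
Definition wr (y : Y) : dtype wedge_of := inr y.

Lemma wl_sim : is_sim (pos s) wl. Proof. by split; [exact: pos_gt0|]. Qed.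
Lemma wr_sim : is_sim (pos t) wr. Proof. by split; [exact: pos_gt0|]. Qed.

Lemma wedge_of_cases (z : dtype wedge_of) :
  (exists x, z = wl x) \/ (exists y, z = wr y).
Proof. by case: z => [x|y]; [left; exists x|right; exists y]. Qed.

Lemma wedge_of_gap x y : Num.min (pos s) (pos t) <= mdist (wl x) (wr y).
Proof. exact: wcross_ge. Qed.

Lemma wedge_of_nonempty : [set: dtype wedge_of] !=set0.
Proof. by exists (wl x0). Qed.

Lemma wedge_of_compact : compact [set: dtype wedge_of].
Proof.
apply: (union_compact wl_sim wr_sim wedge_of_cases); exact: cm_compact.
Qed.

Definition cwedge : compactMetric R := cspace wedge_of_nonempty wedge_of_compact.

Lemma cwedge_dim_T : (dim_T R Y <= dim_T R X)%E -> dim_T R cwedge = dim_T R X.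
Proof.
exact: (dim_T_union wl_sim wr_sim wedge_of_cases (gap_gt0 s t) wedge_of_gap x0).
Qed.

Lemma cwedge_dim_H : dim_H cwedge = maxe (dim_H X) (dim_H Y).
Proof. exact: (dim_H_union wl_sim wr_sim wedge_of_cases). Qed.

Lemma cwedge_dim_P : dim_P cwedge = maxe (dim_P X) (dim_P Y).
Proof.
exact: (dim_P_union wl_sim wr_sim wedge_of_cases (gap_gt0 s t) wedge_of_gap x0 y0).
Qed.

Lemma cwedge_dim_B : upper_dim_B cwedge = maxe (upper_dim_B X) (upper_dim_B Y).
Proof. exact: (upper_dim_B_union wl_sim wr_sim wedge_of_cases x0). Qed.

Lemma cwedge_dim_A : dim_A cwedge = maxe (dim_A X) (dim_A Y).
Proof. exact: (dim_A_union wl_sim wr_sim wedge_of_cases). Qed.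

End CompactWedge.

Definition has_dims (l a1 a2 a3 a4 : \bar R) (X : compactMetric R) : Prop :=
  [/\ dim_T R X = l, dim_H X = a1, dim_P X = a2, upper_dim_B X = a3
    & dim_A X = a4].

Lemma has_dims_cwedge l a1 a2 a3 a4 (X Y : compactMetric R) (x0 : X) (y0 : Y) s t :
  has_dims l a1 a2 a3 a4 X ->
  (dim_T R Y <= l)%E -> (dim_H Y <= a1)%E -> (dim_P Y <= a2)%E ->
  (upper_dim_B Y <= a3)%E -> (dim_A Y <= a4)%E ->
  has_dims l a1 a2 a3 a4 (cwedge x0 y0 s t).
Proof.
move=> [TX HX PX BX AX] TY HY PY BY AY; split.
- by rewrite cwedge_dim_T TX.
- by rewrite cwedge_dim_H HX max_l.
- by rewrite cwedge_dim_P PX max_l.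
- by rewrite cwedge_dim_B BX max_l.
- by rewrite cwedge_dim_A AX max_l.
Qed.

End Wedge.

(** * Gromov-Hausdorff distance *)

Section GromovHausdorff.
Variable R : realType.
Implicit Types X Y : compactMetric R.

Section Glue.
Variables (X Y : compactMetric R) (rel : X -> Y -> Prop) (e : R).
Hypothesis e0 : 0 < e.
Hypothesis totl : forall x, exists y, rel x y.
Hypothesis totr : forall y, exists x, rel x y.
Hypothesis dis : forall x x' y y', rel x y -> rel x' y' ->
  `|mdist x x' - mdist y y'| <= 2 * e.

Let cset (x : X) (y : Y) : set R :=
  [set r | exists a b, rel a b /\ r = mdist x a + e + mdist b y].

(** The usual metric on a disjoint union attached to a correspondence: related points are exactly
    [e] apart. Distortion at most 2 * e is what the triangle inequality through the other space
    requires. *)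
Definition glue_cross (x : X) (y : Y) : R := inf (cset x y).

Lemma cset_ge x y r : cset x y r -> e <= r.
Proof.
by move=> [a [b [_ ->]]]; rewrite addrAC lerDr addr_ge0 ?mdist_ge0.
Qed.

Lemma cset_ne x y : cset x y !=set0.
Proof. by have [b ab] := totl x; exists (mdist x x + e + mdist b y), x, b. Qed.

Lemma glue_le x y a b : rel a b -> glue_cross x y <= mdist x a + e + mdist b y.
Proof.
move=> ab; apply: ge_inf; last by exists a, b.
by exists e => r; exact: cset_ge.
Qed.

Lemma glue_lb x y m :
  (forall a b, rel a b -> m <= mdist x a + e + mdist b y) -> m <= glue_cross x y.
Proof.
move=> H; apply: lb_le_inf; first exact: cset_ne.
by move=> _ [a [b [ab ->]]]; exact: H.
Qed.

Lemma glue_ge x y : e <= glue_cross x y.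
Proof.
by apply: glue_lb => a b _; rewrite addrAC lerDr addr_ge0 ?mdist_ge0.
Qed.

Definition glue_dist (p q : X + Y) : R :=
  match p, q with
  | inl x, inl x' => mdist x x'
  | inr y, inr y' => mdist y y'
  | inl x, inr y => glue_cross x y
  | inr y, inl x => glue_cross x y
  end.

Lemma glue_distxx p : glue_dist p p = 0.
Proof. by case: p => x /=; rewrite mdistxx. Qed.

Lemma glue_dist_eq0 p q : glue_dist p q = 0 -> p = q.
Proof.
have ne x y : glue_cross x y <> 0.
  by move=> xy; have := glue_ge x y; rewrite xy leNgt e0.
by case: p q => [x|y] [x'|y'] /=; try (by move/ne); move/mdist_positivity ->.
Qed.

Lemma glue_dist_sym p q : glue_dist p q = glue_dist q p.
Proof. by case: p q => [x|y] [x'|y'] //=; rewrite metric_sym. Qed.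

Lemma glue_dist_tri q p r : glue_dist p r <= glue_dist p q + glue_dist q r.
Proof.
have ll x x' y : mdist x x' <= glue_cross x y + glue_cross x' y.
  rewrite -lerBlDr; apply: glue_lb => a b ab; rewrite lerBlDr -lerBlDl.
  apply: glue_lb => a' b' ab'.
  have := dis ab ab'; rewrite ler_norml => /andP[_].
  have := metric_triangle x a x'; have := metric_triangle a a' x'.
  have := metric_triangle b y b'; rewrite (metric_sym a' x') (metric_sym y b'); lra.
have rr y y' x : mdist y y' <= glue_cross x y + glue_cross x y'.
  rewrite -lerBlDr; apply: glue_lb => a b ab; rewrite lerBlDr -lerBlDl.
  apply: glue_lb => a' b' ab'.
  have := dis ab ab'; rewrite ler_norml => /andP[+ _].
  have := metric_triangle y b y'; have := metric_triangle b b' y'.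
  have := metric_triangle a x a'; rewrite (metric_sym y b) (metric_sym a x); lra.
have lc x x' y : glue_cross x y <= mdist x x' + glue_cross x' y.
  rewrite -lerBlDl; apply: glue_lb => a b ab.
  by have := glue_le x y ab; have := metric_triangle x x' a; lra.
have rc x y y' : glue_cross x y <= glue_cross x y' + mdist y' y.
  rewrite -lerBlDr; apply: glue_lb => a b ab.
  by have := glue_le x y ab; have := metric_triangle b y' y; lra.
case: p q r => [x|y] [x'|y'] [x''|y''] /=.
- exact: metric_triangle.
- exact: lc.
- exact: ll.
- exact: rc.
- by rewrite addrC metric_sym; exact: lc.
- exact: rr.
- by rewrite addrC metric_sym; exact: rc.
- exact: metric_triangle.
Qed.

Definition glue : dspace R :=
  DSpace glue_distxx glue_dist_eq0 glue_dist_sym glue_dist_tri.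

Lemma gh_dist_le : (gh_dist X Y <= e%:E)%E.
Proof.
pose i (x : X) : dtype glue := inl x.
pose j (y : Y) : dtype glue := inr y.
apply: ge_ereal_inf; exists (hausdorff_dist (range i) (range j)).
  by exists (dtype glue), i, j; split.
have cr x y : rel x y -> mdist (i x) (j y) <= e.
  move=> xy; have := glue_le x y xy; rewrite !mdistxx add0r addr0; exact.
rewrite /hausdorff_dist ge_max; apply/andP; split.
  apply/ereal_supP => _ [_ [x _ <-] <-]; have [y xy] := totl x.
  by apply: ge_ereal_inf; exists (mdist (i x) (j y))%:E;
    [exists (j y) => //; exists y|rewrite lee_fin cr].
apply/ereal_supP => _ [_ [y _ <-] <-]; have [x xy] := totr y.
by apply: ge_ereal_inf; exists (mdist (i x) (j y))%:E;
    [exists (i x) => //; exists x|rewrite lee_fin cr].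
Qed.

End Glue.

Lemma isometric_repr X : isometric (repr (isometry_class X)) X.
Proof.
have /eqmodP : (repr (isometry_class X) = X %[mod GH_space R])%qT.
  by rewrite reprK.
by move/asboolP.
Qed.

Lemma GH_le X Y (rel : X -> Y -> Prop) e : 0 < e ->
  (forall x, exists y, rel x y) -> (forall y, exists x, rel x y) ->
  (forall x x' y y', rel x y -> rel x' y' ->
    `|mdist x x' - mdist y y'| <= 2 * e) ->
  (GH (isometry_class X) (isometry_class Y) <= e%:E)%E.
Proof.
move=> e0 totl totr dis.
have [f [f' fK f'K] fi] := isometric_repr X.
have [g [g' gK g'K] gi] := isometric_repr Y.
apply: (@gh_dist_le _ _ (fun p q => rel (f p) (g q))) => //.
- by move=> p; have [y] := totl (f p); exists (g' y); rewrite g'K.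
- by move=> q; have [x] := totr (g q); exists (f' x); rewrite f'K.
- by move=> p p' q q' /dis/[apply]; rewrite fi gi.
Qed.

(* The Gromov-Hausdorff invariants that detect the parameters of the cube
   embedded in the proof of infinite dimensionality. *)
Definition sep_pts (k : nat) (c : R) (X : metricType R) : Prop :=
  exists p : 'I_k -> X, forall i j, i != j -> c <= mdist (p i) (p j).

Lemma sep_pts_gh k c X Y e : (gh_dist X Y < e%:E)%E ->
  sep_pts k c X -> sep_pts k (c - 2 * e) Y.
Proof.
move=> /ereal_inf_lt[_ [Z [i [j [ii ij ->]]]]]; rewrite gt_max => /andP[H _].
have near (x : X) : exists y : Y, mdist (i x) (j y) < e.
  have : (ereal_inf [set (mdist (i x) b)%:E | b in range j] < e%:E)%E.
    by apply: le_lt_trans H; apply: ereal_sup_ubound; exists (i x) => //; exists x.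
  by move=> /ereal_inf_lt[_ [_ [y _ <-] <-]]; exists y.
have [h hP] := choice near.
move=> [p pc]; exists (h \o p) => a b ab /=.
have := pc a b ab; have := hP (p a); have := hP (p b); rewrite -ii -ij.
have := metric_triangle (i (p a)) (j (h (p a))) (i (p b)).
have := metric_triangle (j (h (p a))) (j (h (p b))) (i (p b)).
rewrite (metric_sym (j (h (p b))) (i (p b))); lra.
Qed.

Lemma gh_dist_sym X Y : gh_dist X Y = gh_dist Y X.
Proof.
congr ereal_inf; apply/seteqP; split=> _ [Z [i [j [ii ij ->]]]].
  exists Z, j, i; split=> //; rewrite /hausdorff_dist maxC; congr maxe;
    congr ereal_sup; apply/seteqP; split=> _ [a ra <-]; exists a => //;
    by congr ereal_inf; apply/seteqP; split=> _ [b rb <-]; exists b => //;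
       rewrite metric_sym.
exists Z, j, i; split=> //; rewrite /hausdorff_dist maxC; congr maxe;
    congr ereal_sup; apply/seteqP; split=> _ [a ra <-]; exists a => //;
    by congr ereal_inf; apply/seteqP; split=> _ [b rb <-]; exists b => //;
       rewrite metric_sym.
Qed.

Lemma sep_pts_class k c X : sep_pts k c (repr (isometry_class X)) <-> sep_pts k c X.
Proof.
have [f [f' fK f'K] fi] := isometric_repr X; split=> -[p pc].
  by exists (f \o p) => i j ij; rewrite /= fi pc.
by exists (f' \o p) => i j ij; rewrite /= -fi !f'K pc.
Qed.

(** The slack [h] makes this set and [sep_lt] open: a change of the space by less than h / 4 costs
    the separation at most h / 2. *)
Definition sep_gt k c : set (GH_space R) :=
  [set x : GH_space R |
    exists2 h : R, 0 < h & sep_pts k (c + h) (repr x : compactMetric R)].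

Definition sep_lt k c : set (GH_space R) :=
  [set x : GH_space R |
    exists2 h : R, 0 < h & ~ sep_pts k (c - h) (repr x : compactMetric R)].

Lemma open_sep_gt k c : open (sep_gt k c).
Proof.
move=> x [h h0 hx]; exists (h / 4); first by rewrite divr_gt0.
move=> y xy; exists (h / 2); first by rewrite divr_gt0.
have := sep_pts_gh xy hx; congr (sep_pts _ _ _); lra.
Qed.

Lemma open_sep_lt k c : open (sep_lt k c).
Proof.
move=> x [h h0 hx]; exists (h / 4); first by rewrite divr_gt0.
move=> y xy; exists (h / 2); first by rewrite divr_gt0.
move: xy; rewrite /= /GH gh_dist_sym => xy hy; apply: hx.
have := sep_pts_gh xy hy; congr (sep_pts _ _ _); lra.
Qed.

Lemma sep_gt_lt k c c' : c < c' -> sep_gt k c `|` sep_lt k c' = setT.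
Proof.
move=> cc'; rewrite -subTset => x _.
have [s|ns] := pselect (sep_pts k ((c + c') / 2) (repr x)); [left|right].
  by exists ((c' - c) / 2); [lra|move: s; congr (sep_pts _ _ _); lra].
by exists ((c' - c) / 2); [lra|move=> s; apply: ns; move: s; congr (sep_pts _ _ _); lra].
Qed.

(* Continuity at a point of a map into the Gromov-Hausdorff space; no triangle
   inequality for GH is needed. *)
Lemma GH_nbhs (T : topologicalType) (g : T -> GH_space R) (t : T) :
  (forall e : R, 0 < e -> \forall u \near t, (GH (g t) (g u) < e%:E)%E) ->
  {for t, continuous g}.
Proof.
move=> H U; rewrite nbhsE => -[V [oV Vgt] VU].
have [e e0 eV] := oV _ Vgt; rewrite /= !near_simpl.
apply: filterS (H e e0) => u tu; exact/VU/eV.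
Qed.

End GromovHausdorff.

(** * Spaces of sequences *)

Section SequenceSpace.
Variable R : realType.

Record weight := Weight {
  wt :> nat -> R;
  wt_gt0 : forall i, 0 < wt i;
  wt_le1 : forall i, wt i <= 1;
  wt_to0 : forall e : R, 0 < e -> exists n, forall i, (n <= i)%N -> wt i <= e }.

(* [sset_closed] is closedness in the product topology. *)
Record seqset := SeqSet {
  sset :> (nat -> R) -> Prop;
  sset01 : forall x i, sset x -> 0 <= x i <= 1;
  sset_closed : forall b,
    (forall (n : nat) (e : R), 0 < e -> exists2 x, sset x &
       forall i, (i < n)%N -> `|x i - b i| <= e) -> sset b }.

Variables (w : weight) (S : seqset).

Definition seqpt : Type := {x : nat -> R | S x}.

Definition seq_of (x : seqpt) : nat -> R := sval x.

Lemma seq_of01 (x : seqpt) i : 0 <= seq_of x i <= 1.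
Proof. exact: sset01 (svalP x). Qed.

Lemma seq_of_diff (x y : seqpt) i : `|seq_of x i - seq_of y i| <= 1.
Proof.
rewrite ler_norml; have /andP[] := seq_of01 x i; have /andP[] := seq_of01 y i; lra.
Qed.

Definition sdist (x y : seqpt) : R :=
  sup [set wt w i * `|seq_of x i - seq_of y i| | i in [set: nat]].

Lemma sdist_ub (x y : seqpt) i : wt w i * `|seq_of x i - seq_of y i| <= sdist x y.
Proof.
apply: ub_le_sup; last by exists i.
exists 1 => _ [j _ <-]; rewrite -[leRHS]mulr1; apply: ler_pM.
- exact/ltW/wt_gt0.
- exact: normr_ge0.
- exact: wt_le1.
- exact: seq_of_diff.
Qed.

Lemma sdist_le (x y : seqpt) c :
  (forall i, wt w i * `|seq_of x i - seq_of y i| <= c) -> sdist x y <= c.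
Proof.
move=> H; apply: ge_sup; first by exists (wt w 0 * `|seq_of x 0 - seq_of y 0|), 0%N.
by move=> _ [i _ <-].
Qed.

Lemma sdistxx x : sdist x x = 0.
Proof.
apply/eqP; rewrite eq_le sdist_le => [|i]; last by rewrite subrr normr0 mulr0.
by apply: le_trans (sdist_ub x x 0); rewrite subrr normr0 mulr0.
Qed.

Lemma sdist_eq0 x y : sdist x y = 0 -> x = y.
Proof.
move=> xy; apply: eq_sig_hprop; first by move=> *; exact: Prop_irrelevance.
apply/funext => i; have := sdist_ub x y i; rewrite xy pmulr_rle0 ?wt_gt0 //.
by rewrite normr_le0 subr_eq0 => /eqP.
Qed.

Lemma sdist_sym x y : sdist x y = sdist y x.
Proof.
by congr sup; apply/seteqP; split=> _ [i _ <-]; exists i => //; rewrite distrC.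
Qed.

Lemma sdist_tri y x z : sdist x z <= sdist x y + sdist y z.
Proof.
apply: sdist_le => i.
apply: le_trans (lerD (sdist_ub x y i) (sdist_ub y z i)).
by rewrite -mulrDr ler_pM2l ?wt_gt0 // ler_distD.
Qed.

Definition seqspace : dspace R :=
  DSpace sdistxx sdist_eq0 sdist_sym sdist_tri.

Local Notation T := (dtype seqspace).

Lemma sdist_prefix (x y : T) n (e : R) :
  (forall i, (n <= i)%N -> wt w i <= e) ->
  (forall i, (i < n)%N -> `|seq_of x i - seq_of y i| <= e) -> mdist x y <= e.
Proof.
move=> we xy; apply: sdist_le => i; have [ni|ni] := leqP n i.
  rewrite -[leRHS]mulr1; apply: ler_pM; rewrite ?normr_ge0 ?we ?seq_of_diff //.
  exact/ltW/wt_gt0.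
rewrite -[leRHS]mul1r; apply: ler_pM; rewrite ?normr_ge0 ?xy ?wt_le1 //.
exact/ltW/wt_gt0.
Qed.

(** Along an ultrafilter every coordinate converges in [0, 1]; the limit sequence is in [S] by
    closedness, and since the weights tend to 0, coordinatewise convergence is convergence for the
    distance. *)
Lemma seqspace_compact : compact [set: T].
Proof.
rewrite compact_ultra => F UF _.
have lim i : exists b : R, (fun x : T => seq_of x i) @ F --> b.
  have : compact `[0, 1 : R] by exact: segment_compact.
  move=> /(_ ((fun x : T => seq_of x i) @ F) _)[|b [_ bF]].
    suff : F ((fun x : T => seq_of x i) @^-1` `[0, 1]) by [].
    by apply: filterE => x; rewrite /= in_itv /=; exact: seq_of01.
  exists b => U Ub; have [//|FnU] := in_ultra_setVsetC ((fun x : T => seq_of x i) @^-1` U) UF.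
  by have [z []] := bF (~` U) U FnU Ub.
have [b bF] := choice lim.
have near_b n (e : R) : 0 < e -> \forall x \near F, forall i, (i < n)%N -> `|seq_of x i - b i| < e.
  move=> e0; have : \forall x \near F, forall i : 'I_n, `|seq_of x i - b i| < e.
    apply: filter_forall => i; have /cvgrPdist_lt/(_ e e0) := bF i.
    by apply: filterS => x; rewrite distrC.
  by apply: filterS => x H i ilt; exact: (H (Ordinal ilt)).
have Sb : S b.
  apply: sset_closed => n e e0.
  have [x Hx] := filter_ex (near_b n e e0).
  by exists (seq_of x); [exact: svalP|move=> i /Hx/ltW].
exists (exist _ b Sb); split=> // U /nbhs_mdistE[e e0 eU].
have [n wn] := wt_to0 w (divr_gt0 e0 (ltr0n R 2)).
have := near_b n (e / 2) (divr_gt0 e0 (ltr0n R 2)).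
apply: filterS => x Hx; apply: eU.
apply: (@le_lt_trans _ _ (e / 2)); last by lra.
by apply: (sdist_prefix wn) => i /Hx/ltW; rewrite distrC.
Qed.

Lemma seqspace_bounded (x y : T) : mdist x y <= 1.
Proof.
apply: sdist_le => i; rewrite -[leRHS]mulr1; apply: ler_pM.
- exact/ltW/wt_gt0.
- exact: normr_ge0.
- exact: wt_le1.
- exact: seq_of_diff.
Qed.

Definition seqspace_cm (ne : exists x, S x) : compactMetric R.
Proof.
apply: (@cspace R seqspace _ seqspace_compact).
by case: ne => x Sx; exists (exist _ x Sx).
Defined.

Lemma coord_open (i : nat) (A : set R) : open A -> open [set x : T | A (seq_of x i)].
Proof.
move=> oA; apply/open_mdistE => x Ax.
have /nbhs_ballP[e /= e0 eA] : nbhs (seq_of x i) A by apply: open_nbhs_nbhs.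
exists (wt w i * e); first by rewrite mulr_gt0 ?wt_gt0.
move=> y xy; apply: eA => /=; rewrite /ball /=.
have := le_lt_trans (sdist_ub x y i) xy.
by rewrite ltr_pM2l ?wt_gt0.
Qed.

End SequenceSpace.

Lemma sepl_card (R : realType) (X : metricType R) (I : finType) (r : R)
    (h : X -> I) (l : seq X) : 0 <= r ->
  (forall x y, x \in l -> y \in l -> r < mdist x y -> h x != h y) ->
  sepl r l -> (size l <= #|I|)%N.
Proof.
move=> r0 hl ls; rewrite -(size_map h).
have : uniq (map h l).
  rewrite uniq_pairwise pairwise_map.
  apply: (@sub_in_pairwise _ (mem l) _ _ _ l _ ls); last exact: allss.
  by move=> x y xl yl /= rxy; exact: hl.
move=> /card_uniqP <-; exact: max_card.
Qed.

(** * Cubes of finite and infinite dimension *)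

Section Cube.
Variable R : realType.

Lemma half_weight : exists w : weight R, True.
Proof.
suff H : forall e : R, 0 < e -> exists n, forall i, (n <= i)%N -> 2^-1 ^+ i <= e.
  by exists (@Weight R (fun i => 2^-1 ^+ i) (fun i => ltac:(by rewrite exprn_gt0 ?invr_gt0))
     (fun i => ltac:(by rewrite exprn_ile1 ?invr_ge0 ?invf_le1 ?ler1n)) H).
move=> e e0; have [p /(_ tt (mem_head _ _))] :=
  @exists_pow_lt R unit [:: tt] (fun=> e) 1 ltr01 (fun _ _ => e0).
rewrite mul1r -exprVn => pe; exists p => i pi; apply: le_trans (ltW pe).
by rewrite ler_wiXn2l ?invr_ge0 ?invf_le1 ?ler1n.
Qed.

(** The statement of [half_weight] forgets the values 2^-i: the cubes rely only on the properties
    recorded in [weight]. *)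
Definition half : weight R := sval (cid half_weight).

(** Covers both cases: the first n indices give the n-cube, all indices the Hilbert cube. *)
Definition subcube_set (P : pred nat) : set (nat -> R) :=
  [set x | forall i, 0 <= x i <= 1 /\ (~~ P i -> x i = 0)].

Lemma subcube_closed (P : pred nat) b :
  (forall (n : nat) (e : R), 0 < e -> exists2 x, subcube_set P x &
       forall i, (i < n)%N -> `|x i - b i| <= e) -> subcube_set P b.
Proof.
move=> H i; split=> [|nPi].
  apply/andP; split.
    rewrite leNgt; apply/negP => bi; have [|x /(_ i)[/andP[x0 _] _]] := H i.+1 (- b i / 2).
      by rewrite divr_gt0 ?oppr_gt0.
    move=> /(_ i (ltnSn i)); rewrite ler_norml => /andP[_]; lra.
  rewrite leNgt; apply/negP => bi; have [|x /(_ i)[/andP[_ x1] _]] := H i.+1 ((b i - 1) / 2).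
    by rewrite divr_gt0 ?subr_gt0.
  move=> /(_ i (ltnSn i)); rewrite ler_norml => /andP[]; lra.
apply/eqP; rewrite -normr_le0; apply/ler_addgt0Pl => e e0; rewrite addr0.
have [x /(_ i)[_ /(_ nPi) x0] /(_ i (ltnSn i))] := H i.+1 e e0.
by rewrite x0 sub0r normrN.
Qed.

Definition subcube (P : pred nat) : seqset R :=
  @SeqSet R (subcube_set P) (fun x i Sx => (Sx i).1) (@subcube_closed P).

Lemma subcube0 P : subcube P (fun=> 0).
Proof. by move=> i; rewrite lexx ler01. Qed.

Definition cube_cm (P : pred nat) : compactMetric R :=
  @seqspace_cm R half (subcube P) (ex_intro (sset (subcube P)) _ (subcube0 P)).

Definition clamp (x : R) : R := Num.min 1 (Num.max 0 x).

Lemma clamp01 x : 0 <= clamp x <= 1.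
Proof. by rewrite /clamp le_min ler01 le_max lexx ge_min lexx. Qed.

Lemma clampE x : 0 <= x <= 1 -> clamp x = x.
Proof. by move=> /andP[x0 x1]; rewrite /clamp max_r // min_r. Qed.

Lemma clamp_lip x y : `|clamp x - clamp y| <= `|x - y|.
Proof.
rewrite /clamp; have [x0|x0] := leP 0 x; have [y0|y0] := leP 0 y;
  rewrite ?(max_r x0) ?(max_l (ltW x0)) ?(max_r y0) ?(max_l (ltW y0));
  rewrite /Num.min; do ?case: ifP; move=> *; rewrite ler_norml;
  have := ler_norm (x - y); have := ler_norm (y - x); rewrite (distrC y x); lra.
Qed.

Variables (P : pred nat) (n : nat).
Hypothesis nP : forall i, (i < n)%N -> P i.

Local Notation K := (dtype (seqspace half (subcube P))).

(** [clamp] makes the parametrization total on 'I_n -> R, as in [lebesgue_covering], without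
    changing it on the cube. *)
Definition cube_fun (x : 'I_n -> R) : nat -> R :=
  fun i => if insub i is Some j then clamp (x j) else 0.

Lemma cube_fun_sub x : subcube P (cube_fun x).
Proof.
move=> i; rewrite /cube_fun; case: insubP => [j _ ji|ni].
  by split; [exact: clamp01|move=> /negP; case; apply: nP; rewrite -ji ltn_ord].
by rewrite lexx ler01.
Qed.

Definition cube_pt (x : 'I_n -> R) : K := exist _ _ (cube_fun_sub x).

Lemma cube_ptE x (i : 'I_n) : 0 <= x i <= 1 -> seq_of (cube_pt x) i = x i.
Proof.
by move=> xi; rewrite /cube_pt /seq_of /= /cube_fun valK clampE.
Qed.

Lemma cube_pt_lip x y (e : R) : 0 <= e -> (forall i, `|x i - y i| <= e) ->
  mdist (cube_pt x) (cube_pt y) <= e.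
Proof.
move=> e0 xy; apply: sdist_le => i; rewrite -[leRHS]mul1r; apply: ler_pM.
- exact/ltW/wt_gt0.
- exact: normr_ge0.
- exact: wt_le1.
rewrite /seq_of /= /cube_fun; case: insubP => [j _ _|_].
  exact: le_trans (clamp_lip _ _) (xy j).
by rewrite subrr normr0.
Qed.

Lemma cube_covering (T : topologicalType) (f : K -> T) (A B : 'I_n -> set T) :
  continuous f ->
  (forall i, open (A i)) -> (forall i, open (B i)) ->
  (forall i, A i `|` B i = setT) ->
  (forall (x : K) (i : 'I_n), seq_of x i = 0 -> ~ B i (f x)) ->
  (forall (x : K) (i : 'I_n), seq_of x i = 1 -> ~ A i (f x)) ->
  ~ covering_dim_lt T n.
Proof.
move=> cf oA oB AB fB fA.
apply: (lebesgue_covering (K := K) (c := cube_pt) (f := f) (A := A) (B := B)) => //.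
- exact: seqspace_compact.
- exact: cube_pt_lip.
- by move=> x i cx xi; apply: fB; rewrite cube_ptE ?xi ?lexx ?ler01.
- by move=> x i cx xi; apply: fA; rewrite cube_ptE ?xi ?lexx ?ler01.
Qed.

Lemma cube_dim_ge : ~ covering_dim_lt K n.
Proof.
apply: (@cube_covering K id (fun i => [set x | seq_of x i < 1])
  (fun i => [set x | 0 < seq_of x i])).
- by move=> x; exact: cvg_id.
- by move=> i; apply: (@coord_open R half (subcube P) i [set r : R | r < 1]); exact: open_lt.
- by move=> i; apply: (@coord_open R half (subcube P) i [set r : R | 0 < r]); exact: open_gt.
- move=> i; rewrite -subTset => x _ /=; have [|x1] := ltP (seq_of x i) 1; first by left.
  by right; exact: lt_le_trans x1.
- by move=> x i /= ->; rewrite ltxx.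
- by move=> x i /= ->; rewrite ltxx.
Qed.

End Cube.

Lemma mul_norm_le (R : realType) (w x c : R) : 0 < w ->
  (w * `|x| <= c) = (- c <= w * x <= c).
Proof. by move=> w0; rewrite -ler_norml normrM gtr0_norm. Qed.

Section FiniteCube.
Variables (R : realType) (n : nat).

Local Notation P := (fun i : nat => (i < n)%N).
Local Notation K := (dtype (seqspace (half R) (subcube R P))).

Lemma fcube_dist (x y : K) (e : R) : 0 <= e ->
  (forall i, (i < n)%N -> wt (half R) i * `|seq_of x i - seq_of y i| <= e) ->
  mdist x y <= e.
Proof.
move=> e0 H; apply: sdist_le => i; have [ni|ni] := leqP n i; last exact: H.
have z (u : K) : seq_of u i = 0 by apply: (svalP u i).2; rewrite -leqNgt.
by rewrite !z subrr normr0 mulr0.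
Qed.

Lemma fcube_apow (s : R) : n%:R <= s -> apow K s.
Proof.
move=> ns; exists (3 ^+ n) => x rho r r0 rrho l lA ls.
have rho0 : 0 < rho by exact: lt_trans rrho.
(* In the ball each weighted coordinate ranges over an interval of length 2 * rho; [c] measures it
   from the lower end in units of r. Points with the same integer parts are within r. *)
pose c (y : K) i : R := (wt (half R) i * (seq_of y i - seq_of x i) + rho) / r.
pose M := (Num.truncn (2 * rho / r)).+1.
have c0 y i : y \in l -> 0 <= c y i <= 2 * rho / r.
  move=> /lA; rewrite /cball /= => xy.
  have := le_trans (sdist_ub (half R) x y i) xy.
  rewrite mul_norm_le ?wt_gt0 // => /andP[h1 h2]; rewrite /c divr_ge0 ?(ltW r0) //=; last by move: h1 h2; rewrite !mulrBr; lra.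
  by rewrite ler_pM2r ?invr_gt0 //; move: h1 h2; rewrite !mulrBr; lra.
have cM y i : y \in l -> (Num.truncn (c y i) < M)%N.
  by move=> /c0 => /(_ i)/andP[_ cy]; rewrite ltnS; exact: le_truncn.
pose h (y : K) : {ffun 'I_n -> 'I_M} := [ffun i : 'I_n => inord (Num.truncn (c y i))].
have sl : (size l <= #|{ffun 'I_n -> 'I_M}|)%N.
  apply: (sepl_card (h := h) (ltW r0)) ls => y z yl zl; apply: contraTneq => hyz.
  rewrite -leNgt; apply: fcube_dist; first exact: ltW.
  move=> i ni; have : (h y (Ordinal ni) : nat) = h z (Ordinal ni) by rewrite hyz.
  rewrite /h !ffunE /= !inordK ?cM // => tyz.
  have /andP[/truncn_itv/andP[y1 y2] _] := c0 y i yl.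
  have /andP[/truncn_itv/andP[z1 z2] _] := c0 z i zl.
  rewrite tyz in y1 y2; move: y1 y2 z1 z2; rewrite -!natr1; set t := (Num.truncn _)%:R.
  rewrite /c !ler_pdivlMr // !ltr_pdivrMr // => y1 y2 z1 z2.
  rewrite mul_norm_le ?wt_gt0 //.
  by move: y1 y2 z1 z2; rewrite !mulrBr !mulrDl mul1r; lra.
(* Here 2 * rho / r + 1 <= 3 * rho / r because r < rho; this is the origin of 3^n. *)
have MR : M%:R <= 3 * (rho / r).
  rewrite /M -natr1; have t0 : 0 <= 2 * rho / r by rewrite !mulr_ge0 ?invr_ge0 ?(ltW rho0) ?(ltW r0).
  have /andP[h1 _] := truncn_itv t0.
  have : 1 <= rho / r by rewrite ler_pdivlMr // mul1r ltW.
  by rewrite -mulrA in h1 *; lra.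
apply: (@le_trans _ _ ((M ^ n)%N%:R)).
  by rewrite ler_nat; move: sl; rewrite card_ffun !card_ord.
rewrite natrX; apply: (@le_trans _ _ ((3 * (rho / r)) ^+ n)).
  by rewrite lerXn2r ?nnegrE ?mulr_ge0 ?invr_ge0 ?(ltW rho0) ?(ltW r0).
rewrite exprMn ler_wpM2l ?exprn_ge0 // -powR_mulrn ?divr_ge0 ?(ltW rho0) ?(ltW r0) //.
by apply: ler_powR => //; rewrite ler_pdivlMr // mul1r ltW.
Qed.

Lemma fcube_dim_A : (dim_A K <= n%:R%:E)%E.
Proof.
apply: ereal_le_approx; first by rewrite lee_fin.
by move=> s s0; rewrite lte_fin => /ltW ns; apply: dim_A_le => //; exact: fcube_apow.
Qed.

(* n+1 shifts of a grid of boxes: a coordinate lies on the walls of at most one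
   shifted grid, so some grid has the point in the interior of a box. *)
Lemma fcube_covering : covering_dim_lt K n.+1.
Proof.
have p0 : K by exact: (exist _ _ (subcube0 R P)).
apply: (small_covers_dim p0); first exact: seqspace_compact.
move=> e e0.
pose h := e / 2; have h0 : 0 < h by rewrite divr_gt0.
pose M := (Num.truncn h^-1).+3.
(* Distinct shifts do not differ by an integer, so two of the grids never share a wall in the same
   coordinate. *)
pose tau (k : 'I_n.+1) : R := k%:R / n.+1%:R.
have tau01 k : 0 <= tau k < 1.
  by rewrite divr_ge0 //= ltr_pdivrMr ?ltr0n // mul1r ltr_nat ltn_ord.
pose U (p : 'I_n.+1 * {ffun 'I_n -> 'I_M}) : set K :=
  [set x | forall i : 'I_n, h * ((p.2 i)%:R - 1 + tau p.1) < seq_of x i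
     < h * ((p.2 i)%:R + tau p.1)].
exists [set U p | p in [set: 'I_n.+1 * {ffun 'I_n -> 'I_M}]]; split.
- exact/finite_image/finite_finset.
- split=> [_ [p _ <-]|].
    rewrite openE => x Ux.
    have Hi (i : 'I_n) : nbhs x [set y : K | h * ((p.2 i)%:R - 1 + tau p.1) <
        seq_of y i < h * ((p.2 i)%:R + tau p.1)].
      apply: open_nbhs_nbhs; split; last exact: Ux.
      apply: (@coord_open R (half R) (subcube R P) i [set r : R | _ < r < _]).
      rewrite (_ : [set r | _] = [set r | h * ((p.2 i)%:R - 1 + tau p.1) < r]
         `&` [set r | r < h * ((p.2 i)%:R + tau p.1)]).
        by apply: openI; [exact: open_gt|exact: open_lt].
      by apply/seteqP; split=> r /= => [/andP[]|[-> ->]].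
    exact: (@filter_forall _ _ _ (nbhs x) _ Hi).
  rewrite -subTset => x _.
  pose u k (i : 'I_n) : R := seq_of x i / h + 1 - tau k.
  (* If the point were on a wall of each of the n + 1 grids, two grids would have a wall there in
     the same one of the n coordinates, and their shifts would agree modulo n + 1. *)
  have [k Hk] : exists k, forall i, u k i != (Num.truncn (u k i))%:R.
    apply: contrapT => /forallNP nk.
    have /choice[f Hf] : forall k : 'I_n.+1, exists i : 'I_n, u k i = (Num.truncn (u k i))%:R.
      by move=> k; have /existsNP[i /negP] := nk k; rewrite negbK => /eqP ui; exists i.
    suff finj : injective f by have := leq_card f finj; rewrite !card_ord ltnn.
    move=> k k' ff; apply: val_inj; have := Hf k; have := Hf k'; rewrite ff.
    set m' := Num.truncn _; set m := Num.truncn _; rewrite /u => E' E.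
    have : (m' * n.+1 + k')%:R = (m * n.+1 + k)%:R :> R.
      rewrite !natrD !natrM -E -E' /tau.
      have n1 : n.+1%:R != 0 :> R by rewrite pnatr_eq0.
      by rewrite !mulrBl !mulrDl !mul1r !divfK // ; lra.
    move/eqP; rewrite eqr_nat => /eqP /(congr1 (modn^~ n.+1)).
    by rewrite !modnMDl !modn_small // => ->.
  have u0 i : 0 < u k i.
    have := tau01 k; have /andP[x0 _] := seq_of01 x i.
    have : 0 <= seq_of x i / h by rewrite divr_ge0 // ltW.
    by rewrite /u; lra.
  have uM i : (Num.truncn (u k i) < M)%N.
    have : u k i <= h^-1 + 1.
      have := tau01 k; have /andP[_ x1] := seq_of01 x i.
      have : seq_of x i / h <= h^-1 by rewrite ler_pdivrMr // mulVf ?gt_eqF.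
      by rewrite /u; lra.
    move=> /le_truncn/leq_ltn_trans; apply.
    have hi0 : 0 <= h^-1 by rewrite invr_ge0 ltW.
    rewrite truncn_lt_nat ?addr_ge0 //.
    by have /andP[_] := truncn_itv hi0; rewrite /M -!natr1; lra.
  exists (U (k, [ffun i => inord (Num.truncn (u k i))])); first by exists (k, [ffun i => inord (Num.truncn (u k i))]).
  move=> i /=; rewrite ffunE inordK //.
  have /andP[u1 u2] := truncn_itv (ltW (u0 i)).
  have {}u1 : (Num.truncn (u k i))%:R < u k i by rewrite lt_neqAle eq_sym Hk.
  move: u1 u2; rewrite -natr1; set t := (Num.truncn _)%:R; rewrite /u => u1 u2.
  have -> : seq_of x i = h * (seq_of x i / h) by rewrite mulrC divfK // gt_eqF.
  by rewrite !ltr_pM2l //; apply/andP; split; lra.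
- move=> F Finj FV; rewrite -subset0 => z Fz.
  have /choice[p Hp] : forall j, exists p, U p = F j.
    by move=> j; have [p _ pF] := FV j; exists p.
  (* There are n + 2 members and only n + 1 shifts, while distinct boxes of one grid are
     disjoint. *)
  have [j [j' [jj' kk]]] : exists j j', j != j' /\ (p j).1 = (p j').1.
    apply: contrapT => H; suff inj1 : injective (fun j => (p j).1).
      by have := leq_card _ inj1; rewrite !card_ord ltnn.
    move=> j j' jj'; apply: contrapT => /eqP nj; apply: H; exists j, j'; split=> //.
  case/eqP: jj'; apply: Finj; rewrite -(Hp j) -(Hp j'); congr U.
  have Uj : U (p j) z by rewrite Hp; exact: Fz.
  have Uj' : U (p j') z by rewrite Hp; exact: Fz.
  move: (p j) (p j') kk Uj Uj' => [k g] [k' g'] /= <- Uj Uj'; congr pair.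
  apply/ffunP => i; apply: val_inj.
  have := Uj i; have := Uj' i => /= /andP[a1 a2] /andP[b1 b2].
  have : (g i)%:R - 1 < (g' i)%:R :> R.
    by have := lt_trans b1 a2; rewrite ltr_pM2l //; lra.
  have : (g' i)%:R - 1 < (g i)%:R :> R.
    by have := lt_trans a1 b2; rewrite ltr_pM2l //; lra.
  by rewrite !ltrBlDr !natr1 !ltr_nat !ltnS => i1 i2; apply/eqP; rewrite eqn_leq i1 i2.
- move=> _ x y [p _ <-] Ux Uy; apply: (@le_lt_trans _ _ h); last by rewrite /h; lra.
  apply: fcube_dist; first exact: ltW.
  move=> i ni; have := Ux (Ordinal ni); have := Uy (Ordinal ni) => /= Uyi Uxi.
  rewrite -[leRHS]mul1r; apply: ler_pM; rewrite ?normr_ge0 ?wt_le1 ?(ltW (wt_gt0 _ _)) //.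
  by rewrite ler_norml; move: Uyi Uxi; rewrite !mulrDr !mulrN1; lra.
Qed.

Lemma fcube_dim_T : dim_T R K = n%:R%:E.
Proof.
apply/eqP; rewrite eq_le; apply/andP; split.
  have := (dim_T_leP R K n.+1).2 fcube_covering.
  by rewrite -natr1 addrK.
by apply: dim_T_ge; apply: cube_dim_ge.
Qed.

End FiniteCube.

Lemma hilbert_dim_T (R : realType) :
  dim_T R (dtype (seqspace (half R) (subcube R xpredT))) = +oo%E.
Proof.
apply/eqyP => A A0; have := @cube_dim_ge R xpredT (Num.truncn A).+1 (fun _ _ => isT).
move=> /(@dim_T_ge R); apply: le_trans.
by rewrite lee_fin ltW // truncnS_gt.
Qed.

(** * Path-connectedness *)

Section Chain.
Variables (R : realType) (X : metricType R) (x0 : X) (D : R).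
Hypothesis bounded : forall x y : X, mdist x y <= D.

Lemma dim_B_le_A : (upper_dim_B X <= dim_A X)%E.
Proof.
apply: ereal_le_approx (dim_A_ge0 _) _ => s s0 /lt_dim_A /(apow_bpow bounded).
exact: upper_dim_B_le.
Qed.

Lemma dim_P_le_B : (dim_P X <= upper_dim_B X)%E.
Proof.
apply: ereal_le_approx (upper_dim_B_ge0 x0) _ => s s0 /(lt_upper_dim_B s0) bs.
apply: (dim_P_le x0); first exact: ltW.
by exists (fun=> setT); split=> // x _; exists 0%N.
Qed.

Lemma dim_H_le_B : (dim_H X <= upper_dim_B X)%E.
Proof.
apply: ereal_le_approx (upper_dim_B_ge0 x0) _ => s s0 /(lt_upper_dim_B s0) bs.
apply/lee_addgt0Pr => e e0; rewrite -EFinD.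
have se0 : 0 < s + e by rewrite addr_gt0.
by apply: dim_H_le => //; apply: bpow_hpow bs => //; rewrite ltrDl.
Qed.

End Chain.

(** * Finite spaces *)

Section FiniteSpace.
Variables (R : realType) (X : metricType R).
Hypothesis finX : finite_set [set: X].

Lemma fin_dim_T (x0 : X) : (dim_T R X <= 0)%E.
Proof.
have -> : 0%E = (1%:R - 1)%:E :> \bar R by rewrite subrr.
apply/dim_T_leP => U fU [oU cU].
have sing (x : X) : open [set x].
  rewrite -[X in open X]setCK; apply: closed_openC.
  have acc := hausdorff_accessible (@metric_hausdorff R X).
  apply: (accessible_finite_set_closed.1 acc).
  exact: sub_finite_set finX.
exists [set [set x] | x in [set: X]]; split.
- exact: finite_image.
- split=> [_ [x _ <-]|]; first exact: sing.
  by rewrite -subTset => x _; exists [set x] => //; exists x.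
- move=> _ [x _ <-]; have [A UA Ax] : (\bigcup_(A in U) A) x by rewrite cU.
  by exists A => // _ ->.
- move=> F Finj FV; rewrite -subset0 => z Fz.
  have Fi i : F i = [set z].
    by have [x _ xF] := FV i; have := Fz i I; rewrite -xF => ->.
  have : @ord0 1 = @ord_max 1 by apply: Finj; rewrite !Fi.
  by move/(congr1 val).
Qed.

Lemma fin_dim_A : (dim_A X <= 0)%E.
Proof.
have /finite_seqP[e Xe] := finX.
apply: ereal_le_approx => // s s0 _; apply: dim_A_le => //.
exists (size e)%:R => x rho r r0 rrho l lA ls.
apply: (@le_trans _ _ (size e)%:R).
  rewrite ler_nat; apply: uniq_leq_size; first exact: sepl_uniq (ltW r0) ls.
  by move=> y _; have : [set: X] y by []; rewrite Xe.
rewrite ler_peMr // -(powRr0 (rho / r)); apply: ler_powR; last exact: ltW.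
by rewrite ler_pdivlMr // mul1r ltW.
Qed.

End FiniteSpace.

Lemma compact_bounded (R : realType) (X : metricType R) (x0 : X) :
  compact [set: X] -> exists2 D : R, 0 <= D & forall x y : X, mdist x y <= D.
Proof.
move=> /compact_near_coveringP coX.
have H : \forall d \near (+oo%R : set_system R), [set: X] `<=` (fun x => mdist x0 x <= d).
  apply: coX => x _; exists (ball x 1, [set d | mdist x0 x + 1 < d]) => /=.
    by split; [exact: nbhsx_ballx|apply: nbhs_pinfty_gt; exact: num_real].
  move=> [y d] /= []; rewrite ballEmdist /= => xy xd.
  by apply: le_trans (metric_triangle _ x _) _; lra.
near (+oo%R : set_system R) => d; have Hd : [set: X] `<=` (fun x => mdist x0 x <= d) by near: d.
have d0 : 0 <= d by apply: le_trans (mdist_ge0 x0 x0) (Hd x0 I).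
exists (2 * d) => [|x y]; first by rewrite mulr_ge0.
apply: le_trans (metric_triangle _ x0 _) _; rewrite metric_sym.
by have := Hd x I; have := Hd y I; rewrite /=; lra.
Unshelve. all: by end_near. Qed.

Section FiniteCompact.
Variables (R : realType) (M : dspace R) (m0 : dtype M).
Hypothesis finM : finite_set [set: dtype M].

Definition fin_cm : compactMetric R :=
  cspace (ex_intro _ m0 I) (finite_compact finM).

Lemma has_dims_fin_wedge l a1 a2 a3 a4 (B : compactMetric R) (b0 : B) (q0 : fin_cm) s t :
  (0 <= l)%E -> (0 <= a1)%E -> (0 <= a2)%E -> (0 <= a3)%E -> (0 <= a4)%E ->
  has_dims l a1 a2 a3 a4 B -> has_dims l a1 a2 a3 a4 (cwedge b0 q0 s t).
Proof.
move=> l0 a10 a20 a30 a40 hB.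
have [D _ bd] := compact_bounded m0 (finite_compact finM).
have A0 := fin_dim_A finM.
have B0 := le_trans (dim_B_le_A bd) A0.
have P0 := le_trans (dim_P_le_B m0) B0.
have H0 := le_trans (dim_H_le_B m0) B0.
have T0 := fin_dim_T finM m0.
apply: has_dims_cwedge => //.
- exact: le_trans T0 l0.
- exact: le_trans H0 a10.
- exact: le_trans P0 a20.
- exact: le_trans B0 a30.
- exact: le_trans A0 a40.
Qed.

End FiniteCompact.

(** * The path through rescaled wedges *)

Section Paths.
Variable R : realType.
Variables (X Y : compactMetric R) (x0 : X) (y0 : Y) (D : R).
Hypotheses (D0 : 0 <= D) (bX : forall x y : X, mdist x y <= D)
  (bY : forall x y : Y, mdist x y <= D).

Lemma scale_diff (Z : metricType R) (a b : R) (x y : Z) :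
  (forall x y : Z, mdist x y <= D) ->
  `|a * mdist x y - b * mdist x y| <= `|a - b| * D.
Proof.
move=> bZ; rewrite -mulrBl normrM ler_wpM2l // ger0_norm ?mdist_ge0 //.
Qed.

Lemma min_diff (a b c d : R) :
  `|Num.min a b - Num.min c d| <= `|a - c| + `|b - d|.
Proof.
have := ler_norm (a - c); have := ler_norm (b - d).
have := ler_norm (c - a); have := ler_norm (d - b).
rewrite (distrC c a) (distrC d b) /Num.min.
by case: ifP => ab; case: ifP => cd; rewrite ler_norml;
  move/negbT: ab || move: ab; move/negbT: cd || move: cd; rewrite -?leNgt; lra.
Qed.

Lemma GH_wedge_wedge s t s' t' e : 0 < e -> 0 < s -> 0 < t -> 0 < s' -> 0 < t' ->
  (`|s - s'| + `|t - t'|) * (D + 1) <= 2 * e ->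
  (GH (isometry_class (cwedge x0 y0 s t))
      (isometry_class (cwedge x0 y0 s' t')) <= e%:E)%E.
Proof.
move=> e0 s0 t0 s'0 t'0 H.
apply: (@GH_le R (cwedge x0 y0 s t) (cwedge x0 y0 s' t')
  (fun p q => (p : X + Y) = q)) => //.
- by move=> x; exists x.
- by move=> x; exists x.
move=> p p' q q' <- <-; apply: le_trans H; rewrite mulrDr mulr1 mulrDl.
have n1 := normr_ge0 (s - s'); have n2 := normr_ge0 (t - t').
have m1 := mulr_ge0 n1 D0; have m2 := mulr_ge0 n2 D0.
have cross x y : `|@wcross R (dspace_of X) (dspace_of Y) x0 y0 s t x y -
    @wcross R (dspace_of X) (dspace_of Y) x0 y0 s' t' x y| <=
    `|s - s'| * D + `|t - t'| * D + (`|s - s'| + `|t - t'|).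
  rewrite /wcross !posE //.
  have := scale_diff s s' x x0 bX; have := scale_diff t t' y0 y bY.
  have := min_diff s t s' t'; rewrite !ler_norml => /andP[? ?] /andP[? ?] /andP[? ?].
  by apply/andP; split; lra.
rewrite !mdist_ddist /=.
case: p p' => [x|y] [x'|y'] /=; rewrite ?posE //.
- by apply: le_trans (scale_diff _ _ _ _ bX) _; lra.
- by apply: le_trans (scale_diff _ _ _ _ bY) _; lra.
Qed.

(** The copy of [Y] is collapsed to [x0], at the cost of its diameter, at most t * D, and of the
    gap, at most t. *)
Lemma GH_l_wedge s t e : 0 < e -> 0 < s -> 0 < t ->
  (`|1 - s| + t) * (D + 1) <= 2 * e ->
  (GH (isometry_class X) (isometry_class (cwedge x0 y0 s t)) <= e%:E)%E.
Proof.
move=> e0 s0 t0 H.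
apply: (@GH_le R X (cwedge x0 y0 s t) (fun x q =>
  match (q : X + Y) with inl x' => x = x' | inr _ => x = x0 end)) => //.
- by move=> x; exists (inl x).
- by case=> [x|y]; [exists x|exists x0].
move=> x x' q q'.
have n1 := normr_ge0 (1 - s); have m1 := mulr_ge0 n1 D0.
have m2 := mulr_ge0 (ltW t0) D0.
have sc (p p' : X) : `|mdist p p' - s * mdist p p'| <= `|1 - s| * D.
  by have := scale_diff 1 s p p' bX; rewrite mul1r.
have ms : 0 < Num.min s t <= t by rewrite lt_min s0 t0 ge_min lexx orbT.
have tY (y y' : Y) : 0 <= t * mdist y y' <= t * D.
  by rewrite mulr_ge0 ?mdist_ge0 ?(ltW t0) //= ler_pM2l.
have HH : `|1 - s| * D + t * D + `|1 - s| + t <= 2 * e by lra.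
rewrite [X in _ -> _ -> `|_ - X| <= _]mdist_ddist /=.
case: q q' => [p|y] [p'|y'] -> -> /=; rewrite /wcross ?posE //; apply: le_trans HH.
- by apply: le_trans (sc _ _) _; lra.
- have := sc p x0; have := tY y0 y'; rewrite !ler_norml => /andP[? ?] /andP[? ?].
  by apply/andP; split; lra.
- have := sc p' x0; have := tY y0 y; rewrite (metric_sym x0 p').
  rewrite !ler_norml => /andP[? ?] /andP[? ?].
  by apply/andP; split; lra.
- by rewrite mdistxx sub0r normrN ger0_norm; have := tY y y'; lra.
Qed.

Lemma GH_r_wedge s t e : 0 < e -> 0 < s -> 0 < t ->
  (s + `|1 - t|) * (D + 1) <= 2 * e ->
  (GH (isometry_class Y) (isometry_class (cwedge x0 y0 s t)) <= e%:E)%E.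
Proof.
move=> e0 s0 t0 H.
apply: (@GH_le R Y (cwedge x0 y0 s t) (fun y q =>
  match (q : X + Y) with inr y' => y = y' | inl _ => y = y0 end)) => //.
- by move=> y; exists (inr y).
- by case=> [x|y]; [exists y0|exists y].
move=> y y' q q'.
have n1 := normr_ge0 (1 - t); have m1 := mulr_ge0 n1 D0.
have m2 := mulr_ge0 (ltW s0) D0.
have sc (p p' : Y) : `|mdist p p' - t * mdist p p'| <= `|1 - t| * D.
  by have := scale_diff 1 t p p' bY; rewrite mul1r.
have ms : 0 < Num.min s t <= s by rewrite lt_min s0 t0 ge_min lexx.
have tX (x x' : X) : 0 <= s * mdist x x' <= s * D.
  by rewrite mulr_ge0 ?mdist_ge0 ?(ltW s0) //= ler_pM2l.
have HH : `|1 - t| * D + s * D + `|1 - t| + s <= 2 * e by lra.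
rewrite [X in _ -> _ -> `|_ - X| <= _]mdist_ddist /=.
case: q q' => [x|p] [x'|p'] -> -> /=; rewrite /wcross ?posE //; apply: le_trans HH.
- by rewrite mdistxx sub0r normrN ger0_norm; have := tX x x'; lra.
- have := sc y0 p'; have := tX x x0; rewrite !ler_norml => /andP[? ?] /andP[? ?].
  by apply/andP; split; lra.
- have := sc p y0; have := tX x' x0; rewrite (@metric_sym R (dtype (dspace_of Y)) y0 p).
  rewrite !ler_norml => /andP[? ?] /andP[? ?].
  by apply/andP; split; lra.
- by apply: le_trans (sc _ _) _; lra.
Qed.

(** Relating all points serves the case of [gpath_GH] with one parameter at or before 0 and the
    other at or after 1. *)
Lemma GH_l_r e : 0 < e -> D <= 2 * e ->
  (GH (isometry_class X) (isometry_class Y) <= e%:E)%E.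
Proof.
move=> e0 H; apply: (@GH_le R X Y (fun _ _ => True)) => //.
move=> x x' y y' _ _; rewrite ler_norml.
have := mdist_ge0 x x'; have := mdist_ge0 y y'; have := bX x x'; have := bY y y'.
by move=> *; apply/andP; split; lra.
Qed.

Lemma GH_refl (Z : compactMetric R) e : 0 < e ->
  (GH (isometry_class Z) (isometry_class Z) <= e%:E)%E.
Proof.
move=> e0; apply: (@GH_le R Z Z eq) => //; [by move=> z; exists z|by move=> z; exists z|].
by move=> x x' _ _ <- <-; rewrite subrr normr0 mulr_ge0 // ltW.
Qed.

(** [Y] grows from size 0 on the first half of [0, 1] and [X] shrinks to size 0 on the second. The
    ends are separate cases, as [pos] would turn a factor 0 into 1. *)
Definition gpath (t : R) : GH_space R :=
  if t <= 0 then isometry_class X else if 1 <= t then isometry_class Y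
  else isometry_class (cwedge x0 y0 (clamp (2 - 2 * t)) (clamp (2 * t))).

Lemma gpath_sym (x y : GH_space R) : GH x y = GH y x.
Proof. exact: gh_dist_sym. Qed.

(** The clamped factors are (1, 0) for t <= 0 and (0, 1) for t >= 1, so the estimates at the ends
    are instances of the same inequality and one bound in the factors covers all cases. *)
Lemma gpath_GH t t' e : 0 < e ->
  (`|clamp (2 - 2 * t) - clamp (2 - 2 * t')| + `|clamp (2 * t) - clamp (2 * t')|)
    * (D + 1) <= 2 * e ->
  (GH (gpath t) (gpath t') <= e%:E)%E.
Proof.
move=> e0.
have cl0 (x : R) : x <= 0 -> clamp (2 - 2 * x) = 1 /\ clamp (2 * x) = 0.
  move=> x0'; rewrite /clamp; split.
    by rewrite min_l // le_max; apply/orP; right; lra.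
  by rewrite max_l ?min_r //; lra.
have cl1 (x : R) : 1 <= x -> clamp (2 - 2 * x) = 0 /\ clamp (2 * x) = 1.
  move=> x0'; rewrite /clamp; split.
    by rewrite max_l ?min_r //; lra.
  by rewrite min_l // le_max; apply/orP; right; lra.
have clm (x : R) : 0 < x -> x < 1 -> 0 < clamp (2 - 2 * x) /\ 0 < clamp (2 * x).
  move=> h0 h1; rewrite /clamp !lt_min !lt_max ltr01 /=.
  by split; apply/orP; right; lra.
rewrite /gpath; have [t0|t0] := leP t 0.
  have [-> ->] := cl0 t t0; have [t'0|t'0] := leP t' 0.
    by move=> _; exact: GH_refl.
  have [t'1|t'1] := leP 1 t'.
    have [-> ->] := cl1 t' t'1; rewrite subr0 sub0r normrN normr1 => H.
    by apply: GH_l_r => //; have := D0; lra.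
  have [v0 u0] := clm t' t'0 t'1; rewrite sub0r normrN (gtr0_norm u0) => H.
  exact: GH_l_wedge.
have [t1|t1] := leP 1 t.
  have [-> ->] := cl1 t t1; have [t'0|t'0] := leP t' 0.
    have [-> ->] := cl0 t' t'0; rewrite subr0 sub0r normrN normr1 => H.
    by rewrite gpath_sym; apply: GH_l_r => //; have := D0; lra.
  have [t'1|t'1] := leP 1 t'; first by move=> _; exact: GH_refl.
  have [v0 u0] := clm t' t'0 t'1; rewrite sub0r normrN (gtr0_norm v0) => H.
  exact: GH_r_wedge.
have [v0 u0] := clm t t0 t1; have [t'0|t'0] := leP t' 0.
  have [-> ->] := cl0 t' t'0; rewrite subr0 (gtr0_norm u0) distrC => H.
  by rewrite gpath_sym; exact: GH_l_wedge.
have [t'1|t'1] := leP 1 t'.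
  have [-> ->] := cl1 t' t'1; rewrite subr0 (gtr0_norm v0) distrC => H.
  by rewrite gpath_sym; apply: GH_r_wedge => //; rewrite distrC.
have [v'0 u'0] := clm t' t'0 t'1; exact: GH_wedge_wedge.
Qed.

Lemma gpath_continuous : continuous gpath.
Proof.
move=> t; apply: GH_nbhs => e e0.
have D1 : 0 < D + 1 by rewrite ltr_wpDl.
(* Both factors are 2-Lipschitz in t, and 4 * d times D + 1 equals 2 * (e / 2). *)
pose d := e / 4 / (D + 1); have d0 : 0 < d by rewrite !divr_gt0.
have /= := nbhsx_ballx t _ d0; apply: filterS => t' /=; rewrite /ball /= => tt'.
apply: (@le_lt_trans _ _ (e / 2)%:E); last by rewrite lte_fin; lra.
apply: gpath_GH; first by rewrite divr_gt0.
have h1 : `|clamp (2 - 2 * t) - clamp (2 - 2 * t')| <= 2 * `|t - t'|.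
  apply: le_trans (clamp_lip _ _) _.
  rewrite (_ : _ - _ = 2 * (t' - t)); last lra.
  by rewrite normrM ger0_norm // distrC.
have h2 : `|clamp (2 * t) - clamp (2 * t')| <= 2 * `|t - t'|.
  apply: le_trans (clamp_lip _ _) _.
  by rewrite -mulrBr normrM ger0_norm.
apply: (@le_trans _ _ (4 * d * (D + 1))).
  by rewrite ler_pM2r //; lra.
by rewrite /d -!mulrA mulVf ?gt_eqF //; lra.
Qed.

End Paths.

Section Conclusion.
Variable R : realType.
Variables (l a1 a2 a3 a4 : \bar R).
Hypotheses (l0 : (0 <= l)%E) (a10 : (0 <= a1)%E) (a20 : (0 <= a2)%E)
  (a30 : (0 <= a3)%E) (a40 : (0 <= a4)%E).

Let DS := D_set l a1 a2 a3 a4.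

Lemma D_set_path_connected : path_connected R DS.
Proof.
move=> _ _ [X hX <-] [Y hY <-].
have [x0 _] := cm_nonempty X; have [y0 _] := cm_nonempty Y.
have [D1 D10 b1] := compact_bounded x0 (@cm_compact R X).
have [D2 D20 b2] := compact_bounded y0 (@cm_compact R Y).
pose D := Num.max D1 D2; have D0 : 0 <= D by rewrite le_max D10.
have bX (x y : X) : mdist x y <= D by rewrite le_max b1.
have bY (x y : Y) : mdist x y <= D by rewrite le_max b2 orbT.
exists (gpath x0 y0); split.
- have gc := @gpath_continuous R X Y x0 y0 D D0 bX bY.
  exact: continuous_subspaceT gc.
- by rewrite /gpath lexx.
- by rewrite /gpath lexx ler10.
- move=> _ [t _ <-]; rewrite /gpath; case: ifP => _; first by exists X.
  case: ifP => _; first by exists Y.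
  have [TY HY PY BY AY] := hY.
  exists (cwedge x0 y0 (clamp (2 - 2 * t)) (clamp (2 * t))) => //.
  by apply: has_dims_cwedge => //; rewrite ?TY ?HY ?PY ?BY ?AY.
Qed.


End Conclusion.

(** * Density *)

Section FiniteNets.
Variable R : realType.

Lemma compact_net (X : metricType R) (x0 : X) (e : R) : compact [set: X] -> 0 < e ->
  exists2 N : set X, finite_set N & forall x, exists2 y, N y & mdist y x < e.
Proof.
move=> + e0.
pose P := isPointed.Build (X : Type) x0.
pose PT : ptopologicalType := HB.pack (X : Type) P (Topological.class X).
rewrite (_ : compact [set: X] = @cover_compact X [set: X]); last first.
  exact: (congr1 (fun c => c [set: X]) (@compact_cover PT)).
move=> /(_ X setT (fun x => [set y | mdist x y < e])) [].
- move=> x _; apply/open_mdistE => y /= xy; exists (e - mdist x y); first by rewrite subr_gt0.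
  by move=> z yz; apply: le_lt_trans (metric_triangle _ y _) _; lra.
- by move=> x _; exists x => //=; rewrite mdistxx.
move=> D _ cD; exists [set y | y \in finmap.enum_fset D]; first exact: finite_seq.
by move=> x; have [y Dy yx] := cD x I; exists y.
Qed.

Definition sub_dspace (X : compactMetric R) (A : set X) : dspace R.
Proof.
refine (@DSpace R {x : cm_carrier X | A x} (fun x y => mdist (sval x) (sval y)) _ _ _ _).
- by move=> x; exact: mdistxx.
- move=> x y /mdist_positivity xy; apply: eq_sig_hprop => //.
- by move=> x y; exact: metric_sym.
- by move=> y x z; exact: metric_triangle.
Defined.

Lemma sub_dspace_finite (X : compactMetric R) (A : set X) : finite_set A ->
  finite_set [set: dtype (sub_dspace A)].
Proof.
move=> fA; pose v (x : dtype (sub_dspace A)) : X := sval x.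
apply: sub_finite_set (@finite_preimage _ _ A v _ fA); first by move=> x _; exact: (svalP x).
move=> x y _ _ xy; apply: (@eq_sig_hprop X A _ x y xy) => //.
Qed.

End FiniteNets.

Section Conclusion.
Variable R : realType.
Variables (l a1 a2 a3 a4 : \bar R).
Hypotheses (l0 : (0 <= l)%E) (a10 : (0 <= a1)%E) (a20 : (0 <= a2)%E)
  (a30 : (0 <= a3)%E) (a40 : (0 <= a4)%E).
Variables (B : compactMetric R) (hB : has_dims l a1 a2 a3 a4 B).

Lemma D_set_dense : dense (D_set l a1 a2 a3 a4).
Proof.
move=> O [x Ox] oO; have [e e0 eO] := oO _ Ox.
have [X Xx] : exists X, isometry_class X = x by exists (repr x); exact: reprK.
have [x0 _] := cm_nonempty X; have [b0 _] := cm_nonempty B.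
have [D D0 bD] := compact_bounded b0 (@cm_compact R B).
pose h := e / 2; have h0 : 0 < h by rewrite divr_gt0.
have [N fN Nnet] := compact_net x0 (@cm_compact R X) h0.
have [n0 Nn0 _] := Nnet x0.
pose q0 : dtype (sub_dspace N) := exist _ n0 Nn0.
have fF := sub_dspace_finite fN.
pose F := fin_cm q0 fF.
have D1 : 0 < D + 1 by rewrite ltr_wpDl.
(* With this factor the copy of [B] together with the gap has size at most h. *)
pose d := Num.min 1 (h / (D + 1)).
have d0 : 0 < d by rewrite lt_min ltr01 divr_gt0.
have dD : d * D + d <= h.
  rewrite -[X in _ + X]mulr1 -mulrDr -ler_pdivlMr //; by rewrite ge_min lexx orbT.
exists (isometry_class (@cwedge R B F b0 q0 d 1)); split; last first.
  by exists (@cwedge R B F b0 q0 d 1) => //; exact: has_dims_fin_wedge.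
apply: eO; rewrite /= -Xx; apply: (@le_lt_trans _ _ h%:E); last by rewrite lte_fin /h; lra.
(* The copy of [B] is related to the base point [n0] alone, and a net point to every point within
   [h] of it. *)
apply: (@GH_le R X (@cwedge R B F b0 q0 d 1) (fun y w =>
  match (w : B + F) with inl _ => y = n0 | inr q => mdist (sval q) y <= h end)) => //.
- move=> y; have [z Nz zy] := Nnet y.
  by exists (inr (exist _ z Nz)); exact: ltW.
- by case=> [b|q]; [exists n0|exists (sval q); rewrite mdistxx ltW].
have dB b b' : 0 <= d * mdist (b : B) b' <= d * D.
  by rewrite mulr_ge0 ?mdist_ge0 ?(ltW d0) //= ler_pM2l.
have min1 : Num.min d 1 = d by rewrite min_l // ge_min lexx.
have tri (y z u : X) : mdist y z <= mdist u y + mdist u z.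
  by rewrite (metric_sym u y); exact: metric_triangle.
move=> y y' w w'; rewrite [X in _ -> _ -> `|_ - X| <= _]mdist_ddist /=.
case: w w' => [b|q] [b'|q'] /=; rewrite /wcross ?posE //.
- move=> -> ->; rewrite mdistxx sub0r normrN ger0_norm; have := dB b b'; lra.
- move=> -> qy; rewrite mul1r min1 [X in _ + _ + X](_ : _ = mdist n0 (sval q')) //.
  have := dB b b0; have := metric_triangle n0 (sval q') y'.
  have := metric_triangle n0 y' (sval q').
  rewrite (metric_sym y') => *; rewrite ler_norml; lra.
- move=> qy ->; rewrite mul1r min1 [X in _ + _ + X](_ : _ = mdist n0 (sval q)) //.
  have := dB b' b0; have := metric_triangle n0 (sval q) y.
  have := metric_triangle n0 y (sval q).
  rewrite (metric_sym y n0) (metric_sym y) => *; rewrite ler_norml; lra.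
move=> qy qy'; rewrite mul1r [X in _ - X](_ : _ = mdist (sval q) (sval q')) //.
have := tri y y' (sval q); have := metric_triangle (sval q) (sval q') y'.
have := tri (sval q) (sval q') y; have := metric_triangle y y' (sval q').
rewrite (metric_sym y (sval q)) (metric_sym y' (sval q')).
move=> *; rewrite ler_norml; lra.
Qed.

End Conclusion.

(** * Infinite dimension *)

Section Scales.
Variables (R : realType) (n : nat).

(* The point k+1 is at distance about 4^-k (1 + x k) from the points 0, ..., k,
   so that k+2 points at mutual distance 1.7 * 4^-k exist when x k = 1, and
   none at mutual distance more than 1.3 * 4^-k when x k = 0. *)
Definition scale (x : nat -> R) (a : nat) : R :=
  if a is k.+1 then 4^-1 ^+ k * (1 + `|x k|) else 0.

Lemma scale_ge0 x a : 0 <= scale x a.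
Proof. by case: a => //= k; rewrite mulr_ge0 ?exprn_ge0 ?addr_ge0 ?invr_ge0. Qed.

Lemma scale_gt0 x k : 0 < scale x k.+1.
Proof. by rewrite /= mulr_gt0 ?exprn_gt0 ?ltr_pwDl ?invr_gt0. Qed.

Lemma pow4_le i j : (i <= j)%N -> 4^-1 ^+ j <= 4^-1 ^+ i :> R.
Proof. by move=> ij; rewrite ler_wiXn2l ?invr_ge0 ?invf_le1 ?ler1n. Qed.

Lemma pow4_gt0 i : 0 < 4^-1 ^+ i :> R.
Proof. by rewrite exprn_gt0 // invr_gt0. Qed.

(** The ratio 4 keeps the levels apart whatever x is, since the factor 1 + x k varies only between 1
    and 2. *)
Lemma scale_le x i a : (forall j, 0 <= x j <= 1) -> (i.+1 < a)%N ->
  scale x a <= 4^-1 ^+ i.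
Proof.
case: a => // k x01 ik /=; have /andP[x0 x1] := x01 k; rewrite ger0_norm //.
have := @pow4_le i.+1 k ik; rewrite exprS => H.
apply: (@le_trans _ _ (4^-1 ^+ k * 2)); first by rewrite ler_pM2l ?pow4_gt0 //; lra.
by have := pow4_gt0 i; lra.
Qed.

Lemma scale_ge x i a : (0 < a <= i)%N -> 4 * 4^-1 ^+ i <= scale x a.
Proof.
case: a => // k /= ki; apply: (@le_trans _ _ (4^-1 ^+ k)).
  by have := @pow4_le k.+1 i ki; rewrite exprS; lra.
by rewrite ler_peMr ?(ltW (pow4_gt0 _)) // lerDl.
Qed.

Definition scale_pt : Type := {a : nat | (a <= n)%N}.

(** An ultrametric: off the diagonal it is a maximum of nonnegative values attached to the points,
    and only the point 0 has value 0. *)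
Definition scale_dist (x : nat -> R) (a b : scale_pt) : R :=
  if sval a == sval b then 0 else Num.max (scale x (sval a)) (scale x (sval b)).

Lemma scale_distxx x a : scale_dist x a a = 0.
Proof. by rewrite /scale_dist eqxx. Qed.

Lemma scale_dist_eq0 x a b : scale_dist x a b = 0 -> a = b.
Proof.
rewrite /scale_dist; case: eqVneq => [ab _|ab m0].
  by apply: eq_sig_hprop => // ? ? ?; exact: bool_irrelevance.
have : scale x (sval a) <= 0 /\ scale x (sval b) <= 0.
  by rewrite -m0 !le_max !lexx orbT.
move: ab; case: a b {m0} => [[|a] pa] [[|b] pb] //= _ [].
- by move=> _; rewrite leNgt scale_gt0.
- by rewrite leNgt scale_gt0.
- by rewrite leNgt scale_gt0.
Qed.

Lemma scale_dist_sym x a b : scale_dist x a b = scale_dist x b a.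
Proof. by rewrite /scale_dist eq_sym maxC. Qed.

Lemma scale_dist_tri x b a c :
  scale_dist x a c <= scale_dist x a b + scale_dist x b c.
Proof.
rewrite /scale_dist; move: (sval a) (sval b) (sval c) => {}a {}b {}c.
have sa := scale_ge0 x a; have sb := scale_ge0 x b; have sc := scale_ge0 x c.
have [ma mb] : scale x a <= Num.max (scale x a) (scale x b) /\
  scale x b <= Num.max (scale x a) (scale x b) by rewrite !le_max !lexx orbT.
have [mb' mc] : scale x b <= Num.max (scale x b) (scale x c) /\
  scale x c <= Num.max (scale x b) (scale x c) by rewrite !le_max !lexx orbT.
case: (eqVneq a b) => [<-|ab]; first by rewrite add0r.
case: (eqVneq b c) => [<-|bc]; first by rewrite (negPf ab) addr0.
case: eqVneq => _; first by lra.
by rewrite ge_max; apply/andP; split; lra.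
Qed.

Definition scale_dspace (x : nat -> R) : dspace R :=
  DSpace (scale_distxx x) (@scale_dist_eq0 x) (@scale_dist_sym x)
    (@scale_dist_tri x).

Lemma scale_finite x : finite_set [set: dtype (scale_dspace x)].
Proof.
pose v (a : dtype (scale_dspace x)) : nat := sval (a : scale_pt).
apply: sub_finite_set (@finite_preimage _ _ `I_n.+1 v _ (finite_II _)).
  by move=> a _; exact: (svalP (a : scale_pt)).
move=> a b _ _ ab; apply: eq_sig_hprop => // ? ? ?; exact: bool_irrelevance.
Qed.

Lemma scale_dist_lip x y (e : R) a b : 0 <= e ->
  (forall i, (i < n)%N -> `|x i - y i| <= e) ->
  `|scale_dist x a b - scale_dist y a b| <= 2 * e.
Proof.
move=> e0 xy; have sl c : (c <= n)%N -> `|scale x c - scale y c| <= e.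
  case: c => [|k] kn /=; first by rewrite subrr normr0.
  rewrite -mulrBr normrM ger0_norm ?(ltW (pow4_gt0 _)) //.
  rewrite -[leRHS]mul1r; apply: ler_pM; rewrite ?normr_ge0 ?(ltW (pow4_gt0 _)) //.
    by rewrite exprn_ile1 ?invr_ge0 ?invf_le1 ?ler1n.
  rewrite [X in `|X|](_ : _ = `|x k| - `|y k|); last lra.
  exact: le_trans (ler_dist_dist _ _) (xy k kn).
rewrite /scale_dist; case: eqP => _; first by rewrite subrr normr0 mulr_ge0.
have := sl _ (svalP a); have := sl _ (svalP b).
rewrite !ler_norml => /andP[? ?] /andP[? ?].
by case: (ltP (scale x (sval a))) => h1; case: (ltP (scale y (sval a))) => h2; lra.
Qed.

End Scales.

Section InfiniteDimensional.
Variable R : realType.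
Variables (l a1 a2 a3 a4 : \bar R).
Hypotheses (l0 : (0 <= l)%E) (a10 : (0 <= a1)%E) (a20 : (0 <= a2)%E)
  (a30 : (0 <= a3)%E) (a40 : (0 <= a4)%E).
Variables (B : compactMetric R) (hB : has_dims l a1 a2 a3 a4 B).
Variables (b0 : B) (D : R) (n : nat).
Hypotheses (D0 : 0 <= D) (bD : forall x y : B, mdist x y <= D).

Local Notation K := (dtype (seqspace (half R) (subcube R (fun i => i < n)%N))).

(** The copy of [B] and the gap together stay below a tenth of the smallest scale, too little to
    cross the thresholds 13/10 and 17/10. *)
Let d : R := 10^-1 * 4^-1 ^+ n / (D + 1).

Let D1 : 0 < D + 1. Proof. by rewrite ltr_wpDl. Qed.

Let d0 : 0 < d.
Proof. by rewrite divr_gt0 // mulr_gt0 ?invr_gt0 ?pow4_gt0. Qed.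

Let d1 : d <= 1.
Proof.
rewrite ler_pdivrMr // mul1r; have := @pow4_le R 0 n (leq0n n); rewrite expr0.
by have := pow4_gt0 R n; have := D0; lra.
Qed.

Let dD : d * D + d <= 10^-1 * 4^-1 ^+ n.
Proof. by rewrite -[X in _ + X]mulr1 -mulrDr divfK ?gt_eqF. Qed.

Definition scale_pt0 : scale_pt n := exist _ 0%N (leq0n n).

Definition scale_cm (x : K) : compactMetric R :=
  @fin_cm R (scale_dspace n (seq_of x)) scale_pt0 (scale_finite _ _).

Definition scale_wedge (x : K) : compactMetric R :=
  @cwedge R B (scale_cm x) b0 scale_pt0 d 1.

Lemma scale_wedge_dims x : has_dims l a1 a2 a3 a4 (scale_wedge x).
Proof. exact: has_dims_fin_wedge. Qed.

Lemma scale_wedge_continuous : continuous (fun x => isometry_class (scale_wedge x)).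
Proof.
move=> x; apply: GH_nbhs => e e0; have h0 : 0 < e / 4 by rewrite divr_gt0.
have : \forall y \near x, forall i : 'I_n, `|seq_of x i - seq_of y i| <= e / 4.
  apply: (@filter_forall _ _ _ (nbhs x)) => i.
  apply: filterS (_ : nbhs x [set y : K | (fun r => `|seq_of x i - r| < e / 4) (seq_of y i)]).
    by move=> y /ltW.
  apply: open_nbhs_nbhs; split; last by rewrite /= subrr normr0.
  apply: (@coord_open R (half R) _ i (fun r => `|seq_of x i - r| < e / 4)).
  exact: (@ball_open R R^o (seq_of x i) (e / 4)).
apply: (@filterS _ (nbhs x)) => y xy; apply: (@le_lt_trans _ _ (e / 2)%:E); last by rewrite lte_fin; lra.
apply: (@GH_le R (scale_wedge x) (scale_wedge y)
  (fun p q => (p : B + scale_pt n) = q)); first by rewrite divr_gt0.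
- by move=> p; exists p.
- by move=> p; exists p.
have lip (a b : scale_pt n) : `|scale_dist (seq_of x) a b - scale_dist (seq_of y) a b| <= 2 * (e / 4).
  by apply: scale_dist_lip (ltW h0) _ => i ilt; exact: (xy (Ordinal ilt)).
have cr (u c c' : R) : `|c - c'| <= 2 * (e / 4) -> `|u + c - (u + c')| <= 2 * (e / 2).
  by rewrite !ler_norml; lra.
move=> p p' _ _ <- <-; rewrite !mdist_ddist /=.
case: p p' => [b|a] [b'|a'] /=; rewrite /wcross ?posE ?ltr01 ?mul1r //.
- by rewrite subrr normr0 mulr_ge0 // divr_ge0 // ltW.
- by apply: cr; exact: lip.
- by apply: cr; exact: lip.
- by apply: le_trans (lip _ _) _; lra.
Qed.

(** When coordinate i is 1, the points 0, ..., i + 1 of the finite space are at mutual distance at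
    least 2 * 4^-i. *)
Lemma scale_sep_lt (x : K) (i : 'I_n) : seq_of x i = 1 ->
  ~ sep_lt i.+2 (17 / 10 * 4^-1 ^+ i) (isometry_class (scale_wedge x)).
Proof.
move=> xi [h h0]; rewrite sep_pts_class; apply.
have lt_n (j : 'I_i.+2) : (j <= n)%N by rewrite (leq_trans _ (ltn_ord i)) // -ltnS.
pose pt j : scale_pt n := exist (fun a : nat => (a <= n)%N) (nat_of_ord j) (lt_n j).
exists (fun j => inr (pt j)) => j k jk.
rewrite mdist_ddist /= posE // mul1r.
rewrite [X in _ <= X](_ : _ = scale_dist (seq_of x) (pt j) (pt k)) //.
rewrite /scale_dist /=.
case: eqVneq => [E|_]; first by rewrite (val_inj E) eqxx in jk.
have p4 := pow4_gt0 R i.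
have sc (a : nat) : (0 < a)%N -> (a <= i.+1)%N -> 17 / 10 * 4^-1 ^+ i - h <= scale (seq_of x) a.
  move=> a0; rewrite leq_eqVlt => /orP[/eqP ->|ai].
    by rewrite /= xi normr1; lra.
  by have := @scale_ge R (seq_of x) i a; rewrite a0 -ltnS ai => /(_ isT); lra.
have [j0|j0] := posnP j; rewrite le_max.
  by apply/orP; right; apply: sc; [rewrite lt0n -j0 eq_sym|rewrite -ltnS].
by apply/orP; left; apply: sc => //; rewrite -ltnS.
Qed.

Lemma scale_sep_gt (x : K) (i : 'I_n) : seq_of x i = 0 ->
  ~ sep_gt i.+2 (13 / 10 * 4^-1 ^+ i) (isometry_class (scale_wedge x)).
Proof.
move=> xi [h h0]; rewrite sep_pts_class => -[p pP].
(* Of the i + 1 classes, i are the single points 1, ..., i. The class of [ord0] consists of the copy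
   of [B], the point 0 and the points beyond i; its diameter is at most 11/10 * 4^-i, so i + 2
   points cannot be that far apart. *)
pose hh (w : B + scale_pt n) : 'I_i.+1 :=
  match w with inl _ => ord0 | inr a => if (sval a <= i)%N then inord (sval a) else ord0 end.
suff : injective (fun j => hh (p j)) by move=> /leq_card; rewrite !card_ord ltnn.
move=> j k hjk; apply/eqP; apply/negPn/negP => jk.
have := pP j k jk; have p4 := pow4_gt0 R i.
have p4n : 4^-1 ^+ n <= 4^-1 ^+ i :> R by rewrite pow4_le // ltnW.
have dB b b' : d * mdist (b : B) b' <= d * D by rewrite ler_pM2l.
have dD' := dD; have dp := d0; have dl := d1.
have dD0 : 0 <= d * D by rewrite mulr_ge0 // ltW.
have sc (a : scale_pt n) : ~~ (0 < sval a <= i)%N -> scale (seq_of x) (sval a) <= 4^-1 ^+ i.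
  rewrite negb_and -leqNgt -ltnNge leqn0 => /orP[/eqP -> /=|]; first exact: ltW.
  rewrite leq_eqVlt => /orP[/eqP <- /=|]; first by rewrite xi normr0 addr0 mulr1.
  by apply: scale_le => m; exact: seq_of01.
have h00 (a : scale_pt n) : hh (inr a) = ord0 -> ~~ (0 < sval a <= i)%N.
  rewrite /=; case: ifP => [ai|]; last by rewrite andbF.
  by move/(congr1 val); rewrite /= inordK // => ->.
have dist0 (a : scale_pt n) : ~~ (0 < sval a <= i)%N ->
    scale_dist (seq_of x) scale_pt0 a <= 4^-1 ^+ i.
  move=> /sc sa; rewrite /scale_dist; case: ifP => _; first exact: ltW.
  by rewrite ge_max sa andbT ltW.
move: (p j) (p k) hjk => [b|a] [b'|a'] hjk; rewrite mdist_ddist /= /wcross ?posE ?mul1r //.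
- by have := dB b b'; lra.
- have := dB b b0; have := dist0 a' (h00 _ (esym hjk)); rewrite min_l //.
  by rewrite [X in _ + _ + X](_ : _ = scale_dist (seq_of x) scale_pt0 a') //; lra.
- have := dB b' b0; have := dist0 a (h00 _ hjk); rewrite min_l //.
  by rewrite [X in _ + _ + X](_ : _ = scale_dist (seq_of x) scale_pt0 a) //; lra.
rewrite [X in _ <= X -> _](_ : _ = scale_dist (seq_of x) a a') // /scale_dist.
case: eqVneq => [_|aa']; first by lra.
have [ai|ai] := boolP (0 < sval a <= i)%N; last first.
  have a'i : ~~ (0 < sval a' <= i)%N.
    apply: h00; rewrite -hjk /=; case: ifP => // h1; apply: val_inj; rewrite /= inordK //.
    by move: ai; rewrite h1 andbT -leqNgt leqn0 => /eqP.
  by have := sc a ai; have := sc a' a'i; rewrite maxEle; case: ifP => _; lra.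
have := h00 a'; have := hjk; rewrite /=.
have /andP[a0 ai'] := ai; rewrite ai'; case: ifP => a'i.
  by move=> /(congr1 val); rewrite /= !inordK // => E; rewrite E eqxx in aa'.
by move=> /(congr1 val); rewrite /= inordK // => E; rewrite E in a0.
Qed.

Lemma D_set_dim_ge : ~ covering_dim_lt (set_type (D_set l a1 a2 a3 a4)) n.
Proof.
have mem x : isometry_class (scale_wedge x) \in D_set l a1 a2 a3 a4.
  by apply/mem_set; exists (scale_wedge x) => //; exact: scale_wedge_dims.
pose f (x : K) : set_type (D_set l a1 a2 a3 a4) := SigSub (mem x).
pose v (z : set_type (D_set l a1 a2 a3 a4)) : GH_space R := set_val z.
have cv : continuous v by exact: initial_continuous.
apply: (@cube_covering R (fun i => i < n)%N n (fun _ => id) _ f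
  (fun i => v @^-1` sep_lt i.+2 (17 / 10 * 4^-1 ^+ i))
  (fun i => v @^-1` sep_gt i.+2 (13 / 10 * 4^-1 ^+ i))).
- by apply: continuous_comp_initial; exact: scale_wedge_continuous.
- by move=> i; apply: open_comp => [? _|]; [exact: cv|exact: open_sep_lt].
- by move=> i; apply: open_comp => [? _|]; [exact: cv|exact: open_sep_gt].
- move=> i; rewrite setUC -preimage_setU sep_gt_lt ?preimage_setT //.
  by rewrite ltr_pM2r ?pow4_gt0 //; lra.
- by move=> x i xi; exact: scale_sep_gt.
- by move=> x i xi; exact: scale_sep_lt.
Qed.

End InfiniteDimensional.

Lemma D_set_infinite_dimensional (R : realType) (l a1 a2 a3 a4 : \bar R)
    (B : compactMetric R) :
  (0 <= l)%E -> (0 <= a1)%E -> (0 <= a2)%E -> (0 <= a3)%E -> (0 <= a4)%E ->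
  has_dims l a1 a2 a3 a4 B ->
  infinite_dimensional R (set_type (D_set l a1 a2 a3 a4)).
Proof.
move=> l0 a10 a20 a30 a40 hB; have [b0 _] := cm_nonempty B.
have [D D0 bD] := compact_bounded b0 (@cm_compact R B).
apply/eqyP => A A0.
have := @D_set_dim_ge R l a1 a2 a3 a4 l0 a10 a20 a30 a40 B hB b0 D (Num.truncn A).+1 D0 bD.
move=> /(@dim_T_ge R); apply: le_trans.
by rewrite lee_fin ltW // truncnS_gt.
Qed.

(** * Boolean sequence spaces *)

Section BooleanSequences.
Variable R : realType.

(* The weight of the i-th coordinate is expR (- rt i). *)
Record rate := Rate {
  rt :> nat -> R;
  rt_ge0 : forall i, 0 <= rt i;
  rt_mono : forall i j, (i <= j)%N -> rt i <= rt j;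
  rt_oo : forall M : R, exists n, M <= rt n }.

Lemma rate_to0 (L : rate) (e : R) : 0 < e ->
  exists n, forall i, (n <= i)%N -> expR (- L i) <= e.
Proof.
move=> e0; have [n nL] := rt_oo L (- ln e); exists n => i ni.
by rewrite -[leRHS]lnK ?posrE // ler_expR lerNl (le_trans nL) // rt_mono.
Qed.

Lemma rate_le1 (L : rate) i : expR (- L i) <= 1.
Proof. by rewrite -[leRHS]expR0 ler_expR oppr_le0 rt_ge0. Qed.

Definition rweight (L : rate) : weight R :=
  Weight (fun i => expR_gt0 (- L i)) (rate_le1 L) (@rate_to0 L).

(** [c] says which pairs of coordinates may be 1 together. A condition on pairs passes to
    coordinatewise limits, so it keeps the set closed. *)
Definition bset (c : rel nat) : set (nat -> R) := [set x | forall i j,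
  (x i = 0 \/ x i = 1) /\ (x i != 0 -> x j != 0 -> c i j)].

Lemma bset01 c x i : bset c x -> 0 <= x i <= 1.
Proof. by move=> /(_ i i)[[]-> _]; rewrite ?lexx ler01. Qed.

Lemma bset_closed c b :
  (forall (n : nat) (e : R), 0 < e -> exists2 x, bset c x &
     forall i, (i < n)%N -> `|x i - b i| <= e) -> bset c b.
Proof.
move=> H i j.
have eqx n : exists2 x, bset c x & forall i, (i < n)%N -> b i = 0 \/ b i = 1 -> x i = b i.
  have [|x bx xb] := H n (1 / 2); first by rewrite divr_gt0.
  exists x => // k kn bk; have := xb k kn; have [+ _] := bx k k.
  by move=> [->|->]; case: bk => -> //; rewrite ler_norml; lra.
have b01 k : b k = 0 \/ b k = 1.
  have [|] := pselect (b k = 0 \/ b k = 1) => // /not_orP[/eqP b0 /eqP b1].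
  pose e := Num.min `|b k| `|b k - 1| / 2.
  have e0 : 0 < e by rewrite divr_gt0 // lt_min !normr_gt0 subr_eq0 b0 b1.
  have [x bx /(_ k (ltnSn k))] := H k.+1 e e0.
  have m1 : Num.min `|b k| `|b k - 1| <= `|b k| by rewrite ge_min lexx.
  have m2 : Num.min `|b k| `|b k - 1| <= `|b k - 1| by rewrite ge_min lexx orbT.
  by have [[->|->] _] := bx k k; rewrite ?sub0r ?normrN 1?distrC /e; move: e0; rewrite /e; lra.
split=> [|bi bj]; first exact: b01.
have [x bx xb] := eqx (maxn i j).+1.
have [_] := bx i j; rewrite !xb ?ltnS ?leq_maxl ?leq_maxr //; exact.
Qed.

Definition bseq (c : rel nat) : seqset R :=
  @SeqSet R (bset c) (@bset01 c) (@bset_closed c).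

Section Space.
Variables (L : rate) (c : rel nat).
Local Notation T := (dtype (seqspace (rweight L) (bseq c))).

Definition bit (x : T) (i : nat) : bool := seq_of x i != 0.

Lemma bitE x i : seq_of x i = (bit x i)%:R.
Proof.
have bx : bset c (seq_of x) := svalP x.
rewrite /bit; have [[] -> _] := bx i i.
- by rewrite eqxx.
- by rewrite oner_eq0.
Qed.

Lemma bit_dist x y i : bit x i != bit y i -> expR (- L i) <= mdist x y.
Proof.
move=> xy; have := sdist_ub (rweight L) x y i; apply: le_trans; rewrite !bitE.
by move: xy; case: (bit x i); case: (bit y i) => //= _;
  rewrite ?subr0 ?sub0r ?normrN normr1 mulr1.
Qed.

Lemma bit_prefix x y n : (forall i, (i < n)%N -> bit x i = bit y i) ->
  mdist x y <= expR (- L n).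
Proof.
move=> xy; apply: sdist_le => i; have [ni|ni] := ltnP i n.
  by rewrite !bitE xy // subrr normr0 mulr0 expR_ge0.
rewrite -[leRHS]mulr1; apply: ler_pM; rewrite ?expR_ge0 ?normr_ge0 ?seq_of_diff //.
by rewrite /= ler_expR lerN2 rt_mono.
Qed.

Definition bpt_fun (p : nat -> bool) (i : nat) : R := (p i)%:R.

Lemma bpt_sub (p : nat -> bool) : (forall i j, p i -> p j -> c i j) ->
  bseq c (bpt_fun p).
Proof.
move=> pc i j; rewrite /bpt_fun !pnatr_eq0 !eqb0 !negbK; split; last exact: pc.
by case: (p i); [right|left].
Qed.

Definition bpt (p : nat -> bool) (pc : forall i j, p i -> p j -> c i j) : T :=
  exist _ _ (bpt_sub pc).

Lemma bit_bpt p pc i : bit (@bpt p pc) i = p i.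
Proof. by rewrite /bit /seq_of /= /bpt_fun pnatr_eq0 eqb0 negbK. Qed.

Lemma bpt0P : forall i j, xpred0 i -> xpred0 j -> c i j. Proof. by []. Qed.

Definition bpt0 : T := bpt bpt0P.

Definition bool_cm : compactMetric R :=
  @seqspace_cm R (rweight L) (bseq c) (ex_intro _ _ (bpt_sub bpt0P)).

(** Points that agree before k are within expR (- L k), so separated points of [A] differ in one of
    the bits i, ..., k - 1. For k <= i the difference truncates to 0 and the bound is 1. *)
Lemma sepb_prefix (A : set T) i k rr :
  (forall x y j, A x -> A y -> (j < i)%N -> bit x j = bit y j) ->
  expR (- L k) <= rr -> sepb A rr (2 ^+ (k - i)).
Proof.
move=> Ai krr l lA ls; have rr0 : 0 <= rr by apply: le_trans krr; exact: expR_ge0.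
pose h (x : T) : {ffun 'I_(k - i) -> bool} := [ffun j : 'I_(k - i) => bit x (i + j)].
rewrite -natrX ler_nat; have := @sepl_card R T _ rr h l rr0 _ ls.
rewrite card_ffun card_bool card_ord; apply=> x y xl yl.
apply: contraL => /eqP hxy; rewrite -leNgt; apply: le_trans krr.
apply: bit_prefix => j jk; have [ji|ij] := ltnP j i; first by apply: Ai; auto.
have jk' : (j - i < k - i)%N by rewrite ltn_sub2r // (leq_ltn_trans ij).
by have := congr1 (fun f : {ffun 'I_(k - i) -> bool} => f (Ordinal jk')) hxy;
   rewrite !ffunE /= subnKC.
Qed.

(** Cylinders over the first n bits form an open partition of small mesh. *)
Lemma bool_dim_T : (dim_T R T <= 0)%E.
Proof.
have -> : 0%E = (1%:R - 1)%:E :> \bar R by rewrite subrr.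
apply/dim_T_leP; apply: (small_covers_dim bpt0); first exact: seqspace_compact.
move=> e e0; have [n nL] := rate_to0 L (divr_gt0 e0 (ltr0n R 2)).
pose cyl (p : {ffun 'I_n -> bool}) : set T := [set x | forall i : 'I_n, bit x i = p i].
have cylE p q x : cyl p x -> cyl q x -> p = q.
  by move=> px qx; apply/ffunP => i; rewrite -px -qx.
exists [set cyl p | p in [set: {ffun 'I_n -> bool}]]; split.
- exact/finite_image/finite_finset.
- split=> [_ [p _ <-]|].
    apply/open_mdistE => x px; exists (expR (- L n)); first exact: expR_gt0.
    move=> y xy i; rewrite -px; case: (eqVneq (bit x i) (bit y i)) => [//|/bit_dist].
    rewrite leNgt => /negP[]; apply: lt_le_trans xy _; rewrite ler_expR.
    by rewrite lerN2 rt_mono // ltnW.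
  rewrite -subTset => x _; exists (cyl [ffun i : 'I_n => bit x i]).
    by exists [ffun i : 'I_n => bit x i].
  by move=> i; rewrite ffunE.
- move=> F Finj FV; rewrite -subset0 => z Fz.
  have FF : F ord0 = F ord_max.
    have [p _ pF] := FV ord0; have [q _ qF] := FV ord_max.
    rewrite -pF -qF; congr cyl; apply: (cylE _ _ z).
      by rewrite pF; exact: Fz.
    by rewrite qF; exact: Fz.
  by have /(congr1 val) := Finj _ _ FF.
- move=> _ x y [p _ <-] px py; apply: (@le_lt_trans _ _ (e / 2)); last by lra.
  apply: le_trans (nL n (leqnn n)); apply: bit_prefix => i ilt.
  by rewrite (px (Ordinal ilt)) (py (Ordinal ilt)).
Qed.

Lemma first_below (rr : R) : 0 < rr -> exists k,
  expR (- L k) <= rr /\ forall i, (i < k)%N -> rr < expR (- L i).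
Proof.
move=> rr0; have [n0 H0] := rate_to0 L rr0.
have ex : exists n, expR (- L n) <= rr by exists n0; exact: H0.
exists (ex_minn ex); case: ex_minnP => k kr kmin; split=> // i ik.
by rewrite ltNge; apply/negP => /kmin; rewrite leqNgt ik.
Qed.

(* Counts the 2^(k-i) points whose only nonzero bits are among i, ..., k-1. *)
Lemma sepb_block (A : set T) i k rr (K : R) : (i < k)%N -> rr < expR (- L k.-1) ->
  (forall j j', (i <= j < k)%N -> (i <= j' < k)%N -> c j j') ->
  (forall x, (forall j, bit x j -> (i <= j < k)%N) -> A x) ->
  sepb A rr K -> 2 ^+ (k - i) <= K.
Proof.
move=> ik rrk ck Abl sA.
pose p (f : {ffun 'I_(k - i) -> bool}) j :=
  if insub (j - i)%N is Some j' then (i <= j)%N && f j' else false.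
have pi f j : p f j -> (i <= j < k)%N.
  rewrite /p; case: insubP => // u uk _ /andP[ij _]; rewrite ij /=.
  by rewrite -(ltn_sub2rE _ ij).
have pc f j j' : p f j -> p f j' -> c j j' by move=> /pi h /pi; exact: ck.
pose P f := bpt (pc f).
have := sA (map P (enum {: {ffun 'I_(k - i) -> bool}})).
rewrite size_map -cardE card_ffun card_bool card_ord natrX; apply.
  by move=> _ /mapP[f _ ->]; apply: Abl => j; rewrite bit_bpt; exact: pi.
rewrite /sepl pairwise_map; have := enum_uniq {: {ffun 'I_(k - i) -> bool}}.
rewrite uniq_pairwise; apply: sub_pairwise => f g /= fg.
apply: lt_le_trans rrk _.
have [j fgj] : exists j : 'I_(k - i), f j != g j.
  apply/existsP; rewrite -negb_forall; apply: contra fg => /forallP fg.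
  by apply/eqP/ffunP => j; exact/eqP.
apply: (@le_trans _ _ (expR (- L (i + j)%N))).
  rewrite ler_expR lerN2 rt_mono //; have := ltn_ord j; move: ik; lia.
apply: bit_dist; rewrite !bit_bpt /p addKn; move: fgj; rewrite valK leq_addr //.
Qed.

End Space.

End BooleanSequences.

(** * Compactness and measure of the space of bit sequences *)

Section PrefixCovers.
Variable R : realType.

Lemma prefix_konig (n : nat -> nat) (P : nat -> seq (seq bool)) :
  (forall x : nat -> bool, exists i, mkseq x (n i) \in P i) ->
  exists m, forall x : nat -> bool, exists2 i, (i < m)%N & mkseq x (n i) \in P i.
Proof.
move=> cov; pose bad (p : seq bool) := forall m, exists2 x : nat -> bool,
  mkseq x (size p) = p & forall i, (i < m)%N -> mkseq x (n i) \notin P i.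
have badS p : bad p -> exists b, bad (rcons p b).
  move=> bp; apply: contrapT => /forallNP H.
  have [/existsNP[m0 H0] /existsNP[m1 H1]] := (H false, H true).
  have [x xp xP] := bp (maxn m0 m1).
  case: (boolP (x (size p))) => xb; [apply: H1|apply: H0]; exists x => [|i im].
  - by rewrite size_rcons mkseqS xp xb.
  - by apply: xP; rewrite leq_max im orbT.
  - by rewrite size_rcons mkseqS xp (negbTE xb).
  - by apply: xP; rewrite leq_max im.
apply: contrapT => /forallNP H.
have bad0 : bad [::].
  move=> m; have /existsNP[x Hx] := H m; exists x => // i im.
  by apply/negP => xi; apply: Hx; exists i.
have [g gP] : exists g : seq bool -> bool, forall p, bad p -> bad (rcons p (g p)).
  have [|g gP] := @choice _ _ (fun p b => bad p -> bad (rcons p b)); last by exists g.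
  by move=> p; have [/badS[b]|] := pselect (bad p); [exists b|exists true].
pose pre := fix pre k := if k is k'.+1 then rcons (pre k') (g (pre k')) else [::].
have prebad k : bad (pre k) by elim: k => //= k /gP.
have mkpre k : mkseq (fun j => g (pre j)) k = pre k.
  by elim: k => // k IH; rewrite mkseqS IH.
have [i iP] := cov (fun j => g (pre j)).
have szpre k : size (pre k) = k by rewrite -mkpre size_mkseq.
have [y yp /(_ i (ltnSn i))] := prebad (n i) i.+1.
by rewrite szpre in yp; rewrite yp -mkpre iP.
Qed.

(** The cylinder of a prefix of length n has coin-tossing measure 2^-n, so covering cylinders have
    total measure at least 1. By [prefix_konig] finitely many suffice, and words of a common length
    N are counted. *)
Lemma prefix_count (n : nat -> nat) (P : nat -> seq (seq bool)) :
  (forall x : nat -> bool, exists i, mkseq x (n i) \in P i) ->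
  exists m, 1 <= \sum_(i < m) (size (P i))%:R / 2 ^+ n i :> R.
Proof.
move=> /prefix_konig[m cov]; exists m; pose N := \max_(i < m) n i.
have nN (i : 'I_m) : (n i <= N)%N by exact: leq_bigmax.
have cnt (i : 'I_m) : (\sum_(t : N.-tuple bool) (take (n i) t \in P i) <=
    size (P i) * 2 ^ (N - n i))%N.
  rewrite [leqLHS](_ : _ = #|[pred t : N.-tuple bool | take (n i) t \in P i]|); last first.
    by rewrite -sum1_card [RHS]big_mkcond /=; apply: eq_bigr => t _; rewrite inE; case: ifP.
  rewrite cardE -(size_map (@tval N bool)) -[X in (X ^ _)%N]card_bool -card_tuple [in leqRHS]cardE.
  rewrite -(size_allpairs (fun p (d : (N - n i).-tuple bool) => p ++ d)).
  apply: uniq_leq_size; first by rewrite (map_inj_uniq val_inj) enum_uniq.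
  move=> _ /mapP[t + ->]; rewrite mem_enum inE => tP; apply/allpairsP.
  have dt : size (drop (n i) t) == (N - n i)%N by rewrite size_drop size_tuple.
  by exists (take (n i) t, Tuple dt); rewrite /= mem_enum inE cat_take_drop.
have tot : (2 ^ N <= \sum_(i < m) size (P i) * 2 ^ (N - n i))%N.
  have := leq_sum (index_enum 'I_m) (fun (i : 'I_m) (_ : true) => cnt i).
  apply: leq_trans; rewrite exchange_big /=.
  rewrite -[X in (X ^ N)%N]card_bool -card_tuple -sum1_card; apply: leq_sum => t _.
  have [i im ti] := cov (nth false t).
  rewrite (bigD1 (Ordinal im)) //= -{1}(_ : mkseq (nth false t) (n i) = take (n i) t).
    by rewrite ti.
  rewrite -[in RHS](mkseq_nth false t) size_tuple -map_take take_iota.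
  by rewrite (minn_idPl (nN (Ordinal im))).
rewrite -(@ler_pM2r _ (2 ^+ N)) ?exprn_gt0 // mul1r mulr_suml -natrX.
apply: (@le_trans _ _ (\sum_(i < m) size (P i) * 2 ^ (N - n i))%:R).
  by rewrite ler_nat.
rewrite natr_sum; apply: ler_sum => i _; rewrite natrM natrX -mulrA.
rewrite (_ : (2 ^ N)%:R = 2 ^+ n i * 2 ^+ (N - n i)); last first.
  by rewrite -exprD subnKC // natrX.
by rewrite mulKf // expf_neq0.
Qed.

Lemma sum_pow_lt m : \sum_(i < m) 2^-1 ^+ i.+2 <= 2^-1 :> R.
Proof.
suff -> : \sum_(i < m) 2^-1 ^+ i.+2 = 2^-1 - 2^-1 ^+ m.+1 :> R.
  by rewrite gerBl exprn_ge0 // invr_ge0.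
elim: m => [|m IH]; first by rewrite big_ord0 expr1 subrr.
by rewrite big_ord_recr /= IH !exprS; lra.
Qed.

End PrefixCovers.

Section LogScale.
Variable R : realType.
Implicit Types (x s : R).

Lemma pow2_expR n : 2 ^+ n = expR (n%:R * ln 2) :> R.
Proof. by rewrite expRM_natl lnK // posrE. Qed.

Lemma powR_expR x s : 0 < x -> x `^ s = expR (s * ln x).
Proof. by move=> x0; rewrite /powR gt_eqF. Qed.

Lemma ln2_gt0 : 0 < ln 2 :> R.
Proof. by rewrite ln_gt0 // ltr1n. Qed.

Lemma le_expR x : x <= expR x.
Proof. by apply: le_trans (expR_ge1Dx x); rewrite lerDr. Qed.

End LogScale.

(** * Dimensions of Boolean sequence spaces in terms of the rate *)

Section BooleanDimensions.
Variable R : realType.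
Local Notation theta := (ln 2 : R).
Implicit Types (L : rate R) (s : R).

(** In logarithms: 2^(k - i) is at most a constant times the s-th power of the quotient of the i-th
    and k-th weights. [rate_lb] is the reverse bound. *)
Definition rate_ub L s : Prop := exists c : R, forall i k, (i <= k)%N ->
  (k%:R - i%:R) * theta <= c + s * (L k - L i).

Definition rate_lb L s : Prop := exists c : R, forall i k, (i <= k)%N ->
  s * (L k - L i) <= c + (k%:R - i%:R) * theta.

Lemma rate_ub_const L s c : (forall i k, (i <= k)%N ->
  (k%:R - i%:R) * theta <= c + s * (L k - L i)) -> 0 <= c.
Proof. by move=> /(_ 0%N 0%N (leqnn _)); rewrite !subrr mul0r mulr0 addr0. Qed.

Lemma lt_expR_ln (L : rate R) k r : 0 < r -> r < expR (- L k) -> ln r < - L k.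
Proof. by move=> r0 rk; rewrite -[ltRHS]expRK ltr_ln ?posrE ?expR_gt0. Qed.

Lemma ge_expR_ln (L : rate R) k r : 0 < r -> expR (- L k) <= r -> - L k <= ln r.
Proof. by move=> r0 rk; rewrite -[leLHS]expRK ler_ln ?posrE ?expR_gt0. Qed.

Lemma half_lt (x : R) : 0 < x -> x / 2 < x.
Proof. by move=> x0; lra. Qed.

Section Upper.
Variables (L : rate R) (c : rel nat).
Local Notation T := (dtype (seqspace (rweight L) (bseq R c))).

Lemma bool_apow s : 0 < s -> rate_ub L s -> apow T s.
Proof.
move=> s0 [b Hb]; have b0 := rate_ub_const Hb; have t0 := ln2_gt0 R.
exists (expR (theta + b)) => x rho r r0 rrho; have rho0 := lt_trans r0 rrho.
(* A ball of radius rho fixes the bits before [i0], and agreement before [k0] brings points within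
   r. *)
have [i0 [i0r i0lt]] := first_below L rho0; have [k0 [k0r k0lt]] := first_below L r0.
have lnr : ln r < ln rho by rewrite ltr_ln ?posrE.
apply: sepb_le (lexx r) _ (sepb_prefix (i := i0) _ k0r); last first.
  move=> y z j xy xz ji; case: (eqVneq (bit y j) (bit z j)) => // yz; exfalso.
  have := i0lt _ ji; apply/negP; rewrite -leNgt.
  have [E|/bit_dist/le_trans] := eqVneq (bit x j) (bit y j); last exact.
  by move: yz; rewrite -E => /bit_dist/le_trans; apply.
rewrite powR_expR ?divr_gt0 // ln_div ?posrE // pow2_expR -expRD ler_expR.
have ss : 0 <= s * (ln rho - ln r) by apply: mulr_ge0; [exact: ltW|rewrite subr_ge0 ltW].
have [ki|ik] := leqP k0 i0; first by move: ki; rewrite -subn_eq0 => /eqP ->; lra.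
(* The rate bound is applied up to k0 - 1, the last index whose weight exceeds r; the remaining bit
   accounts for [theta] in the constant. *)
case: k0 ik k0r k0lt => // k; rewrite ltnS => ik _ /(_ k (ltnSn k)) /(lt_expR_ln r0) rk.
have rI := ge_expR_ln rho0 i0r.
have e1 : (k - i0).+1%:R = k%:R - i0%:R + 1 :> R by rewrite -natr1 natrB.
have := Hb _ _ ik; rewrite subSn // e1.
have : s * (L k - L i0) <= s * (ln rho - ln r) by rewrite ler_pM2l //; lra.
by lra.
Qed.

Lemma bool_dim_A a : (0 <= a)%E ->
  (forall s, 0 < s -> (a < s%:E)%E -> rate_ub L s) -> (dim_A T <= a)%E.
Proof.
move=> a0 H; apply: ereal_le_approx => // s s0 as'.
by apply: dim_A_le => //; apply: bool_apow => //; exact: H.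
Qed.

Lemma bool_hpow s : 0 < s -> (forall M : R, exists n : nat, M <= s * L n - n%:R * theta) ->
  hpow T s.
Proof.
move=> s0 H; apply: sepb_hpow => // e e0; have [n Hn] := H (s * theta - ln e).
exists (expR (- L n)), (2 ^+ (n - 0)); split; first exact: expR_gt0.
  exact: (sepb_prefix (i := 0)).
rewrite powR_expR ?mulr_gt0 ?expR_gt0 // lnM ?posrE ?expR_gt0 // expRK.
by rewrite pow2_expR -expRD -[leRHS]lnK ?posrE // ler_expR subn0; lra.
Qed.

Lemma bool_bpow s : 0 < s -> (exists b : R, forall k, k%:R * theta <= b + s * L k) ->
  bpow [set: T] s.
Proof.
move=> s0 [b Hb]; have t0 := ln2_gt0 R.
exists (expR (`|b| + theta)), 1; split=> // r /andP[r0 r1].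
have [k0 [k0r k0lt]] := first_below L r0.
apply: sepb_le (lexx r) _ (sepb_prefix (i := 0) _ k0r) => //.
have lr : ln r < 0 by rewrite ln_lt0 // r0.
have ss : 0 <= s * - ln r by apply: mulr_ge0; [exact: ltW|rewrite oppr_ge0 ltW].
have bb := ler_norm b; have b0 := normr_ge0 b.
rewrite powR_expR // pow2_expR -expRD ler_expR subn0.
case: k0 k0r k0lt => [|k] _; first by rewrite mul0r; lra.
move=> /(_ k (ltnSn k)) /(lt_expR_ln r0) rk.
have : s * L k <= s * - ln r by rewrite ler_pM2l //; lra.
by have := Hb k; rewrite -natr1; lra.
Qed.

Lemma bpow_blocks s : 0 < s ->
  (forall M : R, exists i k : nat, [/\ (i < k)%N,
     forall j j', (i <= j < k)%N -> (i <= j' < k)%N -> c j j',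
     M <= L k.-1 & M <= (k%:R - i%:R) * theta - s * L k.-1]) ->
  ~ bpow [set: T] s.
Proof.
move=> s0 H [C [d [d0 sB]]]; have t0 := ln2_gt0 R.
have [i [k [ik ck Md MC]]] := H (Num.max (- ln d) (C + s * theta + 1)).
move: Md MC; rewrite !ge_max => /andP[Md _] /andP[_ MC].
(* Half of the last weight of the block, because separation is strict. *)
pose r := expR (- L k.-1) / 2; have r0 : 0 < r by rewrite divr_gt0 ?expR_gt0.
have rk : r < expR (- L k.-1) by apply: half_lt; exact: expR_gt0.
have rd : r < d by rewrite (lt_le_trans rk) // -[leRHS]lnK ?posrE // ler_expR; lra.
have := sepb_block ik rk ck (fun _ _ => I) (sB r _); rewrite r0 rd => /(_ isT).
rewrite powR_expR // ln_div ?posrE ?expR_gt0 // expRK => H1.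
(* [C] may have any sign; it is replaced by the larger expR C so that logarithms can be compared. *)
have : 2 ^+ (k - i) <= expR C * expR (- s * (- L k.-1 - theta)).
  by apply: le_trans H1 _; rewrite ler_wpM2r ?expR_ge0 // le_expR.
rewrite pow2_expR -expRD ler_expR natrB ?(ltnW ik) //; lra.
Qed.

(** The points supported on the block i, ..., k vanish before i, hence lie in the ball of radius
    expR (- L i) around the zero sequence. *)
Lemma apow_blocks s : 0 < s -> (forall j j', c j j') ->
  (forall M : R, exists i k : nat, (i <= k)%N /\
     M <= (k.+1%:R - i%:R) * theta - s * (L k - L i)) ->
  ~ apow T s.
Proof.
move=> s0 ck H [C sA]; have t0 := ln2_gt0 R.
have [i [k [ik MC]]] := H (C + s * theta + 1).
pose r := expR (- L k) / 2; have r0 : 0 < r by rewrite divr_gt0 ?expR_gt0.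
have rk : r < expR (- L k) by apply: half_lt; exact: expR_gt0.
have rrho : r < expR (- L i) by apply: lt_le_trans rk _; rewrite ler_expR lerN2 rt_mono.
have H1 : 2 ^+ (k.+1 - i) <= C * (expR (- L i) / r) `^ s.
  apply: (sepb_block (k := k.+1) _ rk _ _ (sA (bpt0 L c) _ _ r0 rrho)) => //.
  move=> x xi; apply: bit_prefix => j ji; rewrite bit_bpt /=; apply/esym/negbTE.
  by apply/negP => /xi; rewrite leqNgt ji.
move: H1; rewrite powR_expR ?divr_gt0 ?expR_gt0 // ln_div ?posrE ?expR_gt0 // expRK.
rewrite ln_div ?posrE ?expR_gt0 // expRK => H1.
have : 2 ^+ (k.+1 - i) <= expR C * expR (s * (- L i - (- L k - theta))).
  by apply: le_trans H1 _; rewrite ler_wpM2r ?expR_ge0 // le_expR.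
rewrite pow2_expR -expRD ler_expR natrB ?(leqW ik) //; lra.
Qed.

End Upper.

Section Full.
Variable L : rate R.
Local Notation T := (dtype (seqspace (rweight L) (bseq R (fun _ _ => true)))).

(** Points of [S i] that differ in the first [n i] bits are more than [r i] apart, so [S i] meets at
    most [K i] cylinders of length [n i]; [prefix_count] bounds their total measure from below. *)
Lemma bool_mass (S : nat -> set T) (n : nat -> nat) (K r : nat -> R) :
  [set: T] `<=` \bigcup_i S i -> (forall i, sepb (S i) (r i) (K i)) ->
  (forall i, 0 <= r i) ->
  (forall i j, (j < n i)%N -> r i < expR (- L j)) ->
  exists m, 1 <= \sum_(i < m) K i / 2 ^+ n i.
Proof.
move=> cS sS r0 rn.
pose ts i := [seq t : (n i).-tuple bool <- enum {: (n i).-tuple bool} |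
  `[< exists2 x, S i x & mkseq (bit x) (n i) = tval t >]].
pose P i := map (@tval (n i) bool) (ts i).
have szP i : (size (P i))%:R <= K i.
  have ex (t : (n i).-tuple bool) : exists x : T, t \in ts i -> S i x /\ mkseq (bit x) (n i) = tval t.
    have [|] := boolP (t \in ts i); last by exists (bpt0 L (fun _ _ => true)).
    by rewrite mem_filter => /andP[/asboolP[x Sx xt] _]; exists x.
  have [rep repP] := choice ex.
  rewrite size_map -(size_map rep); apply: sS.
    by move=> _ /mapP[t tt ->]; have [] := repP t tt.
  rewrite /sepl pairwise_map; have uts : uniq (ts i) by rewrite filter_uniq // enum_uniq.
  rewrite uniq_pairwise in uts.
  apply: (@sub_in_pairwise _ (mem (ts i)) _ _ _ (ts i) _ uts); last exact: allss.
  move=> t u /repP[_ tE] /repP[_ uE] /= tu.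
  have [j jn] : exists2 j, (j < n i)%N & bit (rep t) j != bit (rep u) j.
    apply: contrapT => H; move/eqP: tu; apply; apply: val_inj; rewrite /= -tE -uE.
    apply/eq_in_map => j; rewrite mem_iota /= add0n => jn.
    by case: (eqVneq (bit (rep t) j) (bit (rep u) j)) => // jtu; case: H; exists j.
  by move=> /bit_dist; apply: lt_le_trans; exact: rn.
have [x|m H] := @prefix_count R n P.
  have [i _ Si] := cS (@bpt R L (fun _ _ => true) x (fun _ _ _ _ => isT)) I.
  exists i; have xt : size (mkseq x (n i)) == n i by rewrite size_mkseq.
  apply/mapP; exists (Tuple xt) => //; rewrite mem_filter mem_enum andbT.
  apply/asboolP; exists (@bpt R L (fun _ _ => true) x (fun _ _ _ _ => isT)) => //.
  by apply: eq_map => j; rewrite bit_bpt.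
exists m; apply: le_trans H _; apply: ler_sum => i _.
by rewrite ler_pM2r ?invr_gt0 ?exprn_gt0.
Qed.

(** The mass distribution principle for the coin-tossing measure: under [rate_lb] a set of diameter
    d > 0 has measure at most a constant times d^s. *)
Lemma full_hpow s : 0 < s -> rate_lb L s -> ~ hpow T s.
Proof.
move=> s0 [b Hb] hT; have t0 := ln2_gt0 R.
pose C := expR (b + s * L 0%N); have C0 : 0 < C by exact: expR_gt0.
have [|S [cS sS]] := hT (C^-1 / 4); first by rewrite divr_gt0 ?invr_gt0.
have bd (x y : T) : mdist x y <= 1 by exact: seqspace_bounded.
have dfin i : diam (S i) = (fine (diam (S i)))%:E.
  rewrite fineK // ge0_fin_numE ?diam_ge0 //.
  by apply: (@le_lt_trans _ _ 1%:E); [exact: diam_le|exact: ltry].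
pose d i := fine (diam (S i)).
have d0 i : 0 <= d i by rewrite -lee_fin -dfin diam_ge0.
have dpow i : ((d i `^ s)%:E <= diam_pow s (S i))%E.
  rewrite /diam_pow; case: eqP => [S0|_]; last by rewrite dfin poweR_EFin.
  have : (diam (S i) <= 0%:E)%E by rewrite S0; apply: diam_le.
  rewrite dfin lee_fin => di; have -> : d i = 0 by apply/eqP; rewrite eq_le di d0.
  by rewrite powR0 ?gt_eqF.
have sepS i : sepb (S i) (d i) 1.
  move=> [|x [|y l]] lS //= => /andP[/andP[xy _] _]; exfalso; move: xy; apply/negP.
  rewrite -leNgt -lee_fin -dfin; apply: mdist_le_diam; apply: lS; rewrite !inE eqxx ?orbT //.
(* [S i] lies in a single cylinder of length [n]; for d i = 0 the length i.+2 is prescribed. The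
   slack terms add up to at most 1/2 and the main terms to at most 1/4, against the total 1 in
   [bool_mass]. *)
have /choice[n nP] i : exists n : nat, (forall j, (j < n)%N -> d i < expR (- L j)) /\
    1 / 2 ^+ n <= C * d i `^ s + 2^-1 ^+ i.+2.
  have [di|di] := ltP 0 (d i); last first.
    have -> : d i = 0 by apply/eqP; rewrite eq_le di d0.
    by exists i.+2; rewrite powR0 ?gt_eqF // mulr0 add0r mul1r exprVn; split=> // j _; exact: expR_gt0.
  have [n [nr nlt]] := first_below L di; exists n; split=> //.
  rewrite -[leLHS]addr0 lerD ?exprn_ge0 ?invr_ge0 // mul1r.
  rewrite powR_expR // pow2_expR -expRN -expRD ler_expR.
  have := Hb 0%N n (leq0n _); rewrite subr0 mulrBr.
  have : s * - L n <= s * ln (d i) by rewrite ler_pM2l //; exact: ge_expR_ln.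
  by lra.
have [m] := bool_mass cS sepS d0 (fun i j => (nP i).1 j).
apply/negP; rewrite -ltNge.
apply: (@le_lt_trans _ _ (\sum_(i < m) (C * d i `^ s + 2^-1 ^+ i.+2))).
  by apply: ler_sum => i _; exact: (nP i).2.
rewrite big_split /= -mulr_sumr.
have h1 := sum_pow_lt R m.
have : \sum_(i < m) d i `^ s <= C^-1 / 4.
  rewrite -lee_fin; apply: le_trans (sS m); rewrite -sumEFin big_mkord.
  by apply: lee_sum => i _; exact: dpow.
by rewrite -(ler_pM2l C0) mulrA divff ?gt_eqF //; lra.
Qed.

(** Countably many sets of box growth s cannot fill the space: each is examined at its own sparse
    scale, where it meets few cylinders, and their measures add up to at most 1/2. *)
Lemma full_ppow s : 0 < s ->
  (forall M : R, exists n : nat, M <= L n /\ s * L n - n.+1%:R * theta <= - M) ->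
  ~ ppow T s.
Proof.
move=> s0 H [S [cS /choice[C /choice[d CdP]]]]; have t0 := ln2_gt0 R.
(* The second condition is the logarithm of the demand that [S i] meets at most a fraction 2^-(i +
   2) of the cylinders of length n + 1, with expR (C i) in place of [C i]. *)
have /choice[n nP] i : exists n : nat, - ln (d i) <= L n /\
    C i + s * theta + i.+2%:R * theta + s * L n - n.+1%:R * theta <= 0.
  have [n] := H (Num.max (- ln (d i)) (C i + s * theta + i.+2%:R * theta)).
  rewrite ge_max => -[/andP[dn _] Hn]; exists n; split=> //.
  have : C i + s * theta + i.+2%:R * theta <= Num.max (- ln (d i)) (C i + s * theta + i.+2%:R * theta).
    by rewrite le_max lexx orbT.
  by lra.
pose r i := expR (- L (n i)) / 2.
have r0 i : 0 < r i by rewrite divr_gt0 ?expR_gt0.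
have rn i : r i < expR (- L (n i)) by apply: half_lt; exact: expR_gt0.
have rd i : r i < d i.
  have [di0 _] := CdP i; apply: (lt_le_trans (rn i)); rewrite -[leRHS]lnK ?posrE // ler_expR.
  by rewrite lerNl; exact: (nP i).1.
have sS i : sepb (S i) (r i) (C i * r i `^ (- s)).
  by have [_] := CdP i; apply; rewrite r0 rd.
have rlt i j : (j < (n i).+1)%N -> r i < expR (- L j).
  by move=> ji; apply: lt_le_trans (rn i) _; rewrite ler_expR lerN2 rt_mono.
have [m] := bool_mass cS sS (fun i => ltW (r0 i)) rlt.
apply/negP; rewrite -ltNge.
apply: (@le_lt_trans _ _ (\sum_(i < m) 2^-1 ^+ i.+2)); last first.
  by have := sum_pow_lt R m; lra.
apply: ler_sum => i _; rewrite ler_pdivrMr ?exprn_gt0 // powR_expR //.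
rewrite ln_div ?posrE ?expR_gt0 // expRK.
apply: (@le_trans _ _ (expR (C i) * expR (- s * (- L (n i) - theta)))).
  by rewrite ler_wpM2r ?expR_ge0 // le_expR.
rewrite exprVn !pow2_expR -expRN -!expRD ler_expR; have [_] := nP i.
move: (L (n i)) (i.+2%:R : R) ((n i).+1%:R : R) (C i) => {H nP r r0 rn rd sS rlt} l p q e.
by lra.
Qed.

End Full.

End BooleanDimensions.

(** * Spaces with prescribed dimensions *)

Section CountableSpaces.
Variables (R : realType) (X : metricType R) (S : nat -> set X).
Hypothesis cS : [set: X] `<=` \bigcup_i S i.
Hypothesis S1 : forall i x y, S i x -> S i y -> x = y.

Lemma countable_dim_H : (dim_H X <= 0)%E.
Proof.
apply: ereal_le_approx => // s s0 _; apply: dim_H_le => // e e0.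
exists S; split=> // n; apply: (@le_trans _ _ 0%E); last by rewrite lee_fin ltW.
rewrite big_seq_cond; apply: (big_ind (fun x => x <= 0)%E) => //.
  by move=> x y x0 y0; rewrite -(adde0 0%E) leeD.
move=> i _; apply: (@le_trans _ _ (0 `^ s)%:E); last by rewrite powR0 ?lt0r_neq0.
by apply: diam_pow_le => // x y Sx Sy; rewrite (S1 Sx Sy) mdistxx.
Qed.

Lemma countable_dim_P (x0 : X) : (dim_P X <= 0)%E.
Proof.
apply: ereal_le_approx => // s s0 _; apply: (dim_P_le x0); first exact: ltW.
exists S; split=> // i; exists 1, 1; split=> // r /andP[r0 r1] l lS ls.
apply: (@le_trans _ _ 1).
  rewrite (ler_nat R _ 1); case: l lS ls => [|x [|y l]] lS //= => /andP[/andP[xy _] _].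
  by move: xy; rewrite (S1 (lS x _) (lS y _)) ?inE ?eqxx ?orbT // mdistxx ltNge ltW.
rewrite mul1r powR_expR // -expR0 ler_expR mulNr -mulrN.
by apply: mulr_ge0; [exact: ltW|rewrite oppr_ge0 ln_le0 // ltW].
Qed.

End CountableSpaces.

(** * Rates with prescribed growth *)

Section Rates.
Variable R : realType.
Local Notation theta := (ln 2 : R).

Lemma ln_nat_le (e : R) : 0 < e -> exists c : R, forall k : nat, ln k.+1%:R <= c + e * k%:R.
Proof.
move=> e0; pose M := Num.max 1 e^-1.
have M1 : 1 <= M by rewrite le_max lexx.
have Me : 1 <= M * e by rewrite -ler_pdivrMr // div1r le_max lexx orbT.
have M0 : 0 < M by exact: lt_le_trans M1.
exists (ln M) => k; rewrite -[e * _]expRK -lnM ?posrE ?expR_gt0 //.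
rewrite ler_ln ?posrE ?ltr0n ?mulr_gt0 ?expR_gt0 //.
apply: (@le_trans _ _ (M * (1 + e * k%:R))); last by rewrite ler_pM2l ?expR_ge1Dx.
rewrite mulrDr mulr1 mulrA -natr1 addrC; apply: lerD => //.
by rewrite -[leLHS]mul1r ler_wpM2r.
Qed.

Lemma linear_rate_oo (e : R) : 0 < e -> forall M : R, exists n : nat, M <= n%:R * e.
Proof.
move=> e0 M; exists (Num.truncn (M / e)).+1; rewrite -ler_pdivrMr //.
exact/ltW/truncnS_gt.
Qed.

Definition linear_rate (e : R) (e0 : 0 < e) : rate R.
Proof.
refine (@Rate R (fun k => k%:R * e) _ _ (linear_rate_oo e0)).
- by move=> i; rewrite mulr_ge0 // ltW.
- by move=> i j ij; rewrite ler_pM2r // ler_nat.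
Defined.

(** The weights are 1/(k + 1): powers of 2 outgrow every power of their quotients, which is the case
    a = +oo. *)
Definition log_rate : rate R.
Proof.
refine (@Rate R (fun k => ln k.+1%:R) _ _ _).
- by move=> i; rewrite ln_ge0 // ler1n.
- by move=> i j ij; rewrite ler_ln ?posrE ?ltr0n // ler_nat.
- move=> M; exists (Num.truncn (expR M)); rewrite -[leLHS]expRK.
  by rewrite ler_ln ?posrE ?expR_gt0 ?ltr0n // ltW // truncnS_gt.
Defined.

(* Under these conditions 2^(k-i) grows like the a-th power of the quotient of
   the i-th and k-th weights, and the full Boolean sequence space has all its
   metric dimensions equal to a. *)
Definition good_rate (a : \bar R) (L : rate R) : Prop :=
  [/\ forall s, 0 < s -> (a < s%:E)%E -> rate_ub L s,
      forall s, 0 < s -> (s%:E < a)%E -> rate_lb L s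
    & exists c : R, forall k : nat, ln k.+1%:R <= c + L k].

(** A linear rate of slope ln 2 / a for finite a, the logarithmic rate for a = +oo. In both cases a
    shift of the index by 2^(k^2) raises the rate at least to k^2 ln 2 up to a constant. *)
Lemma good_rate_exists (a : \bar R) : (0 < a)%E -> exists L, good_rate a L.
Proof.
have t0 := ln2_gt0 R; case: a => [a a0| _|//].
  rewrite lte_fin in a0; have e0 : 0 < theta / a by rewrite divr_gt0.
  have thE : theta = a * (theta / a) by rewrite mulrC divfK // gt_eqF.
  have km (i k : nat) : (i <= k)%N -> 0 <= (k%:R - i%:R) * (theta / a).
    by move=> ik; rewrite mulr_ge0 ?(ltW e0) // subr_ge0 ler_nat.
  exists (linear_rate e0); split=> [s s0|s s0|] /=.
  - rewrite lte_fin => as'; exists 0 => i k /km ik; rewrite add0r -mulrBl {1}thE.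
    by rewrite mulrCA ler_wpM2r // ltW.
  - rewrite lte_fin => sa; exists 0 => i k /km ik; rewrite add0r -mulrBl {2}thE.
    by rewrite [leRHS]mulrCA ler_wpM2r // ltW.
  - have [c Hc] := ln_nat_le e0; exists c => k.
    by have := Hc k; rewrite [_ * k%:R]mulrC.
exists log_rate; split=> [s s0|s s0 _|] /=; [by rewrite ltNge leey| |by exists 0 => k; rewrite add0r].
have [c Hc] := ln_nat_le (divr_gt0 t0 s0); exists (s * c) => i k ik.
have -> : (k%:R - i%:R) * theta = s * (theta / s * (k - i)%:R).
  by rewrite natrB // mulrA [s * _]mulrC divfK ?lt0r_neq0 // mulrC.
rewrite -mulrDr ler_pM2l //; apply: le_trans (Hc (k - i)%N).
rewrite lerBlDr -lnM ?posrE ?ltr0n // ler_ln ?posrE ?mulr_gt0 ?ltr0n // -natrM ler_nat.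
by rewrite mulSn mulnS; lia.
Qed.

Definition gap_rate (L : rate R) (g : nat -> nat)
  (gm : forall i j, (i <= j)%N -> (g i <= g j)%N) : rate R.
Proof.
refine (@Rate R (fun k => L (k + g k)%N) _ _ _).
- by move=> i; exact: rt_ge0.
- by move=> i j ij; rewrite rt_mono // leq_add // gm.
- move=> M; have [n Mn] := rt_oo L M; exists n; apply: le_trans Mn _.
  by rewrite rt_mono // leq_addr.
Defined.

(** The shifted indices are at least as far apart as i and k, so the upper bound survives. The lower
    bound need not, which is how the other dimensions are made to vanish. *)
Lemma gap_rate_ub L g gm s : rate_ub L s -> rate_ub (@gap_rate L g gm) s.
Proof.
move=> [c Hc]; exists c => i k ik /=.
have := Hc (i + g i)%N (k + g k)%N (leq_add ik (gm _ _ ik)); apply: le_trans.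
rewrite ler_pM2r ?ln2_gt0 // !natrD.
have : (g i)%:R <= (g k)%:R :> R by rewrite ler_nat gm.
by lra.
Qed.

Lemma ereal_between (s : R) (a : \bar R) : (s%:E < a)%E ->
  exists2 s' : R, s < s' & (s'%:E < a)%E.
Proof.
case: a => [a| _|//]; last by exists (s + 1); rewrite ?ltrDl // ltry.
by rewrite lte_fin => sa; exists ((s + a) / 2); rewrite ?lte_fin; lra.
Qed.

(* The lower growth bound, with the slack between s and a turned into a
   factor q < 1. *)
Lemma good_rate_lb (a : \bar R) L (s : R) : good_rate a L -> 0 < s -> (s%:E < a)%E ->
  exists c q : R, [/\ 0 < q, q < 1 & forall i k, (i <= k)%N ->
    s * (L k - L i) <= c + q * ((k%:R - i%:R) * theta)].
Proof.
move=> [_ lb _] s0 sa; have [s' ss' s'a] := ereal_between sa.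
have s'0 := lt_trans s0 ss'; have [c Hc] := lb s' s'0 s'a.
have q0 : 0 < s / s' by rewrite divr_gt0.
exists (s / s' * c), (s / s'); split=> //; first by rewrite ltr_pdivrMr // mul1r.
move=> i k ik; rewrite -mulrDr; have := Hc i k ik.
rewrite -(ler_pM2l q0); apply: le_trans; rewrite mulrA divfK ?gt_eqF //.
Qed.

End Rates.

Section Gaps.

(* [stair] waits until its gap 2^(stair k)^2 is negligible compared with k, then
   jumps to the current index. Shifting the weights by that gap leaves the
   packing dimension a, seen at the end of each wait, while the Hausdorff
   dimension drops to 0, seen after each jump. *)
Fixpoint stair (k : nat) : nat :=
  if k is k'.+1 then
    (if stair k' * 2 ^ (stair k' ^ 2) <= k'.+1 then k'.+1 else stair k')%N
  else 0%N.

Lemma stair_le k : (stair k <= k)%N.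
Proof. by elim: k => //= k IH; case: ifP => // _; exact: leqW. Qed.

Lemma stair_mono i j : (i <= j)%N -> (stair i <= stair j)%N.
Proof.
move=> /subnK <-; elim: (j - i)%N => // d IH; apply: leq_trans IH _.
by rewrite addSn /=; case: ifP => // _; apply: leq_trans (stair_le _) _.
Qed.

(** If no dip occurred after M, the stair would stay constant from M on, while n grows past the
    fixed right-hand side. *)
Lemma stair_dip M : exists2 n, (M <= n)%N &
  (stair n * 2 ^ (stair n ^ 2) <= n.+1)%N.
Proof.
apply: contrapT => H.
have {}H n : (M <= n)%N -> (n.+1 < stair n * 2 ^ (stair n ^ 2))%N.
  by move=> Mn; rewrite ltnNge; apply/negP => Hn; apply: H; exists n.
have cst d : stair (M + d) = stair M.
  elim: d => [|d IH]; rewrite ?addn0 // addnS /= leqNgt H ?leq_addr //.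
set B := (stair M * 2 ^ (stair M ^ 2))%N.
by have := H (M + B)%N (leq_addr _ _); rewrite cst -/B; lia.
Qed.

Lemma stair_jump M : exists2 n, (M <= n)%N & stair n = n.
Proof.
have [n Mn Hn] := stair_dip M; exists n.+1; first exact: leqW.
by rewrite /= Hn.
Qed.

Definition stair_gap k := (2 ^ (stair k ^ 2))%N.

Lemma stair_gap_mono i j : (i <= j)%N -> (stair_gap i <= stair_gap j)%N.
Proof. by move=> ij; rewrite leq_exp2l // leq_sqr stair_mono. Qed.

(* Constant on each block [2^m, 2^m.+1), which preserves the Assouad dimension,
   and large enough to make the box dimension 0. *)
Definition block_gap k := (2 ^ ((2 ^ (trunc_log 2 k).+1) ^ 2))%N.

Lemma block_gap_mono i j : (i <= j)%N -> (block_gap i <= block_gap j)%N.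
Proof.
by move=> ij; rewrite leq_exp2l // leq_sqr leq_exp2l // ltnS leq_trunc_log.
Qed.

Lemma block_gap_ge k : (2 ^ (k ^ 2) <= block_gap k)%N.
Proof. by rewrite leq_exp2l // leq_sqr ltnW // trunc_log_ltn. Qed.

Lemma leq_pow2_pred m : (2 ^ m <= (2 ^ m.+1).-1)%N.
Proof. by rewrite expnS; have := expn_gt0 2 m; lia. Qed.

Lemma block_gap_const m : block_gap (2 ^ m) = block_gap (2 ^ m.+1).-1.
Proof.
rewrite /block_gap (trunc_log_eq (n := m)) ?leqnn ?ltn_exp2l //.
rewrite (trunc_log_eq (n := m) (k := (2 ^ m.+1).-1)) //.
  by rewrite leq_pow2_pred /= prednK ?expn_gt0 ?leqnn.
by rewrite ltnSn.
Qed.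

End Gaps.

(** * The four Boolean pieces *)

Section Pieces.
Variable R : realType.
Local Notation theta := (ln 2 : R).

Lemma dim_chain (X : compactMetric R) :
  [/\ (upper_dim_B X <= dim_A X)%E, (dim_P X <= upper_dim_B X)%E
    & (dim_H X <= upper_dim_B X)%E].
Proof.
have [x0 _] := cm_nonempty X; have [D _ bD] := compact_bounded x0 (@cm_compact R X).
by split; [exact: dim_B_le_A bD|exact: dim_P_le_B|exact: dim_H_le_B].
Qed.

Lemma nat_ge (x : R) : exists n : nat, x <= n%:R.
Proof. by exists (Num.truncn x).+1; exact/ltW/truncnS_gt. Qed.

Lemma le_dim (a D : \bar R) : (0 <= D)%E ->
  (forall s : R, 0 < s -> (s%:E < a)%E -> ~ (D < s%:E)%E) -> (a <= D)%E.
Proof.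
move=> D0 H; apply: ereal_le_approx => // s s0 Ds; rewrite leNgt; apply/negP => sa.
exact: H Ds.
Qed.

Definition zero_dims (X : compactMetric R) : Prop :=
  [/\ (dim_T R X <= 0)%E, dim_H X = 0%E, dim_P X = 0%E, upper_dim_B X = 0%E
    & dim_A X = 0%E].

Definition point_dspace : dspace R.
Proof.
refine (@DSpace R unit (fun _ _ => 0) _ _ _ _) => //; first by case=> -[].
Defined.

Lemma point_exists : exists X, zero_dims X.
Proof.
have fin : finite_set [set: dtype point_dspace].
  apply: sub_finite_set (finite_set1 (tt : dtype point_dspace)).
  by move=> [].
pose X := @fin_cm R point_dspace tt fin; exists X.
have A0 : (dim_A X <= 0)%E := fin_dim_A fin.
have [BA PB HB] := dim_chain X; have B0 := le_trans BA A0.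
have eq0 (D : \bar R) : (0 <= D)%E -> (D <= 0)%E -> D = 0%E.
  by move=> D0 D0'; apply/eqP; rewrite eq_le D0 D0'.
split.
- exact: (fin_dim_T fin (tt : dtype point_dspace)).
- by apply: eq0; [exact: dim_H_ge0|exact: le_trans HB B0].
- by apply: eq0; [exact: dim_P_ge0|exact: le_trans PB B0].
- by apply: eq0 => //; exact: (upper_dim_B_ge0 (tt : X)).
- by apply: eq0; [exact: dim_A_ge0|].
Qed.

Lemma bool_cm_le (L : rate R) c a : (0 <= a)%E ->
  (forall s, 0 < s -> (a < s%:E)%E -> rate_ub L s) ->
  [/\ (dim_T R (bool_cm L c) <= 0)%E, (dim_H (bool_cm L c) <= a)%E,
      (dim_P (bool_cm L c) <= a)%E, (upper_dim_B (bool_cm L c) <= a)%E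
    & (dim_A (bool_cm L c) <= a)%E].
Proof.
move=> a0 ub; have A0 : (dim_A (bool_cm L c) <= a)%E by exact: bool_dim_A.
have [BA PB HB] := dim_chain (bool_cm L c); have B0 := le_trans BA A0.
split=> //; [exact: bool_dim_T|exact: le_trans HB B0|exact: le_trans PB B0].
Qed.

Lemma hausdorff_piece (a : \bar R) : (0 <= a)%E -> exists X : compactMetric R,
  [/\ (dim_T R X <= 0)%E, dim_H X = a, (dim_P X <= a)%E, (upper_dim_B X <= a)%E
    & (dim_A X <= a)%E].
Proof.
rewrite le_eqVlt => /orP[/eqP <-|a0].
  by have [X [TX HX PX BX AX]] := point_exists; exists X; rewrite HX PX BX AX.
have [L [ub lb _]] := good_rate_exists a0.
exists (bool_cm L (fun _ _ => true)).
have [T0 H0 P0 B0 A0] := bool_cm_le (fun _ _ => true) (ltW a0) ub; split=> //.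
apply/eqP; rewrite eq_le H0 le_dim ?dim_H_ge0 // => s s0 sa Hs.
by have := lt_dim_H s0 Hs; apply: full_hpow => //; exact: lb.
Qed.

Lemma packing_piece (a : \bar R) : (0 <= a)%E -> exists X : compactMetric R,
  [/\ (dim_T R X <= 0)%E, (dim_H X <= 0)%E, dim_P X = a, (upper_dim_B X <= a)%E
    & (dim_A X <= a)%E].
Proof.
rewrite le_eqVlt => /orP[/eqP <-|a0].
  by have [X [TX HX PX BX AX]] := point_exists; exists X; rewrite HX PX BX AX.
have t0 := ln2_gt0 R; have [L gL] := good_rate_exists a0; have [ub lb [b hb]] := gL.
pose L' := gap_rate L stair_gap_mono.
exists (bool_cm L' (fun _ _ => true)).
have [|T0 H0 P0 B0 A0] := @bool_cm_le L' (fun _ _ => true) a (ltW a0).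
  by move=> s s0 sa; apply: gap_rate_ub; exact: ub.
split=> //; last first.
- apply/eqP; rewrite eq_le P0 le_dim ?dim_P_ge0 // => s s0 sa Ps.
  have := lt_dim_P (bpt0 L' (fun _ _ => true)) s0 Ps; apply: full_ppow => // M.
  have [c [q [q0 q1 Hc]]] := good_rate_lb gL s0 sa.
  have [n1 Mn1] := rt_oo L M.
  have [k0 k0P] := nat_ge (2 / (1 - q)).
  have [k1 k1P] := nat_ge ((M + s * L 0%N + c) * 2 / (theta * (1 - q))).
  have [j jM jj] := stair_jump (maxn n1 (maxn k0 k1)).
  (* After the jump at [j] the stair is at least [k0], so at the later dip [n] the gap takes at most
     the part (1 - q) / 2 of n + 1. The other half of the slack 1 - q absorbs the constants. *)
  have [n jn Hn] := stair_dip j; exists n.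
  have bn : (k0 <= stair n)%N.
    apply: leq_trans (stair_mono jn); rewrite jj; apply: leq_trans jM.
    by rewrite !leq_max leqnn orbT.
  have Vn : (M + s * L 0%N + c) * 2 / (theta * (1 - q)) <= n.+1%:R.
    apply: le_trans k1P _; rewrite ler_nat; apply: leqW.
    by apply: leq_trans jn; apply: leq_trans jM; rewrite !leq_max leqnn !orbT.
  have n1n : (n1 <= n)%N.
    by apply: leq_trans jn; apply: leq_trans jM; rewrite !leq_max leqnn.
  split; first by apply: le_trans Mn1 _; rewrite rt_mono // (leq_trans n1n) // leq_addr.
  have gn : k0%:R * (stair_gap n)%:R <= n.+1%:R :> R.
    by rewrite -natrM ler_nat; apply: leq_trans Hn; rewrite leq_mul2r bn orbT.
  have := Hc 0%N (n + stair_gap n)%N (leq0n _); rewrite subr0 natrD => H1.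
  have g0 : 0 <= (stair_gap n)%:R :> R by [].
  have g1 : (stair_gap n)%:R <= (1 - q) / 2 * n.+1%:R.
    have q1' : 0 < 1 - q by rewrite subr_gt0.
    have h1 : 2 / (1 - q) * (stair_gap n)%:R <= n.+1%:R.
      by apply: le_trans gn; rewrite ler_wpM2r.
    have := ler_wpM2l (ltW q1') h1; rewrite mulrA mulrCA divff ?gt_eqF // mulr1; lra.
  have V2 : M + s * L 0%N + c <= n.+1%:R * (theta * (1 - q)) / 2.
    by move: Vn; rewrite ler_pdivrMr ?mulr_gt0 ?subr_gt0 //; lra.
  have qg : q * (stair_gap n)%:R * theta <= (1 - q) / 2 * n.+1%:R * theta.
    rewrite ler_pM2r //; apply: le_trans g1.
    by rewrite -[leRHS]mul1r ler_wpM2r // ltW.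
  have nn : q * n%:R * theta <= q * n.+1%:R * theta by rewrite ler_pM2r // ler_pM2l // ler_nat.
  rewrite /=; lra.
(* At a jump the stair equals n, so [L' n] is at least n^2 ln 2 up to a constant and s * L' n
   exceeds n ln 2 by any given amount. *)
apply: ereal_le_approx => // s s0 _; apply: dim_H_le => //; apply: bool_hpow => // M.
have [u Hu] := nat_ge (1 / s + 1); have [v Hv] := nat_ge ((M + s * b) / (s * theta)).
have [n nn nE] := stair_jump (maxn u v); exists n.
have un : 1 / s + 1 <= n%:R.
  by apply: le_trans Hu _; rewrite ler_nat; apply: leq_trans nn; rewrite leq_maxl.
have Vn : (M + s * b) / (s * theta) <= n%:R.
  by apply: le_trans Hv _; rewrite ler_nat; apply: leq_trans nn; rewrite leq_maxr.
have Ln : n%:R * n%:R * theta <= b + L' n.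
  apply: le_trans (hb _); rewrite -natrM -[leLHS]expRK -pow2_expR ler_ln ?posrE ?exprn_gt0 //.
  rewrite -natrX ler_nat /stair_gap nE -mulnn; apply: leqW; exact: leq_addl.
have n0 : 0 <= n%:R :> R by [].
have h1 : s * (n%:R * n%:R * theta) <= s * (b + L' n) by rewrite ler_pM2l.
have h2 : M + s * b <= n%:R * (s * theta).
  by rewrite -ler_pdivrMr // mulr_gt0.
have h3 : n%:R * (s * theta) * (1 / s + 1) <= n%:R * (s * theta) * n%:R.
  by rewrite ler_wpM2l // mulr_ge0 // mulr_ge0 // ltW.
have h4 : n%:R * (s * theta) * (1 / s + 1) = n%:R * theta + n%:R * (s * theta).
  by rewrite mulrDr mulr1 div1r -mulrA (mulrC s) mulfK ?gt_eqF.
lra.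
Qed.

Lemma box_piece (a : \bar R) : (0 <= a)%E -> exists X : compactMetric R,
  [/\ (dim_T R X <= 0)%E, (dim_H X <= 0)%E, (dim_P X <= 0)%E, upper_dim_B X = a
    & (dim_A X <= a)%E].
Proof.
rewrite le_eqVlt => /orP[/eqP <-|a0].
  by have [X [TX HX PX BX AX]] := point_exists; exists X; rewrite HX PX BX AX.
have t0 := ln2_gt0 R; have [L gL] := good_rate_exists a0; have [ub lb _] := gL.
(* A sequence starting at i ends before (i+1)^2: there are only countably many,
   but the blocks [i, (i+1)^2) are full, which forces box dimension a. *)
pose c (i j : nat) := (j < i.+1 * i.+1)%N.
exists (bool_cm L c).
have [T0 H0 P0 B0 A0] := bool_cm_le c (ltW a0) ub.
pose x0 := bpt0 L c.
(* Every point is a finite word padded with zeros, and [unpickle] enumerates the words. *)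
pose S i : set (dtype (seqspace (rweight L) (bseq R c))) :=
  [set x | exists2 p : seq bool, unpickle i = Some p & bit x =1 nth false p].
have cS : setT `<=` \bigcup_i S i.
  move=> x _; have [[i xi]|nx] := pselect (exists i, bit x i).
    exists (pickle (mkseq (bit x) (i.+1 * i.+1))) => //.
    exists (mkseq (bit x) (i.+1 * i.+1)); first exact: pickleK.
    move=> j; have [ji|ij] := ltnP j (i.+1 * i.+1); first by rewrite nth_mkseq.
    rewrite nth_default ?size_mkseq //; apply/negbTE/negP => xj.
    have bx : bset c (seq_of x) := svalP x.
    by have [_ /(_ xi xj)] := bx i j; rewrite /c ltnNge ij.
  exists (pickle ([::] : seq bool)) => //; exists [::]; first exact: pickleK.
  by move=> j; rewrite nth_nil; apply/negbTE/negP => xj; apply: nx; exists j.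
have S1 i x y : S i x -> S i y -> x = y.
  move=> [p ip xp] [q]; rewrite ip => -[<-] yp; apply: sdist_eq0; apply/eqP.
  rewrite eq_le; apply/andP; split; last exact: (mdist_ge0 x y).
  apply: sdist_le => j.
  by rewrite !(@bitE R L c) xp yp subrr normr0 mulr0.
split=> //.
- exact: countable_dim_H cS S1.
- exact: (countable_dim_P cS S1 x0).
apply/eqP; rewrite eq_le B0 le_dim ?(upper_dim_B_ge0 x0) // => s s0 sa Bs.
have := lt_upper_dim_B s0 Bs; apply: bpow_blocks => // M.
have [b [q [q0 q1 Hb]]] := good_rate_lb gL s0 sa.
have [n1 Mn1] := rt_oo L M.
have q1' : 0 < 1 - q by rewrite subr_gt0.
(* The choice gives 2 * (i + 1) <= (1 - q) * k for k = (i + 1)^2: one half pays for the i bits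
   before the block, the other for the constants. *)
have [i [n1i iq iV]] : exists i : nat, [/\ (n1 <= i)%N, 2 / (1 - q) <= i.+1%:R &
    (M + s * L 0%N + b) / theta <= i%:R].
  have [i0 Hi0] := nat_ge (2 / (1 - q)).
  have [i1 Hi1] := nat_ge ((M + s * L 0%N + b) / theta).
  exists (maxn n1 (maxn i0 i1)); split; first by rewrite leq_maxl.
    by apply: le_trans Hi0 _; rewrite ler_nat; apply: leqW; rewrite !leq_max leqnn orbT.
  by apply: le_trans Hi1 _; rewrite ler_nat !leq_max leqnn !orbT.
pose k := (i.+1 * i.+1)%N; exists i, k.
have ik : (i < k)%N by rewrite /k mulSn ltn_addr.
split=> //.
- move=> j j' /andP[ij _] /andP[_ j'k]; rewrite /c (leq_trans j'k) // /k.
  by rewrite leq_mul.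
- apply: le_trans Mn1 _; rewrite rt_mono //; apply: leq_trans n1i _.
  by rewrite /k /= leq_addr.
have := Hb 0%N k.-1 (leq0n _); rewrite subr0 => H1.
have kk : (k.-1)%:R <= k%:R :> R by rewrite ler_nat leq_pred.
have h1 : q * (k.-1%:R * theta) <= q * (k%:R * theta) by rewrite ler_pM2l // ler_pM2r.
have h2 : 2 * i.+1%:R <= (1 - q) * k%:R.
  rewrite /k natrM mulrA ler_wpM2r // mulrC; move: iq.
  by rewrite ler_pdivrMr.
have h3 : 2 * i.+1%:R * theta <= (1 - q) * k%:R * theta by rewrite ler_pM2r.
have h4 : M + s * L 0%N + b <= i%:R * theta by rewrite -ler_pdivrMr.
have h5 : i.+1%:R = i%:R + 1 :> R by rewrite natr1.
by rewrite h5 in h3; lra.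
Qed.

Lemma assouad_piece (a : \bar R) : (0 <= a)%E -> exists X : compactMetric R,
  [/\ (dim_T R X <= 0)%E, (dim_H X <= 0)%E, (dim_P X <= 0)%E,
      (upper_dim_B X <= 0)%E & dim_A X = a].
Proof.
rewrite le_eqVlt => /orP[/eqP <-|a0].
  by have [X [TX HX PX BX AX]] := point_exists; exists X; rewrite HX PX BX AX.
have t0 := ln2_gt0 R; have [L gL] := good_rate_exists a0; have [ub lb [b hb]] := gL.
pose L' := gap_rate L block_gap_mono.
pose X := bool_cm L' (fun _ _ => true); exists X.
have [|T0 _ _ _ A0] := @bool_cm_le L' (fun _ _ => true) a (ltW a0).
  by move=> s s0 sa; apply: gap_rate_ub; exact: ub.
have B0 : (upper_dim_B X <= 0)%E.
  apply: ereal_le_approx => // s s0 _; apply: upper_dim_B_le; apply: bool_bpow => //.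
  (* From k <= 1 / s + s * k^2 and the lower bound k^2 ln 2 - b for [L' k]. *)
  exists (theta / s + s * b) => k.
  have Lk : k%:R * k%:R * theta <= b + L' k.
    apply: le_trans (hb _); rewrite -natrM -[leLHS]expRK -pow2_expR ler_ln ?posrE ?exprn_gt0 //.
    rewrite -natrX ler_nat mulnn; apply: leqW; apply: leq_trans (leq_addl _ _).
    exact: block_gap_ge.
  have h1 : s * (k%:R * k%:R * theta) <= s * (b + L' k) by rewrite ler_pM2l.
  have h2 : k%:R <= 1 / s + s * (k%:R * k%:R) :> R.
    have [ks|ks] := leP k%:R (1 / s).
      by rewrite -[leLHS]addr0 lerD // mulr_ge0 ?(ltW s0).
    rewrite -[leLHS]add0r lerD ?divr_ge0 ?(ltW s0) // mulrA -[leLHS]mul1r ler_wpM2r //.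
    by move: ks; rewrite ltr_pdivrMr // mulrC => /ltW.
  have h3 : k%:R * theta <= (1 / s + s * (k%:R * k%:R)) * theta by rewrite ler_pM2r.
  have h4 : (1 / s) * theta = theta / s by rewrite div1r mulrC.
  by lra.
have [_ PB HB] := dim_chain X.
split=> //; [exact: le_trans HB B0|exact: le_trans PB B0|].
apply/eqP; rewrite eq_le A0 le_dim ?dim_A_ge0 // => s s0 sa As.
have := lt_dim_A As; apply: apow_blocks => // M.
have [c [q [q0 q1 Hc]]] := good_rate_lb gL s0 sa.
have q1' : 0 < 1 - q by rewrite subr_gt0.
have [m Hm] := nat_ge ((M + c) / ((1 - q) * theta)).
(* Both ends of this block have the same gap, so over it [L'] grows like [L] over 2^m consecutive
   indices, and the slack (1 - q) * 2^m * ln 2 exceeds any constant for large m. *)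
exists (2 ^ m)%N, (2 ^ m.+1).-1.
have mp : (m < 2 ^ m)%N by rewrite ltn_expl.
have ik := leq_pow2_pred m.
split=> //; rewrite /= -block_gap_const.
have := Hc (2 ^ m + block_gap (2 ^ m))%N ((2 ^ m.+1).-1 + block_gap (2 ^ m))%N.
rewrite leq_add2r => /(_ ik); rewrite !natrD.
have -> : (2 ^ m.+1).-1.+1 = (2 ^ m.+1)%N by rewrite prednK // expn_gt0.
have e1 : ((2 ^ m.+1).-1)%:R = 2 * (2 ^ m)%:R - 1 :> R.
  by rewrite -subn1 natrB ?expn_gt0 // expnS natrM.
have e2 : (2 ^ m.+1)%:R = 2 * (2 ^ m)%:R :> R by rewrite expnS natrM.
rewrite e1 e2.
have mp' : m%:R <= (2 ^ m)%:R :> R by rewrite ler_nat ltnW.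
have h1 : M + c <= m%:R * ((1 - q) * theta).
  by rewrite -ler_pdivrMr ?mulr_gt0.
have h2 : m%:R * ((1 - q) * theta) <= (2 ^ m)%:R * ((1 - q) * theta).
  by rewrite ler_pM2r // mulr_gt0.
move: ((2 ^ m)%:R : R) h2 => p h2.
have qt : 0 < q * theta by rewrite mulr_gt0.
move: (L _) (L _) => u v; lra.
Qed.

End Pieces.

(** * Assembly of a space with the five prescribed dimensions *)

Section Assembly.
Variable R : realType.

Lemma wedge_exists (X Y : compactMetric R) : (dim_T R Y <= dim_T R X)%E ->
  exists Z : compactMetric R, [/\ dim_T R Z = dim_T R X,
    dim_H Z = maxe (dim_H X) (dim_H Y), dim_P Z = maxe (dim_P X) (dim_P Y),
    upper_dim_B Z = maxe (upper_dim_B X) (upper_dim_B Y)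
  & dim_A Z = maxe (dim_A X) (dim_A Y)].
Proof.
move=> TYX; have [x0 _] := cm_nonempty X; have [y0 _] := cm_nonempty Y.
exists (cwedge x0 y0 1 1); split.
- exact: cwedge_dim_T.
- exact: cwedge_dim_H.
- exact: cwedge_dim_P.
- exact: cwedge_dim_B.
- exact: cwedge_dim_A.
Qed.

Lemma cube_exists (l : \bar R) : l = +oo%E \/ (exists n : nat, l = n%:R%:E) ->
  exists X : compactMetric R, dim_T R X = l /\ (dim_A X <= l)%E.
Proof.
case=> [->|[n ->]].
  by exists (cube_cm R xpredT); split; [exact: hilbert_dim_T|exact: leey].
exists (cube_cm R (fun i => i < n)%N); split; [exact: fcube_dim_T|exact: fcube_dim_A].
Qed.

Lemma has_dims_exists (l a1 a2 a3 a4 : \bar R) :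
  l = +oo%E \/ (exists n : nat, l = n%:R%:E) ->
  (0 <= a1)%E -> (0 <= a2)%E -> (0 <= a3)%E -> (0 <= a4)%E ->
  (l <= a1)%E -> (a1 <= a2)%E -> (a2 <= a3)%E -> (a3 <= a4)%E ->
  exists B : compactMetric R, has_dims l a1 a2 a3 a4 B.
Proof.
move=> hl a10 a20 a30 a40 la1 a12 a23 a34.
have l0 : (0 <= l)%E by case: hl => [->|[n ->]]; rewrite ?lee_fin.
have a13 := le_trans a12 a23; have a14 := le_trans a13 a34.
have a24 := le_trans a23 a34.
have [P [TP AP]] := cube_exists hl; have [BP PP HP] := dim_chain P.
have {}AP := le_trans AP la1; have {}BP := le_trans BP AP.
have {}PP := le_trans PP BP; have {}HP := le_trans HP BP.
have [C1 [T1 H1 P1 B1 A1]] := hausdorff_piece a10.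
have [C2 [T2 H2 P2 B2 A2]] := packing_piece a20.
have [C3 [T3 H3 P3 B3 A3]] := box_piece a30.
have [C4 [T4 H4 P4 B4 A4]] := assouad_piece a40.
have [|Z1 [TZ1 HZ1 PZ1 BZ1 AZ1]] := @wedge_exists P C1; first by rewrite TP (le_trans T1).
have [|Z2 [TZ2 HZ2 PZ2 BZ2 AZ2]] := @wedge_exists Z1 C2; first by rewrite TZ1 TP (le_trans T2).
have [|Z3 [TZ3 HZ3 PZ3 BZ3 AZ3]] := @wedge_exists Z2 C3.
  by rewrite TZ2 TZ1 TP (le_trans T3).
have [|Z4 [TZ4 HZ4 PZ4 BZ4 AZ4]] := @wedge_exists Z3 C4.
  by rewrite TZ3 TZ2 TZ1 TP (le_trans T4).
exists Z4; split.
- by rewrite TZ4 TZ3 TZ2 TZ1.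
- rewrite HZ4 HZ3 HZ2 HZ1 H1 (max_r HP).
  by rewrite !max_l // (le_trans _ a10).
- rewrite PZ4 PZ3 PZ2 PZ1 P2 [X in maxe (maxe X _) _]max_r.
    by rewrite !max_l // (le_trans _ a20).
  by rewrite ge_max (le_trans PP) // (le_trans P1).
- rewrite BZ4 BZ3 BZ2 BZ1 B3 [X in maxe X _]max_r.
    by rewrite max_l // (le_trans _ a30).
  by rewrite !ge_max (le_trans BP) // (le_trans B1) // (le_trans B2).
- rewrite AZ4 AZ3 AZ2 AZ1 A4 max_r // !ge_max (le_trans AP) // (le_trans A1) //.
  by rewrite (le_trans A2) // (le_trans A3).
Qed.

End Assembly.

Theorem corollary1p4 (R : realType) (l a1 a2 a3 a4 : \bar R)
    (hl : l = +oo%E \/ exists n : nat, l = (n%:R)%:E)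
    (ha1 : (0 <= a1)%E) (ha2 : (0 <= a2)%E)
    (ha3 : (0 <= a3)%E) (ha4 : (0 <= a4)%E)
    (hla1 : (l <= a1)%E) (ha12 : (a1 <= a2)%E)
    (ha23 : (a2 <= a3)%E) (ha34 : (a3 <= a4)%E) :
  [/\ path_connected R (D_set l a1 a2 a3 a4),
      infinite_dimensional R (set_type (D_set l a1 a2 a3 a4))
    & dense (D_set l a1 a2 a3 a4)].
Proof.
have l0 : (0 <= l)%E by case: hl => [->|[n ->]]; rewrite ?lee_fin.
have [B hB] := has_dims_exists hl ha1 ha2 ha3 ha4 hla1 ha12 ha23 ha34.
split.
- exact: D_set_path_connected.
- exact: D_set_infinite_dimensional hB.
- exact: D_set_dense hB.
Qed.
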